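(* For all $P_1,P_2,N>0$ and $\sigma_2^2\ge0$, $$\mathcal C_{\mathrm{NoisyPartialFB}}(P_1,P_2,N,\sigma_2^2)\supseteq\mathcal R_{\mathrm P}(P_1,P_2,N,\sigma_2^2).$$
   Context: Channel model (noisy partial feedback). Fix $P_1,P_2,N>0$ and $\sigma_2^2\ge0$. Messages $M_1,M_2$ are independent and uniform on finite sets $\mathcal M_1,\mathcal M_2$. $\{Z_t\}$ is IID $\mathcal N(0,N)$, $\{W_{2,t}\}$ is IID $\mathcal N(0,\sigma_2^2)$, and $M_1,M_2,\{Z_t\},\{W_{2,t}\}$ are mutually independent. The output is $Y_t=X_{1,t}+X_{2,t}+Z_t$. Transmitter 1 has no feedback: $X_{1,t}=\varphi_{1,t}(M_1)$. Transmitter 2 observes causally $V_{2,t}=Y_t+W_{2,t}$: $X_{2,t}=\varphi_{2,t}(M_2,V_{2,1},\dots,V_{2,t-1})$. Encoders must satisfy $\frac1n\sum_{t=1}^n\mathbb E[X_{\nu,t}^2]\le P_\nu$, and the decoder is $\phi:\mathbb R^n\to\mathcal M_1\times\mathcal M_2$. Achievability of $(R_1,R_2)$: for every $\delta>0$ and all sufficiently large $n$ there is a blocklength-$n$ code with $\frac1n\log|\mathcal M_\nu|>R_\nu-\delta$ and error probability $\Pr[\phi(Y^n)\neq(M_1,M_2)]\to0$ as $n\to\infty$. $\mathcal C_{\mathrm{NoisyPartialFB}}(P_1,P_2,N,\sigma_2^2)$ is the set of achievable pairs. Region $\mathcal R_{\mathrm P}$. For a positive integer $\eta$, $\mathbf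 a_1,\mathbf a_2\in\mathbb R^\eta$, strictly lower-triangular $\mathsf B_2\in\mathbb R^{\eta\times\eta}$, $\mathsf C\in\mathbb R^{2\times\eta}$, let $\mathsf A=(\mathbf a_1\ \mathbf a_2)$ and $\mathsf Q_{\mathrm P}=N\mathsf I_\eta+\sigma_2^2\mathsf B_2\mathsf B_2^{\mathsf T}$. If $\mathsf C\mathsf C^{\mathsf T}$ is nonsingular, $\mathcal R^{N,\sigma_2^2}_{\mathrm P,\eta}(\mathbf a_1,\mathbf a_2,\mathsf B_2,\mathsf C)$ is the set of nonnegative $(R_1,R_2)$ with $R_1\le\frac1{2\eta}\log\frac{\det(\mathsf C(\mathbf a_1\mathbf a_1^{\mathsf T}+\mathsf Q_{\mathrm P})\mathsf C^{\mathsf T})}{\det(\mathsf C\mathsf Q_{\mathrm P}\mathsf C^{\mathsf T})}$, $R_2\le\frac1{2\eta}\log\frac{\det(\mathsf C(\mathbf a_2\mathbf a_2^{\mathsf T}+\mathsf Q_{\mathrm P})\mathsf C^{\mathsf T})}{\det(\mathsf C\mathsf Q_{\mathrm P}\mathsf C^{\mathsf T})}$, $R_1+R_2\le\frac1{2\eta}\log\frac{\det(\mathsf C(\mathsf A\mathsf A^{\mathsf T}+\mathsf Q_{\mathrm P})\mathsf C^{\mathsf T})}{\det(\mathsf C\mathsf Q_{\mathrm P}\mathsf C^{\mathsf T})}$; if $\mathsf C\mathsf C^{\mathsf T}$ is singular but $\mathsf C\ne0$, the same with $\mathsf C$ replaced by any nonzero row; if $\mathsf C=0$, $\{(0,0)\}$.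 Power constraints: $\mathbf a_1^{\mathsf T}\mathbf a_1\le\eta P_1$ and $\mathrm{tr}\big((\mathsf I_\eta-\mathsf B_2)^{-1}(\mathbf a_2\mathbf a_2^{\mathsf T}+\mathsf B_2\mathbf a_1\mathbf a_1^{\mathsf T}\mathsf B_2^{\mathsf T}+(N+\sigma_2^2)\mathsf B_2\mathsf B_2^{\mathsf T})(\mathsf I_\eta-\mathsf B_2)^{-\mathsf T}\big)\le\eta P_2$. $\mathcal R_{\mathrm P}(P_1,P_2,N,\sigma_2^2)$ is the closure of the union of $\mathcal R^{N,\sigma_2^2}_{\mathrm P,\eta}(\mathbf a_1,\mathbf a_2,\mathsf B_2,\mathsf C)$ over all $(\eta,\mathbf a_1,\mathbf a_2,\mathsf B_2,\mathsf C)$ satisfying the power constraints. *)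

(* Defs.v *)
From HB Require Import structures.
From mathcomp Require Import all_boot all_order all_algebra.
From mathcomp Require Import all_classical all_reals all_analysis.

Set Implicit Arguments.
Unset Strict Implicit.
Unset Printing Implicit Defensive.

Import Order.TTheory GRing.Theory Num.Theory.
Import numFieldNormedType.Exports.

Local Open Scope classical_set_scope.
Local Open Scope ring_scope.

Section NoisyPartialFB.
Variable R : realType.

Definition stdnormal := @normal_prob R 0 1.

(** [gauss_int k f] = E[f(G)] where G = ((A_0,B_0),...,(A_{k-1},B_{k-1}))
    has 2k IID standard normal coordinates (iterated integral). *)
Fixpoint gauss_int (k : nat) : (k.-tuple (R * R) -> \bar R) -> \bar R :=
  match k return (k.-tuple (R * R) -> \bar R) -> \bar R with
  | 0 => fun f => f [tuple]
  | k'.+1 => fun f =>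
      (\int[stdnormal]_a \int[stdnormal]_b
         gauss_int (fun g : k'.-tuple (R * R) => f [tuple of (a, b) :: g]))%E
  end.

(** A blocklength-n code: message sets are 'I_K1, 'I_K2.
    enc1 m t = X_{1,t};  enc2 m t v = X_{2,t} as a function of the whole
    vector v of feedback observations (causality imposed in [valid_code]);
    dec : R^n -> M1 x M2.  Time is indexed 0..n-1. *)
Record code (n : nat) := Code {
  K1 : nat;
  K2 : nat;
  enc1 : 'I_K1 -> nat -> R;
  enc2 : 'I_K2 -> nat -> n.-tuple R -> R;
  dec : n.-tuple R -> 'I_K1 * 'I_K2 }.
Arguments K1 {n} c.
Arguments K2 {n} c.
Arguments enc1 {n} c _ _.
Arguments enc2 {n} c _ _ _.
Arguments dec {n} c _.

Definition pad (n : nat) (s : seq R) : n.-tuple R :=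
  [tuple nth 0 s (val i) | i < n].

Definition valid_code (n : nat) (c : code n) : Prop :=
  [/\ (0 < K1 c)%N, (0 < K2 c)%N,
      (forall m (t : nat) (v v' : n.-tuple R),
          (forall i : 'I_n, (val i < t)%N -> tnth v i = tnth v' i) ->
          enc2 c m t v = enc2 c m t v'),
      (forall m (t : nat), (t < n)%N -> measurable_fun setT (enc2 c m t)) &
      (forall p, measurable (dec c @^-1` [set p]))].

Section Process.
Variables (N s2 : R) (n : nat) (c : code n) (m1 : 'I_(K1 c)) (m2 : 'I_(K2 c)).
Variable g : n.-tuple (R * R).

(** Z_t = sqrt N * A_t ~ N(0,N),  W_{2,t} = sqrt s2 * B_t ~ N(0,s2) *)
Definition Znoise (t : nat) : R := Num.sqrt N * (nth (0, 0) g t).1.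
Definition Wnoise (t : nat) : R := Num.sqrt s2 * (nth (0, 0) g t).2.

Definition X2of (t : nat) (past : seq R) : R := enc2 c m2 t (pad n past).
Definition Yof (t : nat) (past : seq R) : R :=
  enc1 c m1 t + X2of t past + Znoise t.

Fixpoint Vpast (k : nat) : seq R :=
  match k with
  | 0 => [::]
  | k'.+1 => let p := Vpast k' in rcons p (Yof k' p + Wnoise k')
  end.

Definition X2 (t : nat) : R := X2of t (Vpast t).
Definition Yout : n.-tuple R := [tuple Yof (val t) (Vpast (val t)) | t < n].
End Process.

Definition power1_ok (n : nat) (c : code n) (P1 : R) : Prop :=
  (\sum_(t < n) (K1 c)%:R^-1 * \sum_(m < K1 c) (enc1 c m t) ^+ 2
     <= n%:R * P1).

Definition power2_ok (N s2 : R) (n : nat) (c : code n) (P2 : R) : Prop :=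
  (\sum_(t < n) ((K1 c * K2 c)%:R^-1)%:E *
     \sum_(m1 < K1 c) \sum_(m2 < K2 c)
        gauss_int (fun g => ((X2 N s2 m1 m2 g t) ^+ 2)%:E)
   <= (n%:R * P2)%:E)%E.

Definition err_prob (N s2 : R) (n : nat) (c : code n) : \bar R :=
  (((K1 c * K2 c)%:R^-1)%:E *
     \sum_(m1 < K1 c) \sum_(m2 < K2 c)
        gauss_int (fun g =>
          (if dec c (Yout N s2 m1 m2 g) == (m1, m2) then 0 else 1)%:E))%E.

Definition achievable (P1 P2 N s2 : R) (r1 r2 : R) : Prop :=
  forall delta : R, 0 < delta ->
  exists (n0 : nat) (c : forall n : nat, code n),
    (forall n : nat, (n0 <= n)%N ->
       [/\ valid_code (c n),
           ln (K1 (c n))%:R / n%:R > r1 - delta,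
           ln (K2 (c n))%:R / n%:R > r2 - delta,
           power1_ok (c n) P1 & power2_ok N s2 (c n) P2]) /\
    (forall eps : R, 0 < eps -> exists n1 : nat, forall n : nat,
       (n1 <= n)%N -> (err_prob N s2 (c n) <= eps%:E)%E).

Definition C_NoisyPartialFB (P1 P2 N s2 : R) : set (R * R) :=
  [set p | achievable P1 P2 N s2 p.1 p.2].

Definition strictly_lower (eta : nat) (B : 'M[R]_eta) : Prop :=
  forall i j : 'I_eta, (val i <= val j)%N -> B i j = 0.

Definition QP (N s2 : R) (eta : nat) (B2 : 'M[R]_eta) : 'M[R]_eta :=
  N%:M + s2 *: (B2 *m B2^T).

Definition logdetratio (eta k : nat) (C : 'M[R]_(k, eta)) (M Q : 'M[R]_eta)
  : R :=
  (2 * eta%:R)^-1 * ln (\det (C *m (M + Q) *m C^T) / \det (C *m Q *m C^T)).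

Definition rate_bounds (N s2 : R) (eta k : nat) (a1 a2 : 'cV[R]_eta)
  (B2 : 'M[R]_eta) (C : 'M[R]_(k, eta)) (r1 r2 : R) : Prop :=
  let Q := QP N s2 B2 in
  [/\ 0 <= r1, 0 <= r2,
      r1 <= logdetratio C (a1 *m a1^T) Q,
      r2 <= logdetratio C (a2 *m a2^T) Q &
      r1 + r2 <= logdetratio C (row_mx a1 a2 *m (row_mx a1 a2)^T) Q].

Definition R_P_eta (N s2 : R) (eta : nat) (a1 a2 : 'cV[R]_eta)
  (B2 : 'M[R]_eta) (C : 'M[R]_(2, eta)) : set (R * R) :=
  [set p |
    if (C *m C^T) \in unitmx then rate_bounds N s2 a1 a2 B2 C p.1 p.2
    else if C != 0 then
      exists i : 'I_2, row i C != 0 /\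
        rate_bounds N s2 a1 a2 B2 (row i C) p.1 p.2
    else p = (0, 0)].

Definition power_P1 (P1 : R) (eta : nat) (a1 : 'cV[R]_eta) : Prop :=
  (a1^T *m a1) 0 0 <= eta%:R * P1.

Definition power_P2 (P2 N s2 : R) (eta : nat) (a1 a2 : 'cV[R]_eta)
  (B2 : 'M[R]_eta) : Prop :=
  let IB := invmx (1%:M - B2) in
  \tr (IB *m (a2 *m a2^T + B2 *m (a1 *m a1^T) *m B2^T
              + (N + s2) *: (B2 *m B2^T)) *m IB^T) <= eta%:R * P2.

Definition R_P (P1 P2 N s2 : R) : set (R * R) :=
  closure (\bigcup_(eta in [set k : nat | (0 < k)%N])
    [set p | exists (a1 a2 : 'cV[R]_eta) (B2 : 'M[R]_eta) (C : 'M[R]_(2, eta)),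
       [/\ strictly_lower B2, power_P1 P1 a1, power_P2 P2 N s2 a1 a2 B2 &
           R_P_eta N s2 a1 a2 B2 C p]]).

End NoisyPartialFB.

(* Main.v *)
Require Import Defs.
From HB Require Import structures.
From mathcomp Require Import all_boot all_order all_algebra.
From mathcomp Require Import all_classical all_reals all_analysis.
From mathcomp Require Import measurable_realfun.
From mathcomp Require Import ring lra.
Set Implicit Arguments.
Unset Strict Implicit.
Unset Printing Implicit Defensive.
Import Order.TTheory GRing.Theory Num.Theory.
Import numFieldNormedType.Exports.
Local Open Scope classical_set_scope.
Local Open Scope ring_scope.

(**
Over a block of [eta] channel uses the feedback loop is linear, and
[(I - B2) Y = a1 u1 + a2 u2 + Z + B2 W]: the block is a vector multiple-access
channel with scalar inputs and noise covariance [QP].  With [h_i = C a_i] and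
[Q = C QP C^T], the pair [h_i^T Q^-1 C (I - B2) Y] is a sufficient statistic,
of the form [S (x1, x2) + N(0, S)] with [S = (h_i^T Q^-1 h_j)], and the three
rate bounds are the mutual informations of this two-dimensional channel for
standard normal inputs, because
[det (Q + V V^T) / det Q = det (1 + V^T Q^-1 V)].

These mutual informations are achieved by Gaussian random codebooks and a
threshold decoder on the information densities.  A wrong codeword has
information density at least [tau] with probability at most [exp (- tau)],
since [exp] of the density has mean one for every channel output; the sent
codewords fall below the threshold with exponentially small probability by a
Chernoff bound.  The same average over codebooks also controls the empirical
powers and the cross-correlation of the two codebooks, so a single pair of
codebooks satisfies all the constraints once the inputs are scaled by
[(1 + eps)^(-1/2)].  All the expectations reduce, coordinate by coordinate, to
[E exp (b x + a x^2)] for a standard normal [x].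
*)

(** * Gaussian integrals *)

(** Every bad event enters through an exponential majorant that is at least one on it, so the error
    indicator is bounded pointwise and every expectation is a Gaussian integral in closed form. One
    averaged sum then yields the error bound and all codebook constraints together: the power and
    correlation terms do not involve the noise, so an average below one gives, by [1 + x <= exp x],
    a linear inequality on the message averages, and no codeword has to be expurgated.

    The correlation of the codebooks matters because feedback makes transmitter 2 resend [x1]
    through [B2 a1]: its power contains a cross term whose coefficient has a fixed sign, and only
    that sign of the correlation has to be bounded.

    No two-dimensional density is used. The joint test rests on
    [det (1 + S) = (1 + s11) (1 + s22')], where [s22'] belongs to the scalar channel of [x2] with
    [x1] counted as Gaussian noise.

    Channel uses after the last complete block are silent; they cost the constant
    [exp (h (r1 + r2))] in the error bound. *)

Lemma ge0_integral_mono d (T : measurableType d) (R : realType)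
    (mu : {measure set T -> \bar R}) (f g : T -> \bar R) :
  (forall x, 0 <= f x)%E -> (forall x, f x <= g x)%E ->
  (\int[mu]_x f x <= \int[mu]_x g x)%E.
Proof.
move=> f0 fg.
have g0 x : (0 <= g x)%E by exact: le_trans (fg x).
rewrite !ge0_integralTE//; apply: ereal_sup_le => _ /= [h hf <-].
by exists h => // x; exact: le_trans (fg x).
Qed.

Import HBNNSimple.

(** The hypothesis is the claim for indicators; linearity extends it to simple functions and
    monotone convergence to all nonnegative measurable [f]. *)
Lemma ge0_integral_density d (T : measurableType d) (R : realType)
    (mu nu : {measure set T -> \bar R}) (g : T -> R) (f : T -> \bar R) :
  measurable_fun setT g -> (forall x, 0 <= g x) ->
  (forall A, measurable A -> nu A = \int[mu]_(x in A) (g x)%:E)%E ->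
  measurable_fun setT f -> (forall x, 0 <= f x)%E ->
  (\int[nu]_x f x = \int[mu]_x (f x * (g x)%:E))%E.
Proof.
move=> mgr gr0 nuE mf f0; pose G x := (g x)%:E.
have mg : measurable_fun setT G by exact/measurable_EFinP.
have g0 x : (0 <= G x)%E by rewrite lee_fin.
pose h := nnsfun_approx measurableT mf.
have hf x : (fun n => (h n x)%:E) @ \oo --> f x.
  by apply: cvg_nnsfun_approx => // *; exact: f0.
have hnd x : nondecreasing_seq (fun n => (h n x)%:E).
  by move=> a b ab; rewrite lee_fin; exact/lefP/nd_nnsfun_approx.
have key (u : {nnsfun T >-> R}) : (\int[nu]_x (u x)%:E =
   \int[mu]_x ((u x)%:E * G x))%E.
  under eq_integral do rewrite fimfunE -fsumEFin//.
  rewrite ge0_integral_fsum//; last 2 first.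
  - by move=> r; exact/measurable_EFinP/measurable_funM.
  - by move=> r x _; rewrite nnfun_muleindic_ge0.
  transitivity (\sum_(r \in range u) \int[mu]_x
     ((r * \1_(u @^-1` [set r]) x)%:E * G x))%E; last first.
    rewrite -ge0_integral_fsum//; last 2 first.
    - move=> r; apply: emeasurable_funM => //.
      exact/measurable_EFinP/measurable_funM.
    - by move=> r x _; rewrite mule_ge0// nnfun_muleindic_ge0.
    apply: eq_integral => x _; rewrite -ge0_mule_fsuml; last first.
      by move=> r; rewrite nnfun_muleindic_ge0.
    by rewrite fsumEFin// -fimfunE.
  apply: eq_fsbigr => r _; rewrite integralZl_indic_nnsfun// integral_indic//=.
  rewrite setIT; under [RHS]eq_integral do rewrite EFinM -muleA.
  (* A scalar is pulled out of the integral only when nonnegative; for [r < 0] the level set of the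
     nonnegative [u] is empty and both sides vanish. *)
  have [r0|r0] := ltP r 0.
    rewrite preimage_nnfun0//= measure0 mule0; apply/esym/integral0_eq => x _.
    by rewrite indic0 mul0e mule0.
  rewrite ge0_integralZl//; last 2 first.
  - apply: emeasurable_funM => //; exact/measurable_EFinP/measurable_indic.
  - by move=> x _; rewrite mule_ge0// lee_fin.
  rewrite nuE// integral_mkcond; congr (_ * _)%E; apply: eq_integral => x _.
  by rewrite patchE indicE; case: ifPn; rewrite ?mul1e ?mul0e.
transitivity (limn (fun n => \int[nu]_x (h n x)%:E)%E).
  rewrite -monotone_convergence//.
  - by apply: eq_integral => x _; apply/esym/cvg_lim => //; exact: hf.
  - by move=> n; exact/measurable_EFinP.
  - by move=> n x _; rewrite lee_fin.
transitivity (limn (fun n => \int[mu]_x ((h n x)%:E * G x))%E).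
  by congr (limn _); apply/funext => n; exact: key.
rewrite -monotone_convergence//.
- apply: eq_integral => x _; apply/cvg_lim => //.
  exact: (cvgeZr _ (hf x)).
- move=> n; apply: emeasurable_funM => //; exact/measurable_EFinP.
- by move=> n x _; rewrite mule_ge0// lee_fin.
- by move=> x _ a b ab; apply: lee_wpmul2r => //; exact: hnd.
Qed.

Lemma integral_normal_prob (R : realType) (m s : R)
    (f : measurableTypeR R -> \bar R) :
  measurable_fun setT f -> (forall x, 0 <= f x)%E ->
  (\int[normal_prob m s]_x f x =
   \int[lebesgue_measure]_x (f x * (normal_pdf m s x)%:E))%E.
Proof.
move=> mf f0; apply: ge0_integral_density => //.
- exact: measurable_normal_pdf.
- by move=> x; exact: normal_pdf_ge0.
Qed.

(** Completing the square: with [q = 1 - 2 a], the integrand times the N(0,1) density is a constant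
    times the density of N(b/q, 1/q), which integrates to one. *)
Lemma integral_expR_quad (R : realType) (a b : R) : 2 * a < 1 ->
  (\int[@stdnormal R]_x (expR (b * x + a * x ^+ 2))%:E =
   (expR (b ^+ 2 / (2 * (1 - 2 * a)) - ln (1 - 2 * a) / 2))%:E)%E.
Proof.
move=> a1; have q0 : 0 < 1 - 2 * a by rewrite subr_gt0.
have meas : measurable_fun setT (fun x : R => (expR (b * x + a * x ^+ 2))%:E).
  apply/measurable_EFinP; apply: measurableT_comp => //.
  apply: measurable_funD; apply: measurable_funM => //.
rewrite /stdnormal integral_normal_prob; [|exact: meas|by move=> x; rewrite lee_fin expR_ge0].
set q := 1 - 2 * a in q0 *.
pose s := Num.sqrt q^-1.
have s2 : s ^+ 2 = q^-1 by rewrite sqr_sqrtr// invr_ge0 ltW.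
have s0 : s != 0 by rewrite sqrtr_eq0 -ltNge invr_gt0.
have lnq : expR (- (ln q / 2)) = s.
  apply: (@pexpIrn _ 2) => //; rewrite ?nnegrE ?expR_ge0 ?sqrtr_ge0//.
  rewrite s2 -expRM_natl mulrN mulrCA divff// mulr1 expRN lnK//.
transitivity (\int[lebesgue_measure]_x
   ((expR (b ^+ 2 / (2 * q) - ln q / 2))%:E * (normal_pdf (b / q) s x)%:E))%E.
  apply: eq_integral => x _; rewrite -!EFinM; congr EFin.
  rewrite !normal_pdfE// /normal_fun /normal_peak.
  rewrite (expRD (b ^+ 2 / _)) lnq expr1n s2 subr0 mul1r.
  rewrite -[(q^-1 * pi) *+ 2]mulrnAr sqrtrM; last by rewrite invr_ge0 ltW.
  rewrite -/s (invfM s).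
  rewrite [RHS](_ : _ = (Num.sqrt (pi *+ 2))^-1 * (expR (b ^+ 2 / (2 * q)) *
     expR (- (x - b / q) ^+ 2 / (q^-1 *+ 2)))); last first.
    by field; rewrite s0 gt_eqF ?andbT// sqrtr_gt0 mulrn_wgt0// pi_gt0.
  rewrite mulrCA -!expRD; congr (_ * expR _).
  by rewrite /q; field; rewrite -/q gt_eqF.
rewrite ge0_integralZl//.
- by rewrite integral_normal_pdf mule1.
- by apply/measurable_EFinP; exact: measurable_normal_pdf.
- by move=> x _; rewrite lee_fin normal_pdf_ge0.
Qed.

(** * Product measures and independent samples *)

Definition tuple_cons (T : Type) n (x : T * n.-tuple T) : n.+1.-tuple T :=
  [tuple of x.1 :: x.2].

Lemma measurable_tuple_cons d (T : measurableType d) n :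
  measurable_fun setT (@tuple_cons T n).
Proof. exact: measurable_cons. Qed.

Section prod_prob.
Context d1 d2 (T : measurableType d1) (U : measurableType d2) (R : realType).
Variables (P : probability T R) (Q : probability U R).

(** A named copy of the product measure, so that it carries a probability structure and can itself
    be a factor of further products. *)
Definition prod_prob : set (T * U) -> \bar R := (P \x Q)%E.

HB.instance Definition _ := Measure.on prod_prob.

Lemma prod_probT : prod_prob setT = 1%E.
Proof.
rewrite /prod_prob -setXTT product_measure1E//.
by rewrite -[X in (X * _)%E]/(P setT) -[X in (_ * X)%E]/(Q setT)
  !probability_setT mule1.
Qed.

HB.instance Definition _ := Measure_isProbability.Build _ _ _ prod_prob prod_probT.

Variable f : T * U -> \bar R.
Hypothesis mf : measurable_fun setT f.
Hypothesis f0 : forall x, (0 <= f x)%E.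

Lemma integral_prod_prob :
  (\int[prod_prob]_z f z = \int[P]_x \int[Q]_y f (x, y))%E.
Proof. exact: fubini_tonelli1. Qed.

Lemma integral_prod_prob_swap :
  (\int[prod_prob]_z f z = \int[Q]_y \int[P]_x f (x, y))%E.
Proof. exact: fubini_tonelli2. Qed.

Lemma integral_swap :
  (\int[P]_x \int[Q]_y f (x, y) = \int[Q]_y \int[P]_x f (x, y))%E.
Proof. exact: fubini_tonelli. Qed.

Lemma measurable_integral_right :
  measurable_fun setT (fun x => \int[Q]_y f (x, y))%E.
Proof. exact: (measurable_fun_fubini_tonelli_F (m2 := Q) f). Qed.

Lemma measurable_integral_left :
  measurable_fun setT (fun y => \int[P]_x f (x, y))%E.
Proof. exact: (measurable_fun_fubini_tonelli_G (m1 := P) f). Qed.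

End prod_prob.

Lemma measurable_comp_fun d1 d2 d3 (W : measurableType d1) (T : measurableType d2)
    (U : measurableType d3) (f : T -> U) (g : W -> T) :
  measurable_fun setT f -> measurable_fun setT g ->
  measurable_fun setT (fun w => f (g w)).
Proof. by move=> mf mg; apply: (measurableT_comp mf mg). Qed.

Section prod3.
Context d1 d2 d3 (T : measurableType d1) (U : measurableType d2)
  (V : measurableType d3) (R : realType).
Variables (P : probability T R) (Q : probability U R) (S : probability V R).
Variable h : T * U * V -> \bar R.
Hypothesis mh : measurable_fun setT h.
Hypothesis h0 : forall x, (0 <= h x)%E.

(** The innermost variable is the one whose integral is known in closed form with the others frozen:
    here the first codebook or word, in the [zxy] variant the second. *)
Lemma integral_prod3_zyx :
  (\int[prod_prob (prod_prob P Q) S]_w h w =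
   \int[S]_z \int[Q]_y \int[P]_x h ((x, y), z))%E.
Proof.
rewrite integral_prod_prob_swap//; apply: eq_integral => z _.
rewrite (integral_prod_prob_swap _ _ (f := fun c => h (c, z)))//.
exact: measurable_comp_fun.
Qed.

Lemma integral_prod3_zxy :
  (\int[prod_prob (prod_prob P Q) S]_w h w =
   \int[S]_z \int[P]_x \int[Q]_y h ((x, y), z))%E.
Proof.
rewrite integral_prod_prob_swap//; apply: eq_integral => z _.
rewrite (integral_prod_prob _ _ (f := fun c => h (c, z)))//.
exact: measurable_comp_fun.
Qed.

End prod3.

Section cons_law.
Context d (T : measurableType d) (R : realType) (P : probability T R) (n : nat).
Variable Q : probability (n.-tuple T) R.

(** Law of a tuple with independent head and tail. Building [iid] from this step makes it unfold
    coordinate by coordinate, in the same order as [gauss_int]. *)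
Definition cons_law : set (n.+1.-tuple T) -> \bar R :=
  pushforward (prod_prob P Q) (@tuple_cons T n).

Let cons_law0 : cons_law set0 = 0%E.
Proof. by rewrite /cons_law /pushforward preimage_set0 measure0. Qed.

Let cons_law_ge0 A : (0 <= cons_law A)%E.
Proof. by rewrite /cons_law /pushforward measure_ge0. Qed.

Let cons_law_sigma_additive : semi_sigma_additive cons_law.
Proof.
move=> F mF tF mU; rewrite /cons_law /pushforward preimage_bigcup.
have mc A : measurable A -> measurable (@tuple_cons T n @^-1` A).
  by move=> mA; rewrite -[X in measurable X]setTI; exact: measurable_tuple_cons.
apply: measure_semi_sigma_additive.
- by move=> k; exact: mc.
- apply/trivIsetP => /= i j _ _ ij; rewrite -preimage_setI.
  by move/trivIsetP : tF => /(_ _ _ _ _ ij) ->//; rewrite preimage_set0.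
- by rewrite -preimage_bigcup; exact: mc.
Qed.

HB.instance Definition _ := isMeasure.Build _ _ _ cons_law
  cons_law0 cons_law_ge0 cons_law_sigma_additive.

Lemma cons_lawT : cons_law setT = 1%E.
Proof. by rewrite /cons_law /pushforward preimage_setT; exact: prod_probT. Qed.

HB.instance Definition _ := Measure_isProbability.Build _ _ _ cons_law cons_lawT.

Lemma integral_cons_law (f : n.+1.-tuple T -> \bar R) :
  measurable_fun setT f -> (forall x, 0 <= f x)%E ->
  (\int[cons_law]_t f t = \int[P]_x \int[Q]_t f (tuple_cons (x, t)))%E.
Proof.
move=> mf f0; have mc := @measurable_tuple_cons _ T n.
rewrite [LHS](@ge0_integral_pushforward _ _ _ _ _ _ mc (prod_prob P Q))//.
rewrite preimage_setT (integral_prod_prob _ _ (f := f \o @tuple_cons T n))//.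
- exact: measurableT_comp.
- by move=> x; exact: f0.
Qed.

End cons_law.

Section iid.
Context d (T : measurableType d) (R : realType) (P : probability T R).

Fixpoint iid (n : nat) : probability (n.-tuple T) R :=
  match n with
  | 0 => [the probability _ _ of \d_([tuple] : 0.-tuple T)]
  | n'.+1 => [the probability _ _ of cons_law P (iid n')]
  end.

Lemma integral_iid0 (f : 0.-tuple T -> \bar R) :
  measurable_fun setT f -> (\int[iid 0]_t f t = f [tuple])%E.
Proof. by move=> mf; rewrite /= integral_dirac// diracE mem_set// mul1e. Qed.

Lemma integral_iidS n (f : n.+1.-tuple T -> \bar R) :
  measurable_fun setT f -> (forall x, 0 <= f x)%E ->
  (\int[iid n.+1]_t f t = \int[P]_x \int[iid n]_t f (tuple_cons (x, t)))%E.
Proof. exact: integral_cons_law. Qed.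

Lemma integral_prob_cst d' (U : measurableType d') (Q : probability U R)
  (c : \bar R) : (\int[Q]_x c = c)%E.
Proof. by rewrite integral_cst// [X in (_ * X)%E]probability_setT mule1. Qed.

Lemma tnth_tuple_cons0 n (x : T) (t : n.-tuple T) :
  tnth (tuple_cons (x, t)) ord0 = x.
Proof. by []. Qed.

Lemma tnth_tuple_consS n (x : T) (t : n.-tuple T) i :
  tnth (tuple_cons (x, t)) (lift ord0 i) = tnth t i.
Proof. exact: tnthS. Qed.

Lemma integral_iid1 n (i : 'I_n) (f : T -> \bar R) :
  measurable_fun setT f -> (forall x, 0 <= f x)%E ->
  (\int[iid n]_t f (tnth t i) = \int[P]_x f x)%E.
Proof.
move=> mf f0; elim: n i => [[]//|n IH] i.
rewrite integral_iidS//; last first.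
  by apply: measurableT_comp => //; exact: measurable_tnth.
have [j ->|->] := unliftP ord0 i.
  under eq_integral => x _ do under eq_integral => t _ do rewrite tnth_tuple_consS.
  by under eq_integral do rewrite IH; rewrite integral_prob_cst.
under eq_integral => x _ do
  under eq_integral => t _ do rewrite tnth_tuple_cons0.
by under eq_integral do rewrite integral_prob_cst.
Qed.

Lemma integral_iid2 n (i j : 'I_n) (f : T * T -> \bar R) :
  measurable_fun setT f -> (forall x, 0 <= f x)%E -> i != j ->
  (\int[iid n]_t f (tnth t i, tnth t j) = \int[P]_x \int[P]_y f (x, y))%E.
Proof.
move=> mf f0; elim: n i j => [[]//|n IH] i j ij.
rewrite integral_iidS//; last first.
  apply: measurableT_comp => //; apply: measurable_fun_pair;
    exact: measurable_tnth.
have m1 y : measurable_fun setT (fun x => f (x, y)).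
  by apply: measurableT_comp => //; exact: measurable_fun_pair.
have m2 x : measurable_fun setT (fun y => f (x, y)).
  by apply: measurableT_comp => //; exact: measurable_fun_pair.
have [i' ei|ei] := unliftP ord0 i; have [j' ej|ej] := unliftP ord0 j; subst i j.
- transitivity (\int[P]_x \int[iid n]_t f (tnth t i', tnth t j'))%E.
    apply: eq_integral => x _; apply: eq_integral => t _.
    by rewrite !tnth_tuple_consS.
  rewrite integral_prob_cst IH//; by rewrite (inj_eq lift_inj) in ij.
- transitivity (\int[P]_y \int[iid n]_t f (tnth t i', y))%E.
    by apply: eq_integral => y _; apply: eq_integral => t _; rewrite tnth_tuple_consS.
  (* Here the head of the tuple is the second argument of [f], so the two integrals come out in the
     wrong order and Tonelli exchanges them. *)
  rewrite (integral_swap P P mf f0); apply: eq_integral => y _.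
  by rewrite (integral_iid1 _ (m1 y)).
- transitivity (\int[P]_x \int[iid n]_t f (x, tnth t j'))%E.
    by apply: eq_integral => x _; apply: eq_integral => t _; rewrite tnth_tuple_consS.
  by apply: eq_integral => x _; rewrite (integral_iid1 _ (m2 x)).
- by rewrite eqxx in ij.
Qed.

End iid.

(** * The iterated Gaussian integral of the channel model as an integral over independent samples *)

Section gauss.
Variable R : realType.

Local Notation mR := (measurableTypeR R).

Definition N01 : probability mR R := [the probability _ _ of @stdnormal R].

Definition N01pair : probability (mR * mR)%type R :=
  [the probability _ _ of prod_prob N01 N01].

(** Tonelli, applied once per time index to split the pair of standard normals; measurability of the
    partial integrals carries the induction. *)
Lemma gauss_intE k (f : k.-tuple (mR * mR) -> \bar R) :
  measurable_fun setT f -> (forall x, 0 <= f x)%E ->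
  gauss_int f = (\int[iid N01pair k]_g f g)%E.
Proof.
elim: k f => [|k IH] f mf f0; first by rewrite integral_iid0.
rewrite integral_iidS//.
have mc : measurable_fun setT (f \o @tuple_cons _ k).
  by apply: measurableT_comp => //; exact: measurable_tuple_cons.
have mI := @measurable_integral_right _ _ _ _ _ (iid N01pair k) _ mc (fun x => f0 _).
have I0 x : (0 <= \int[iid N01pair k]_t f (tuple_cons (x, t)))%E.
  exact: integral_ge0.
rewrite [RHS](integral_prod_prob N01 N01 mI I0).
rewrite [LHS]/=; apply: eq_integral => a _; apply: eq_integral => b _.
rewrite IH//.
pose h t : (mR * mR) * k.-tuple (mR * mR) := ((a, b), t).
have mh : measurable_fun setT h by exact: measurable_fun_pair.
exact: (measurableT_comp mc mh).
Qed.

Lemma gauss_int_ge0 k (f : k.-tuple (R * R) -> \bar R) :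
  (forall x, 0 <= f x)%E -> (0 <= gauss_int f)%E.
Proof.
elim: k f => [|k IH] f f0 //=.
by apply: integral_ge0 => a _; apply: integral_ge0 => b _; exact: IH.
Qed.

(** Each integral of a nonnegative function is a supremum over the simple functions below it, so
    monotonicity holds for arbitrary [f] and [g]. It is applied to the error indicator, with a
    measurable majorant on the right. *)
Lemma gauss_int_mono k (f g : k.-tuple (R * R) -> \bar R) :
  (forall x, 0 <= f x)%E -> (forall x, f x <= g x)%E ->
  (gauss_int f <= gauss_int g)%E.
Proof.
elim: k f g => [|k IH] f g f0 fg //=.
apply: ge0_integral_mono => a.
  by apply: integral_ge0 => b _; exact: gauss_int_ge0.
by apply: ge0_integral_mono => b; [exact: gauss_int_ge0|exact: IH].
Qed.

End gauss.

(** * Random coding *)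

Section measurable_projections.
Context d1 d2 d3 (W : measurableType d1) (T : measurableType d2)
  (U : measurableType d3).

Lemma measurable_tnth_fun n (f : W -> n.-tuple T) i :
  measurable_fun setT f -> measurable_fun setT (fun w => tnth (f w) i).
Proof. by move=> mf; apply: (measurableT_comp (measurable_tnth i) mf). Qed.

Lemma measurable_fst_fun (f : W -> T * U) :
  measurable_fun setT f -> measurable_fun setT (fun w => (f w).1).
Proof. by move=> mf; apply: (measurableT_comp measurable_fst mf). Qed.

Lemma measurable_snd_fun (f : W -> T * U) :
  measurable_fun setT f -> measurable_fun setT (fun w => (f w).2).
Proof. by move=> mf; apply: (measurableT_comp measurable_snd mf). Qed.

End measurable_projections.

Ltac measurable_projection :=
  lazymatch goal with
  | |- @measurable_fun _ _ _ _ _ (fun _ => ?c) => exact: measurable_cst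
  | |- @measurable_fun _ _ _ _ _ (fun w => w) => exact: measurable_id
  | |- @measurable_fun _ _ _ _ _ id => exact: measurable_id
  | |- @measurable_fun _ _ _ _ _ fst => exact: measurable_fst
  | |- @measurable_fun _ _ _ _ _ snd => exact: measurable_snd
  | |- @measurable_fun _ _ _ _ _ (fun w => fst w) => exact: measurable_fst
  | |- @measurable_fun _ _ _ _ _ (fun w => snd w) => exact: measurable_snd
  | |- @measurable_fun _ _ _ _ _ (fun w => (_, _)) =>
      apply: measurable_fun_pair; measurable_projection
  | |- @measurable_fun _ _ _ _ _ (fun w => tnth _ _) =>
      apply: measurable_tnth_fun; measurable_projection
  | |- @measurable_fun _ _ _ _ _ (fun w => fst _) =>
      apply: measurable_fst_fun; measurable_projection
  | |- @measurable_fun _ _ _ _ _ (fun w => snd _) =>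
      apply: measurable_snd_fun; measurable_projection
  | |- _ => idtac
  end.

Section random_coding.
Context dX (X : measurableType dX) dG (G : measurableType dG) (R : realType).
Variables (mu : probability X R) (nu : probability G R) (K1 K2 : nat).

Local Notation C1 := (K1.-tuple X).
Local Notation C2 := (K2.-tuple X).
Local Notation W := (prod_prob (prod_prob (iid mu K1) (iid mu K2)) nu).

Lemma integral_le_cst d (T : measurableType d) (P : probability T R)
    (f : T -> \bar R) (e : \bar R) :
  (forall x, 0 <= f x)%E -> (forall x, f x <= e)%E -> (\int[P]_x f x <= e)%E.
Proof.
by move=> f0 fe; rewrite -[leRHS](integral_prob_cst P); exact: ge0_integral_mono.
Qed.

(** The wrong codeword [m] is independent of the sent words and the noise, so all of these can be
    frozen and the uniform bound [e] applied to the integral over it alone. *)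
Lemma integral_confusion1 (F : X * (X * X * G) -> \bar R) (e : \bar R)
    (m m1 : 'I_K1) (m2 : 'I_K2) :
  measurable_fun setT F -> (forall x, 0 <= F x)%E ->
  (forall w, \int[mu]_x F (x, w) <= e)%E -> m1 != m ->
  (\int[W]_w F (tnth w.1.1 m, ((tnth w.1.1 m1, tnth w.1.2 m2), w.2)) <= e)%E.
Proof.
move=> mF F0 Fe mm1; rewrite integral_prod3_zyx//; last first.
  by apply: measurable_comp_fun => //; measurable_projection.
apply: integral_le_cst => g; first by do 2 (apply: integral_ge0 => ? _).
apply: integral_le_cst => c2; first by apply: integral_ge0.
rewrite /= (@integral_iid2 _ _ _ _ _ m1 m
  (fun p => F (p.2, ((p.1, tnth c2 m2), g))))//; last first.
  by apply: measurable_comp_fun => //; measurable_projection.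
by apply: integral_le_cst => y; [exact: integral_ge0|exact: (Fe (_, _, g))].
Qed.

Lemma integral_confusion2 (F : X * (X * X * G) -> \bar R) (e : \bar R)
    (m1 : 'I_K1) (m m2 : 'I_K2) :
  measurable_fun setT F -> (forall x, 0 <= F x)%E ->
  (forall w, \int[mu]_x F (x, w) <= e)%E -> m2 != m ->
  (\int[W]_w F (tnth w.1.2 m, ((tnth w.1.1 m1, tnth w.1.2 m2), w.2)) <= e)%E.
Proof.
move=> mF F0 Fe mm2; rewrite integral_prod3_zxy//; last first.
  by apply: measurable_comp_fun => //; measurable_projection.
apply: integral_le_cst => g; first by do 2 (apply: integral_ge0 => ? _).
apply: integral_le_cst => c1; first by apply: integral_ge0.
rewrite /= (@integral_iid2 _ _ _ _ _ m2 m
  (fun p => F (p.2, ((tnth c1 m1, p.1), g))))//; last first.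
  by apply: measurable_comp_fun => //; measurable_projection.
by apply: integral_le_cst => y; [exact: integral_ge0|exact: (Fe (_, _, g))].
Qed.

(** The integral over the first wrong word is not bounded by a constant; it leaves [F'], a function
    of the second wrong word, to which the one-word case applies. *)
Lemma integral_confusion12 (F : X * (X * (X * X * G)) -> \bar R)
    (F' : X * (X * X * G) -> \bar R) (e : \bar R)
    (m m1 : 'I_K1) (m' m2 : 'I_K2) :
  measurable_fun setT F -> (forall x, 0 <= F x)%E ->
  measurable_fun setT F' -> (forall x, 0 <= F' x)%E ->
  (forall x' w, \int[mu]_x F (x, (x', w)) <= F' (x', w))%E ->
  (forall w, \int[mu]_x F' (x, w) <= e)%E -> m1 != m -> m2 != m' ->
  (\int[W]_w F (tnth w.1.1 m, (tnth w.1.2 m',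
     ((tnth w.1.1 m1, tnth w.1.2 m2), w.2))) <= e)%E.
Proof.
move=> mF F0 mF' F'0 FF' F'e mm1 mm2.
apply: le_trans (integral_confusion2 m1 mF' F'0 F'e mm2).
have mA : measurable_fun setT (fun w : C1 * C2 * G => F (tnth w.1.1 m,
    (tnth w.1.2 m', ((tnth w.1.1 m1, tnth w.1.2 m2), w.2)))).
  by apply: measurable_comp_fun => //; measurable_projection.
have mB : measurable_fun setT (fun w : C1 * C2 * G =>
    F' (tnth w.1.2 m', ((tnth w.1.1 m1, tnth w.1.2 m2), w.2))).
  by apply: measurable_comp_fun => //; measurable_projection.
rewrite (integral_prod3_zyx _ _ _ mA (fun w => F0 _)).
rewrite (integral_prod3_zyx _ _ _ mB (fun w => F'0 _)).
apply: ge0_integral_mono => g; first by do 2 (apply: integral_ge0 => ? _).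
apply: ge0_integral_mono => c2; first by apply: integral_ge0.
rewrite /= (@integral_iid2 _ _ _ _ _ m1 m
  (fun p => F (p.2, (tnth c2 m', ((p.1, tnth c2 m2), g)))))//; last first.
  by apply: measurable_comp_fun => //; measurable_projection.
rewrite (@integral_iid1 _ _ _ _ _ m1
  (fun y => F' (tnth c2 m', ((y, tnth c2 m2), g))))//; last first.
  by apply: measurable_comp_fun => //; measurable_projection.
by apply: ge0_integral_mono => y; [exact: integral_ge0|exact: (FF' _ (_, _, g))].
Qed.

Lemma integral_outage12 (O : X * X * G -> \bar R) (m1 : 'I_K1) (m2 : 'I_K2) :
  measurable_fun setT O -> (forall x, 0 <= O x)%E ->
  (\int[W]_w O ((tnth w.1.1 m1, tnth w.1.2 m2), w.2) =
   \int[nu]_g \int[mu]_x2 \int[mu]_x1 O ((x1, x2), g))%E.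
Proof.
move=> mO O0; rewrite integral_prod3_zyx//; last first.
  by apply: measurable_comp_fun => //; measurable_projection.
apply: eq_integral => g _ /=.
transitivity (\int[iid mu K2]_c2 \int[mu]_x1 O ((x1, tnth c2 m2), g))%E.
  apply: eq_integral => c2 _.
  rewrite (@integral_iid1 _ _ _ _ _ m1 (fun y => O ((y, tnth c2 m2), g)))//.
  by apply: measurable_comp_fun => //; measurable_projection.
rewrite (@integral_iid1 _ _ _ _ _ m2
  (fun y => \int[mu]_x1 O ((x1, y), g))%E)// => [|y]; last exact: integral_ge0.
apply: (measurable_integral_left mu (f := fun p => O (p, g))) => //.
by apply: measurable_comp_fun => //; measurable_projection.
Qed.

Lemma ge0_integral_sum_cond d (T : measurableType d)
    (P : {measure set T -> \bar R}) (I : finType) (p : pred I)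
    (f : I -> T -> \bar R) :
  (forall i, measurable_fun setT (f i)) -> (forall i x, 0 <= f i x)%E ->
  (\int[P]_x (\sum_(i | p i) f i x) = \sum_(i | p i) \int[P]_x f i x)%E.
Proof.
move=> mf f0; under eq_integral do rewrite -big_filter.
by rewrite ge0_integral_sum// big_filter.
Qed.

Lemma emeasurable_sum_cond d (T : measurableType d) (I : finType) (p : pred I)
    (f : I -> T -> \bar R) :
  (forall i, measurable_fun setT (f i)) ->
  measurable_fun setT (fun x => \sum_(i | p i) f i x)%E.
Proof.
by move=> mf; under eq_fun do rewrite -big_filter; exact: emeasurable_sum.
Qed.

Lemma lee_sum_cst (I : finType) (p : pred I) (f : I -> \bar R) (e : R) :
  (forall i, p i -> f i <= e%:E)%E ->
  (\sum_(i | p i) f i <= (#|p|%:R * e)%:E)%E.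
Proof.
move=> fe; apply: (le_trans (lee_sum _ fe)).
by rewrite sumEFin sumr_const mulr_natl.
Qed.

Variables (O : X * X * G -> \bar R) (F1 F2 F2' : X * (X * X * G) -> \bar R).
Variable F12 : X * (X * (X * X * G)) -> \bar R.

(** Pointwise union bound with each indicator replaced by a nonnegative majorant: [O] for the sent
    pair failing its test, [F1], [F2] and [F12] for acceptance of a pair wrong in the first, the
    second or both messages. *)
Definition union_bound (c1 : 'I_K1 -> X) (c2 : 'I_K2 -> X) m1 m2 (g : G) :=
  let w := ((c1 m1, c2 m2), g) in
  (O w + \sum_(m | m1 != m) F1 (c1 m, w) + \sum_(m | m2 != m) F2 (c2 m, w)
   + \sum_(m | m1 != m) \sum_(m' | m2 != m') F12 (c1 m, (c2 m', w)))%E.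

(** The average over codebooks of the message-averaged union bound is at most the displayed sum, so
    some pair of codebooks stays below [B]. [K1.-1] and [K2.-1] count the wrong messages, and [F2']
    is [F12] after averaging over the first wrong word. *)
Lemma random_coding (e0 e1 e2 e12 B : R) :
  (0 < K1)%N -> (0 < K2)%N -> 0 <= B ->
  measurable_fun setT O -> measurable_fun setT F1 -> measurable_fun setT F2 ->
  measurable_fun setT F2' -> measurable_fun setT F12 ->
  (forall w, 0 <= O w)%E -> (forall w, 0 <= F1 w)%E ->
  (forall w, 0 <= F2 w)%E -> (forall w, 0 <= F2' w)%E ->
  (forall w, 0 <= F12 w)%E ->
  (\int[nu]_g \int[mu]_x2 \int[mu]_x1 O ((x1, x2), g) <= e0%:E)%E ->
  (forall w, \int[mu]_x F1 (x, w) <= e1%:E)%E ->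
  (forall w, \int[mu]_x F2 (x, w) <= e2%:E)%E ->
  (forall x' w, \int[mu]_x F12 (x, (x', w)) <= F2' (x', w))%E ->
  (forall w, \int[mu]_x F2' (x, w) <= e12%:E)%E ->
  e0 + K1.-1%:R * e1 + K2.-1%:R * e2 + K1.-1%:R * (K2.-1%:R * e12) < B ->
  exists (c1 : 'I_K1 -> X) (c2 : 'I_K2 -> X),
    (((K1 * K2)%:R^-1)%:E * \sum_(m1 < K1) \sum_(m2 < K2)
       \int[nu]_g union_bound c1 c2 m1 m2 g < B%:E)%E.
Proof.
move=> K10 K20 B0 mO mF1 mF2 mF2' mF12 O0 F10 F20 F2'0 F120 Oe Fe1 Fe2 FF' Fe12 eB.
set E := e0 + _ + _ + _ in eB.
pose Psi m1 m2 (w : C1 * C2 * G) :=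
  union_bound (tnth w.1.1) (tnth w.1.2) m1 m2 w.2.
have mPO m1 m2 : measurable_fun setT
    (fun w : C1 * C2 * G => O ((tnth w.1.1 m1, tnth w.1.2 m2), w.2)).
  by apply: measurable_comp_fun => //; measurable_projection.
have mP1 m1 m2 m : measurable_fun setT (fun w : C1 * C2 * G =>
    F1 (tnth w.1.1 m, ((tnth w.1.1 m1, tnth w.1.2 m2), w.2))).
  by apply: measurable_comp_fun => //; measurable_projection.
have mP2 m1 m2 m : measurable_fun setT (fun w : C1 * C2 * G =>
    F2 (tnth w.1.2 m, ((tnth w.1.1 m1, tnth w.1.2 m2), w.2))).
  by apply: measurable_comp_fun => //; measurable_projection.
have mP12 m1 m2 m m' : measurable_fun setT (fun w : C1 * C2 * G =>
    F12 (tnth w.1.1 m, (tnth w.1.2 m',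
      ((tnth w.1.1 m1, tnth w.1.2 m2), w.2)))).
  by apply: measurable_comp_fun => //; measurable_projection.
have Psi0 m1 m2 w : (0 <= Psi m1 m2 w)%E.
  rewrite /Psi /union_bound !adde_ge0// ?sume_ge0// => m _.
  by rewrite sume_ge0.
have mPsi m1 m2 : measurable_fun setT (Psi m1 m2).
  rewrite /Psi /union_bound; apply: emeasurable_funD.
    apply: emeasurable_funD.
      by apply: emeasurable_funD => //; exact: emeasurable_sum_cond.
    exact: emeasurable_sum_cond.
  by apply: emeasurable_sum_cond => m; exact: emeasurable_sum_cond.
have cardK K (i : 'I_K) : #|[pred m | i != m]| = K.-1.
  rewrite -[in RHS](card_ord K) -(cardC1 i); apply: eq_card => m.
  by rewrite !inE eq_sym.
have PsiE m1 m2 : (\int[W]_w Psi m1 m2 w <= E%:E)%E.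
  rewrite /Psi /union_bound.
  rewrite ge0_integralD//; last 4 first.
  - by move=> w _; rewrite !adde_ge0// sume_ge0.
  - apply: emeasurable_funD; last exact: emeasurable_sum_cond.
    by apply: emeasurable_funD => //; exact: emeasurable_sum_cond.
  - by move=> w _; rewrite sume_ge0// => m _; rewrite sume_ge0.
  - by apply: emeasurable_sum_cond => m; exact: emeasurable_sum_cond.
  rewrite ge0_integralD//; last 4 first.
  - by move=> w _; rewrite !adde_ge0// sume_ge0.
  - by apply: emeasurable_funD => //; exact: emeasurable_sum_cond.
  - by move=> w _; rewrite sume_ge0.
  - exact: emeasurable_sum_cond.
  rewrite ge0_integralD//; last 2 first.
  - by move=> w _; rewrite sume_ge0.
  - exact: emeasurable_sum_cond.
  rewrite integral_outage12// !ge0_integral_sum_cond//; last 2 first.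
  - by move=> m; exact: emeasurable_sum_cond.
  - by move=> m w; rewrite sume_ge0.
  rewrite /E !EFinD; apply: leeD; [apply: leeD; [apply: leeD => //|]|].
  - rewrite -(cardK _ m1); apply: lee_sum_cst => m mm.
    exact: integral_confusion1.
  - rewrite -(cardK _ m2); apply: lee_sum_cst => m mm.
    exact: integral_confusion2.
  - rewrite -(cardK _ m1); apply: lee_sum_cst => m mm.
    rewrite ge0_integral_sum_cond//.
    rewrite -(cardK _ m2); apply: lee_sum_cst => m' mm'.
    exact: (integral_confusion12 _ _ mF2').
pose a : \bar R := ((K1 * K2)%:R^-1)%:E.
pose Th w := (a * \sum_(m1 < K1) \sum_(m2 < K2) Psi m1 m2 w)%E.
have a0 : (0 <= a)%E by rewrite lee_fin invr_ge0.
have mS : measurable_fun setT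
    (fun w => \sum_(m1 < K1) \sum_(m2 < K2) Psi m1 m2 w)%E.
  by apply: emeasurable_sum_cond => m1; exact: emeasurable_sum_cond.
have S0 w : (0 <= \sum_(m1 < K1) \sum_(m2 < K2) Psi m1 m2 w)%E.
  by rewrite sume_ge0// => m _; rewrite sume_ge0.
have mTh : measurable_fun setT Th by exact: measurable_funeM.
have Th0 w : (0 <= Th w)%E by rewrite mule_ge0.
have ThE : (\int[W]_w Th w <= E%:E)%E.
  rewrite /Th ge0_integralZl// ge0_integral_sum_cond//; last 2 first.
  - by move=> m; exact: emeasurable_sum_cond.
  - by move=> m w; rewrite sume_ge0.
  apply: (@le_trans _ _ (a * (K1%:R * (K2%:R * E))%:E)%E).
    apply: lee_wpmul2l => //; rewrite -[in leRHS](card_ord K1).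
    apply: lee_sum_cst => m1 _; rewrite ge0_integral_sum_cond//.
    rewrite -[in leRHS](card_ord K2); apply: lee_sum_cst => m2 _.
    exact: PsiE.
  rewrite /a -EFinM lee_fin mulrA -natrM mulrA mulVf ?mul1r//.
  by rewrite pnatr_eq0 -lt0n muln_gt0 K10.
have ThI c : (\int[nu]_g Th (c, g) = a * \sum_(m1 < K1) \sum_(m2 < K2)
    \int[nu]_g union_bound (tnth c.1) (tnth c.2) m1 m2 g)%E.
  have mPc m1 m2 : measurable_fun setT (fun g => Psi m1 m2 (c, g)).
    by apply: measurable_comp_fun => //; measurable_projection.
  rewrite /Th ge0_integralZl//; last first.
    by apply: emeasurable_sum_cond => m1; exact: emeasurable_sum_cond.
  congr (_ * _)%E; rewrite ge0_integral_sum_cond//; last 2 first.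
  - by move=> m; exact: emeasurable_sum_cond.
  - by move=> m w; rewrite sume_ge0.
  by apply: eq_bigr => m1 _; rewrite ge0_integral_sum_cond.
(* If every pair of codebooks had value at least [B], so would their average, against [E < B]. *)
apply: contrapT => noc.
have BTh c : (B%:E <= \int[nu]_g Th (c, g))%E.
  rewrite leNgt; apply/negP => lt; apply: noc.
  by exists (tnth c.1), (tnth c.2); rewrite -ThI.
have : (B%:E <= E%:E)%E; last by rewrite lee_fin leNgt eB.
apply: le_trans ThE; rewrite integral_prod_prob//.
rewrite -(integral_prob_cst (prod_prob (iid mu K1) (iid mu K2)) B%:E).
by apply: ge0_integral_mono => c; [rewrite lee_fin|exact: BTh].
Qed.

End random_coding.

(** * Measurability of real expressions in words and noise *)

Section measurable_real.
Context d (W : measurableType d) (R : realType).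
Local Notation mR := (measurableTypeR R).

Lemma measurable_coordinate n (f : W -> n.-tuple mR) i :
  measurable_fun setT f -> measurable_fun setT (fun w => tnth (f w) i : R).
Proof. by move=> mf; exact: (measurableT_comp (measurable_tnth i) mf). Qed.

Lemma measurable_coordinate1 n (f : W -> n.-tuple (mR * mR)) i :
  measurable_fun setT f -> measurable_fun setT (fun w => (tnth (f w) i).1 : R).
Proof.
by move=> mf; exact: (measurableT_comp measurable_fst
  (measurableT_comp (measurable_tnth i) mf)).
Qed.

Lemma measurable_coordinate2 n (f : W -> n.-tuple (mR * mR)) i :
  measurable_fun setT f -> measurable_fun setT (fun w => (tnth (f w) i).2 : R).
Proof.
by move=> mf; exact: (measurableT_comp measurable_snd
  (measurableT_comp (measurable_tnth i) mf)).
Qed.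

Lemma measurable_expR_fun (f : W -> R) :
  measurable_fun setT f -> measurable_fun setT (fun w => expR (f w)).
Proof. by move=> mf; exact: measurableT_comp. Qed.

Lemma measurable_add_fun (f g : W -> R) : measurable_fun setT f ->
  measurable_fun setT g -> measurable_fun setT (fun w => f w + g w).
Proof. by move=> mf mg; exact: measurable_funD. Qed.

Lemma measurable_opp_fun (f : W -> R) : measurable_fun setT f ->
  measurable_fun setT (fun w => - f w).
Proof. by move=> mf; exact: measurableT_comp. Qed.

Lemma measurable_mul_fun (f g : W -> R) : measurable_fun setT f ->
  measurable_fun setT g -> measurable_fun setT (fun w => f w * g w).
Proof. by move=> mf mg; exact: measurable_funM. Qed.

Lemma measurable_pow_fun (f : W -> R) n : measurable_fun setT f ->
  measurable_fun setT (fun w => f w ^+ n).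
Proof. by move=> mf; exact: measurable_funX. Qed.

Lemma measurable_sum_fun (I : Type) (s : seq I) (p : pred I) (f : I -> W -> R) :
  (forall i, measurable_fun setT (f i)) ->
  measurable_fun setT (fun w => \sum_(i <- s | p i) f i w).
Proof.
by move=> mf; under eq_fun do rewrite -big_filter; exact: measurable_sum.
Qed.

Lemma measurable_EFin_fun (f : W -> R) :
  measurable_fun setT f -> measurable_fun setT (fun w => (f w)%:E).
Proof. by move=> mf; exact/measurable_EFinP. Qed.

End measurable_real.

Ltac measurable_real :=
  lazymatch goal with
  | |- @measurable_fun _ _ _ _ _ (fun _ => ?c) => exact: measurable_cst
  | |- @measurable_fun _ _ _ _ _ (fun w => EFin _) =>
      apply: measurable_EFin_fun; measurable_real
  | |- @measurable_fun _ _ _ _ _ (fun w => expR _) =>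
      apply: measurable_expR_fun; measurable_real
  | |- @measurable_fun _ _ _ _ _ (fun w => GRing.add _ _) =>
      apply: measurable_add_fun; measurable_real
  | |- @measurable_fun _ _ _ _ _ (fun w => GRing.opp _) =>
      apply: measurable_opp_fun; measurable_real
  | |- @measurable_fun _ _ _ _ _ (fun w => GRing.mul _ _) =>
      apply: measurable_mul_fun; measurable_real
  | |- @measurable_fun _ _ _ _ _ (fun w => GRing.exp _ _) =>
      apply: measurable_pow_fun; measurable_real
  | |- @measurable_fun _ _ _ _ _ (fun w => \sum_(i <- _ | _) _) =>
      apply: measurable_sum_fun => ?; measurable_real
  | |- @measurable_fun _ _ _ _ _ (fun w => (tnth _ _).1) =>
      apply: measurable_coordinate1; measurable_projection
  | |- @measurable_fun _ _ _ _ _ (fun w => (tnth _ _).2) =>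
      apply: measurable_coordinate2; measurable_projection
  | |- @measurable_fun _ _ _ _ _ (fun w => tnth _ _) =>
      apply: measurable_coordinate; measurable_projection
  | |- _ => idtac
  end.

Section gaussian_integrals.
Variable R : realType.
Local Notation mR := (measurableTypeR R).

Definition gauss_word (L : nat) := iid (N01 R) L.
Definition gauss_noise (n : nat) := iid (N01pair R) n.

Lemma integral_gauss_word_quad L (a : R) (b : 'I_L -> R) : 2 * a < 1 ->
  (\int[gauss_word L]_x
     (expR (\sum_(k < L) (b k * tnth x k + a * tnth x k ^+ 2)))%:E =
   (expR (\sum_(k < L) (b k ^+ 2 / (2 * (1 - 2 * a)) - ln (1 - 2 * a) / 2)))%:E)%E.
Proof.
move=> a1; elim: L b => [|L IH] b; rewrite /gauss_word.
  rewrite integral_iid0; last by measurable_real.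
  by rewrite !big_ord0.
rewrite integral_iidS; [|by measurable_real
  |by move=> x; rewrite lee_fin expR_ge0].
rewrite big_ord_recl expRD.
transitivity (\int[N01 R]_x ((expR (\sum_(i < L) (b (lift ord0 i) ^+ 2 /
   (2 * (1 - 2 * a)) - ln (1 - 2 * a) / 2)))%:E *
   (expR (b ord0 * x + a * x ^+ 2))%:E))%E.
  apply: eq_integral => x _.
  under eq_integral => t _.
    rewrite big_ord_recl expRD EFinM; under eq_bigr do rewrite tnth_tuple_consS.
    rewrite tnth_tuple_cons0; over.
  rewrite ge0_integralZl//; last by measurable_real.
  by rewrite -/(gauss_word L) (IH (fun i => b (lift ord0 i))) muleC.
rewrite ge0_integralZl//; last first.
  apply/measurable_EFinP; apply: measurable_expR_fun.
  by apply: measurable_funD; apply: measurable_funM.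
by rewrite integral_expR_quad// -EFinM mulrC.
Qed.

Lemma integral_gauss_noise_lin n (p q : 'I_n -> R) :
  (\int[gauss_noise n]_g
     (expR (\sum_(t < n) (p t * (tnth g t).1 + q t * (tnth g t).2)))%:E =
   (expR (\sum_(t < n) ((p t ^+ 2 + q t ^+ 2) / 2)))%:E)%E.
Proof.
elim: n p q => [|n IH] p q; rewrite /gauss_noise.
  rewrite integral_iid0; last by measurable_real.
  by rewrite !big_ord0.
rewrite integral_iidS; [|by measurable_real
  |by move=> x; rewrite lee_fin expR_ge0].
have lin (c : R) : (\int[N01 R]_x (expR (c * x))%:E = (expR (c ^+ 2 / 2))%:E)%E.
  have := @integral_expR_quad R 0 c; rewrite mulr0 subr0 ln1 mul0r subr0 mulr1.
  move=> <-; last exact: ltr01.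
  by apply: eq_integral => x _; rewrite mul0r addr0.
have mlin (c : R) : measurable_fun setT (fun x : mR => (expR (c * x))%:E).
  apply/measurable_EFinP; apply: measurable_expR_fun; exact: measurable_funM.
rewrite big_ord_recl expRD.
set E := expR (\sum_(i < n) _).
transitivity (\int[N01pair R]_x (E%:E *
   (expR (p ord0 * x.1 + q ord0 * x.2))%:E))%E.
  apply: eq_integral => x _.
  under eq_integral => t _.
    rewrite big_ord_recl expRD EFinM; under eq_bigr do rewrite tnth_tuple_consS.
    rewrite tnth_tuple_cons0; over.
  rewrite ge0_integralZl//; last by measurable_real.
  rewrite -/(gauss_noise n).
  by rewrite (IH (fun i => p (lift ord0 i)) (fun i => q (lift ord0 i))) muleC.
have m2 : measurable_fun setT
    (fun x : mR * mR => (expR (p ord0 * x.1 + q ord0 * x.2))%:E).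
  apply/measurable_EFinP; apply: measurable_expR_fun.
  apply: measurable_add_fun; apply: measurable_mul_fun => //.
rewrite ge0_integralZl ?lee_fin ?expR_ge0//.
rewrite [X in (_ * X)%E](integral_prod_prob (N01 R) (N01 R) m2)//.
rewrite [X in (_ * X)%E](_ : _ = (expR ((p ord0 ^+ 2 + q ord0 ^+ 2) / 2))%:E).
  by rewrite -EFinM mulrC.
transitivity (\int[N01 R]_a ((expR (q ord0 ^+ 2 / 2))%:E * (expR (p ord0 * a))%:E))%E.
  apply: eq_integral => a _ /=.
  under eq_integral do rewrite expRD EFinM.
  by rewrite ge0_integralZl// lin muleC.
by rewrite ge0_integralZl// lin -EFinM -expRD -mulrDl addrC.
Qed.

End gaussian_integrals.

(** * Outage probability *)

Section block_sums.
Variable V : zmodType.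

Lemma sum_block n h k (F : nat -> V) : (0 < h)%N -> (k * h + h <= n)%N ->
  \sum_(t < n | (t %/ h == k)%N) F t = \sum_(j < h) F (k * h + j)%N.
Proof.
move=> h0 kn; rewrite -(big_mkord (fun t => t %/ h == k)%N).
rewrite (@big_cat_nat _ _ _ (k * h)%N)//=; last by rewrite (leq_trans _ kn)// leq_addr.
rewrite big_nat_cond big_pred0 ?add0r; last first.
  move=> t; apply/negbTE/negP => /andP[/andP[_ tk] /eqP e].
  by rewrite -e ltnNge leq_divM in tk.
rewrite (@big_cat_nat _ _ _ (k * h + h)%N)//= ?leq_addr//.
rewrite [X in _ + X]big_nat_cond [X in _ + X]big_pred0 ?addr0; last first.
  move=> t; apply/negbTE/negP => /andP[/andP[tk _] /eqP e].
  by rewrite -e -mulSnr leqNgt ltn_ceil in tk.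
rewrite -{1}[(k * h)%N]add0n big_addn addKn -(big_mkord xpredT (fun j => F (k * h + j)%N)).
rewrite big_nat_cond [RHS]big_nat_cond; apply: eq_big => [j|j _]; last by rewrite addnC.
by case: ltnP => //= jh; rewrite addnC divnMDl ?divn_small ?addn0 ?eqxx.
Qed.

(** Each [t] lies in at most one block. Indices of an incomplete last block have [t %/ h >= L], so
    [insub] yields [None] and they contribute zero. *)
Lemma exchange_blocks n h L (G : 'I_L -> nat -> V) :
  \sum_(k < L) \sum_(t < n | (t %/ h == k)%N) G k t =
  \sum_(t < n) (if insub (t %/ h)%N is Some k then G k t else 0).
Proof.
under eq_bigr do rewrite big_mkcond; rewrite exchange_big; apply: eq_bigr => t _.
case: insubP => [k _ ek|nk]; last first.
  rewrite big1// => k _; case: eqP => // e; by rewrite e ltn_ord in nk.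
rewrite (bigD1 k)//= ek eqxx big1 ?addr0// => i ik.
by case: eqP => // e; rewrite -val_eqE /= ek e eqxx in ik.
Qed.

End block_sums.

Section outage.
Variable R : realType.
Local Notation mR := (measurableTypeR R).

(** The noise in the statistic of block [k], with the same coefficients in all blocks. As a filtered
    sum over all times, a combination of several blocks is again one linear form in the whole
    noise. *)
Definition noise_form n h (p q : nat -> R) (k : nat) (g : n.-tuple (mR * mR)) : R :=
  \sum_(t < n | (t %/ h == k)%N)
    (p (t %% h)%N * (tnth g t).1 + q (t %% h)%N * (tnth g t).2).

(** The variance of [noise_form] on a complete block, since the underlying samples are independent
    standard normals. *)
Definition form_var h (p q : nat -> R) : R := \sum_(j < h) (p j ^+ 2 + q j ^+ 2).

Lemma form_var_ge0 h p q : 0 <= form_var h p q.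
Proof. by rewrite sumr_ge0// => j _; rewrite addr_ge0 ?sqr_ge0. Qed.

Lemma measurable_noise_form d (W : measurableType d) n h p q k
    (f : W -> n.-tuple (mR * mR)) :
  measurable_fun setT f -> measurable_fun setT (fun w => noise_form h p q k (f w)).
Proof. by move=> mf; rewrite /noise_form; measurable_real. Qed.

(** Blocks use disjoint noise samples, so the forms behave as independent centred Gaussians of
    variance [form_var], and the joint moment generating function factors. *)
Lemma integral_noise_forms n h L p q (xi : 'I_L -> R) :
  (0 < h)%N -> (L * h <= n)%N ->
  (\int[gauss_noise R n]_g
     (expR (\sum_(k < L) xi k * noise_form h p q k g))%:E =
   (expR (\sum_(k < L) xi k ^+ 2 * form_var h p q / 2))%:E)%E.
Proof.
move=> h0 Ln.
(* The weight of the block containing [t], and zero after the last complete block; it merges all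
   blocks into a single linear form. *)
pose X t := if insub (t %/ h)%N is Some k then xi (k : 'I_L) else 0.
transitivity (\int[gauss_noise R n]_g (expR (\sum_(t < n)
   ((X t * p (t %% h)%N) * (tnth g t).1 + (X t * q (t %% h)%N) * (tnth g t).2)))%:E)%E.
  apply: eq_integral => g _; congr (expR _)%:E.
  pose Z (t : nat) := nth (0, 0) g t.
  rewrite /noise_form; under eq_bigr do rewrite big_distrr/=.
  transitivity (\sum_(k < L) \sum_(t < n | (t %/ h == k)%N)
      xi k * (p (t %% h)%N * (Z t).1 + q (t %% h)%N * (Z t).2)).
    by apply: eq_bigr => k _; apply: eq_bigr => t _; rewrite /Z -tnth_nth.
  rewrite (exchange_blocks n h (fun k t =>
      xi k * (p (t %% h)%N * (Z t).1 + q (t %% h)%N * (Z t).2))).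
  apply: eq_bigr => t _; rewrite /X /Z -tnth_nth; case: insubP => [k _ _|_].
    by rewrite mulrDr !mulrA.
  by rewrite !mul0r addr0.
rewrite integral_gauss_noise_lin; congr (expR _)%:E.
transitivity (\sum_(k < L) \sum_(t < n | (t %/ h == k)%N)
   (xi k ^+ 2 * (p (t %% h)%N ^+ 2 + q (t %% h)%N ^+ 2) / 2)).
  rewrite (exchange_blocks n h (fun k t =>
    (xi k ^+ 2 * (p (t %% h)%N ^+ 2 + q (t %% h)%N ^+ 2) / 2))).
  apply: eq_bigr => t _; rewrite /X; case: insubP => [k _ _|_]; first by field.
  by rewrite !mul0r expr0n/= addr0 mul0r.
apply: eq_bigr => k _.
rewrite (sum_block (fun t => xi k ^+ 2 * (p (t %% h)%N ^+ 2 + q (t %% h)%N ^+ 2) / 2))//.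
  rewrite /form_var big_distrr/= big_distrl/=; apply: eq_bigr => j _.
  by rewrite modnMDl modn_small.
by rewrite -mulSnr (leq_trans _ Ln)// leq_mul2r ltn_ord orbT.
Qed.

Lemma integral_noise_forms_sq n h L p q (b : R) :
  (0 < h)%N -> (L * h <= n)%N -> 0 <= b -> 2 * b * form_var h p q < 1 ->
  (\int[gauss_noise R n]_g
     (expR (\sum_(k < L) b * noise_form h p q k g ^+ 2))%:E =
   (expR (L%:R * (- ln (1 - 2 * b * form_var h p q) / 2)))%:E)%E.
Proof.
move=> h0 Ln b0 b1.
(* [exp (b w^2)] is the mean of [exp (sqrt (2 b) w xi)] over a standard normal
   [xi], which makes the exponent linear in the noise. *)
pose e (xi : L.-tuple mR) (g : n.-tuple (mR * mR)) : R :=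
  \sum_(k < L) (Num.sqrt (2 * b) * noise_form h p q k g * tnth xi k).
have sb : Num.sqrt (2 * b) ^+ 2 = 2 * b by rewrite sqr_sqrtr// mulr_ge0.
transitivity (\int[gauss_noise R n]_g \int[gauss_word R L]_xi (expR (e xi g))%:E)%E.
  apply: eq_integral => g _.
  rewrite [RHS](_ : _ = \int[gauss_word R L]_xi (expR (\sum_(k < L)
    (Num.sqrt (2 * b) * noise_form h p q k g * tnth xi k + 0 * tnth xi k ^+ 2)))%:E)%E;
    last first.
    apply: eq_integral => xi _; congr (expR _)%:E; apply: eq_bigr => k _.
    by rewrite mul0r addr0.
  rewrite integral_gauss_word_quad ?mulr0//; congr (expR _)%:E; apply: eq_bigr => k _.
  by rewrite subr0 ln1 mul0r subr0 mulr1 exprMn sb; field.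
rewrite (integral_swap (gauss_noise R n) (gauss_word R L)
   (f := fun x => (expR (e x.2 x.1))%:E)); last 2 first.
- rewrite /e; measurable_real; apply: measurable_noise_form; measurable_projection.
- by move=> x; rewrite lee_fin expR_ge0.
transitivity (\int[gauss_word R L]_xi (expR (\sum_(k < L)
    (0 * tnth xi k + b * form_var h p q * tnth xi k ^+ 2)))%:E)%E.
  apply: eq_integral => xi _ /=.
  rewrite [LHS](_ : _ = \int[gauss_noise R n]_g
     (expR (\sum_(k < L) (Num.sqrt (2 * b) * tnth xi k) * noise_form h p q k g))%:E)%E.
    rewrite integral_noise_forms//; congr (expR _)%:E; apply: eq_bigr => k _.
    by rewrite exprMn sb mul0r add0r; field.
  by apply: eq_integral => g _; congr (expR _)%:E; apply: eq_bigr => k _; ring.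
rewrite integral_gauss_word_quad; last by rewrite mulrA.
congr (expR _)%:E.
rewrite (eq_bigr (fun=> - ln (1 - 2 * b * form_var h p q) / 2)).
  by rewrite sumr_const card_ord [RHS]mulr_natl.
by move=> k _; rewrite expr0n/= mul0r sub0r mulrA mulNr.
Qed.

(** With [th = lam / (1 + s)] this is [- lam] times the deviation of the total information density
    of the sent word from its mean [L * ln (1 + s) / 2]; see [info_density_true]. *)
Definition outage_exponent L (th s : R) (x w : 'I_L -> R) : R :=
  - (th / 2) * \sum_(k < L) (s * x k ^+ 2 + 2 * w k * x k - w k ^+ 2).

(** On this range [(1 - v) * (1 + 2 * v) >= 1], hence [1 / (1 - v) <= 1 + 2 * v <= exp (2 * v)]. *)
Lemma ln1B_ge (v : R) : 0 <= v -> v <= 2^-1 -> - (ln (1 - v) / 2) <= v.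
Proof.
move=> v0 v1; have lt1 : 0 < 1 - v by lra.
rewrite lerNl ler_pdivlMr// -ler_expR lnK ?posrE//.
rewrite mulNr expRN invf_ple ?posrE ?expR_gt0//.
apply: le_trans (expR_ge1Dx (v * 2)).
rewrite -[leLHS]mul1r ler_pdivrMr//.
have : 0 <= v * (1 - 2 * v) by rewrite mulr_ge0//; lra.
lra.
Qed.

(* Integrating out [x] turns the exponent into [b w^2]; integrating out [u]
   and then the noise leaves the constant [1 - lam^2 s / (1 + s)] with [th =
   lam / (1 + s)]. *)
Lemma integral_outage n h L p q (r lam : R) (s := r ^+ 2 + form_var h p q)
    (th := lam / (1 + s)) :
  (0 < h)%N -> (L * h <= n)%N -> 0 <= lam -> lam ^+ 2 <= 2^-1 ->
  (\int[gauss_noise R n]_g \int[gauss_word R L]_u \int[gauss_word R L]_x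
     (expR (outage_exponent th s (tnth x)
        (fun k => r * tnth u k + noise_form h p q k g)))%:E
   <= (expR (L%:R * lam ^+ 2))%:E)%E.
Proof.
move=> h0 Ln lam0 lam1.
have fv0 : 0 <= form_var h p q := form_var_ge0 _ _ _.
have s0 : 0 <= s by rewrite addr_ge0 ?sqr_ge0.
have s1 : 0 < 1 + s by rewrite ltr_wpDr.
have th0 : 0 <= th by rewrite divr_ge0// ltW.
have A0 : 0 < 1 + th * s by rewrite ltr_wpDr// mulr_ge0.
(* The first summand is the [w^2] already in the exponent, the second comes from completing the
   square in [x]. *)
pose b := th / 2 + th ^+ 2 / (2 * (1 + th * s)).
have b0 : 0 <= b by rewrite addr_ge0// divr_ge0// ?sqr_ge0// mulr_ge0// ltW.
(* The terms of first order in [th] cancel, because [s x^2 + 2 w x - w^2] has mean zero when [w] has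
   variance [s]. Hence the exponent is only of order [lam ^+ 2]. *)
have key : (1 + th * s) * (1 - 2 * b * s) = 1 - lam ^+ 2 * s / (1 + s).
  rewrite /b /th; field; rewrite (gt_eqF s1) /=.
  have -> : 1 + s + lam * s = (1 + th * s) * (1 + s) by rewrite /th; field; rewrite gt_eqF.
  by rewrite mulf_neq0 ?gt_eqF.
have v1 : lam ^+ 2 * s / (1 + s) <= lam ^+ 2.
  rewrite -mulrA ler_piMr ?sqr_ge0// ler_pdivrMr// mul1r; lra.
have v0 : 0 <= lam ^+ 2 * s / (1 + s).
  by rewrite divr_ge0 ?mulr_ge0 ?sqr_ge0// ltW.
have bs : 2 * b * s < 1.
  rewrite -subr_gt0 -(pmulr_rgt0 _ A0) key; lra.
have br : 2 * (b * r ^+ 2) < 1.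
  apply: le_lt_trans bs; rewrite /s mulrDr mulrA lerDl !mulr_ge0//.
have br0 : 0 < 1 - 2 * (b * r ^+ 2) by rewrite subr_gt0.
(* The coefficient of the squared noise form that remains after the Gaussian integral over [u] in
   [b * (r * u + noise)^2]. *)
pose b' := b / (1 - 2 * (b * r ^+ 2)).
have b'0 : 0 <= b' by rewrite divr_ge0// ltW.
have key2 : (1 - 2 * (b * r ^+ 2)) * (1 - 2 * b' * form_var h p q) = 1 - 2 * b * s.
  by rewrite /b' /s; field; rewrite gt_eqF.
have b's : 2 * b' * form_var h p q < 1.
  by rewrite -subr_gt0 -(pmulr_rgt0 _ br0) key2 subr_gt0.
pose c := - ln (1 + th * s) / 2 : R.
pose c' := - ln (1 - 2 * (b * r ^+ 2)) / 2 : R.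
rewrite [leLHS](_ : _ = \int[gauss_noise R n]_g
   ((expR (L%:R * (c + c')))%:E *
    (expR (\sum_(k < L) b' * noise_form h p q k g ^+ 2))%:E))%E; last first.
  apply: eq_integral => g _.
  transitivity (\int[gauss_word R L]_u ((expR (L%:R * c +
      \sum_(k < L) b * noise_form h p q k g ^+ 2))%:E *
     (expR (\sum_(k < L) ((2 * b * r * noise_form h p q k g) * tnth u k
        + (b * r ^+ 2) * tnth u k ^+ 2)))%:E))%E.
    apply: eq_integral => u _.
    pose w k := r * tnth u k + noise_form h p q k g.
    transitivity (\int[gauss_word R L]_x ((expR (\sum_(k < L) th / 2 * w k ^+ 2))%:E *
        (expR (\sum_(k < L) ((- th * w k) * tnth x k + (- (th * s / 2)) * tnth x k ^+ 2)))%:E))%E.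
      apply: eq_integral => x _; rewrite -EFinM -expRD -big_split/=.
      congr (expR _)%:E; rewrite /outage_exponent big_distrr/=.
      by apply: eq_bigr => k _; rewrite -/(w k); field.
    rewrite ge0_integralZl//; last by measurable_real.
    rewrite integral_gauss_word_quad; last by nra.
    rewrite -!EFinM -!expRD; congr (expR _)%:E.
    rewrite -big_split/=.
    rewrite (_ : L%:R * c = \sum_(k < L) c); last first.
      by rewrite sumr_const card_ord mulr_natl.
    rewrite -!big_split/=; apply: eq_bigr => k _.
    rewrite (_ : 1 - 2 * - (th * s / 2) = 1 + th * s); last by field.
    rewrite /c /b /w; field; rewrite gt_eqF//.
  rewrite ge0_integralZl//; last by measurable_real.
  rewrite integral_gauss_word_quad// -!EFinM -!expRD; congr (expR _)%:E.
  rewrite (mulrDr L%:R) -!addrA; congr (_ + _).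
  rewrite (_ : L%:R * c' = \sum_(k < L) c'); last first.
    by rewrite sumr_const card_ord mulr_natl.
  rewrite -!big_split/=; apply: eq_bigr => k _.
  by rewrite /c' /b'; field; rewrite gt_eqF.
rewrite ge0_integralZl//; last first.
  measurable_real; apply: measurable_noise_form; measurable_projection.
rewrite integral_noise_forms_sq// -EFinM -expRD lee_fin ler_expR -mulrDr.
rewrite ler_wpM2l// ?ler0n//.
apply: (le_trans _ (le_trans (ln1B_ge v0 (le_trans v1 lam1)) v1)).
rewrite -key -key2 /c /c'.
rewrite lnM ?posrE ?mulr_gt0 ?subr_gt0// lnM ?posrE ?subr_gt0//.
lra.
Qed.

End outage.

(** * Second moment of an affine function of the noise *)

Section second_moment.
Variable R : realType.
Local Notation mR := (measurableTypeR R).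

Lemma expR_ge_quad (x : R) : 0 <= x -> 1 + x + x ^+ 2 / 2 <= expR x.
Proof.
move=> x0; have nd : nondecreasing_seq (series (exp_coeff x)).
  by apply: nondecreasing_series => n _ _; exact: exp_coeff_ge0.
have := nondecreasing_cvgn_le nd (is_cvg_series_exp_coeff x) 3%N.
apply: le_trans; rewrite /series/= /exp_coeff !big_nat_recr//= big_geq//.
by rewrite expr0 expr1 !factS fact0 add0r !muln1 !divr1.
Qed.

(** With [t = u / 2] the right side is the square of [exp t - exp (- t)], which is at least [2 t]
    for [t >= 0]. *)
Lemma expR_sym_ge (u : R) : u ^+ 2 <= expR u + expR (- u) - 2.
Proof.
wlog u0 : u / 0 <= u.
  move=> H; have [/H//|u0] := leP 0 u.
  have := H (- u); rewrite sqrrN opprK [expR (- u) + _]addrC; apply.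
  by rewrite oppr_ge0 ltW.
pose t := u / 2; have t0 : 0 <= t by rewrite divr_ge0.
have ut : u = t + t by rewrite /t; field.
have e1 := expR_ge_quad t0.
have e2 : expR t * expR (- t) = 1 by rewrite expRxMexpNx_1.
(* Invert the quadratic lower bound on [exp t]: [(1 + t + t^2/2) * (1 - t + t^2/2) = 1 + t^4/4 >=
   1]. *)
have e3 : expR (- t) <= 1 - t + t ^+ 2 / 2.
  have p : 0 < 1 + t + t ^+ 2 / 2.
    by rewrite addrAC ltr_wpDr// ltr_wpDr// divr_ge0// sqr_ge0.
  rewrite expRN -[leLHS]mul1r ler_pdivrMr ?expR_gt0//.
  have : 0 <= 1 - t + t ^+ 2 / 2 by nra.
  move=> q; apply: le_trans (ler_wpM2l q e1); nra.
rewrite ut opprD !expRD.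
have : 2 * t <= expR t - expR (- t) by lra.
move: e2; set a := expR t; set b := expR (- t) => e2 ab.
have : 0 <= a - b - 2 * t by lra.
have -> : a * a + b * b - 2 = (a - b) ^+ 2 by rewrite -e2; ring.
move=> h; have : 0 <= (a - b - 2 * t) * (a - b + 2 * t) by rewrite mulr_ge0//; lra.
lra.
Qed.

(** For [u >= 0] the left side is [exp (- u) * (exp u - 1)^2], and [exp u - 1 <= u * exp u]. With
    the previous bound, squares are squeezed between exponentials, whose integrals are known. *)
Lemma expR_sym_le (u : R) : expR u + expR (- u) - 2 <= u ^+ 2 * expR `|u|.
Proof.
wlog u0 : u / 0 <= u.
  move=> H; have [/H//|u0] := leP 0 u.
  have := H (- u); rewrite sqrrN opprK normrN [expR (- u) + _]addrC; apply.
  by rewrite oppr_ge0 ltW.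
rewrite ger0_norm//; set a := expR u; set b := expR (- u).
have ab : a * b = 1 by rewrite expRxMexpNx_1.
have b1 : 1 - u <= b by exact: expR_ge1Dx.
have a0 : 0 < a by exact: expR_gt0.
have a1 : 1 <= a by rewrite /a -[leLHS]expR0 ler_expR.
have e1 : a - 1 <= u * a.
  have : a * (1 - u) <= 1 by rewrite -[leRHS]ab ler_pM2l.
  lra.
have b0 : 0 < b by exact: expR_gt0.
have -> : a + b - 2 = b * (a - 1) ^+ 2.
  by transitivity (a * (a * b) + b - 2 * (a * b)); [rewrite ab|]; ring.
have : (a - 1) ^+ 2 <= (u * a) ^+ 2.
  by rewrite ler_sqr// nnegrE ?mulr_ge0 ?subr_ge0// ltW.
rewrite exprMn => h; apply: le_trans (ler_wpM2l (ltW b0) h) _.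
by rewrite [leRHS](_ : _ = b * (u ^+ 2 * a ^+ 2) + u ^+ 2 * a * (1 - a * b));
  [rewrite ab subrr mulr0 addr0|ring].
Qed.

(** The square of [l * (v + noise)] is bounded by symmetric exponentials, whose integrals are given
    by the moment generating function. After division by [l^2] the bound tends to [v^2 + form_var]
    as [l] tends to zero. *)
Lemma gauss_int_affine_sq n h p q k (v : R) :
  (0 < h)%N -> (k * h + h <= n)%N ->
  (gauss_int (fun g : n.-tuple (R * R) => ((v + noise_form h p q k g) ^+ 2)%:E)
   <= (v ^+ 2 + form_var h p q)%:E)%E.
Proof.
move=> h0 kn; set s := form_var h p q.
have s0 : 0 <= s := form_var_ge0 _ _ _.
pose N (g : n.-tuple (mR * mR)) := noise_form h p q k g.
rewrite gauss_intE; last 2 first.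
- measurable_real; apply: measurable_noise_form; measurable_projection.
- by move=> g; rewrite lee_fin sqr_ge0.
have EN (l : R) : (\int[gauss_noise R n]_g (expR (l * N g))%:E =
    (expR (l ^+ 2 * s / 2))%:E)%E.
  (* A single block is obtained by giving weight zero to all blocks before block [k]. *)
  have := @integral_noise_forms R n h k.+1 p q
    (fun i => if i == ord_max then l else 0) h0.
  rewrite mulSnr => /(_ kn).
  rewrite (bigD1 ord_max)//= eqxx big1 ?addr0; last first.
    by move=> i /negbTE ->; rewrite expr0n/= !mul0r.
  move=> <-; apply: eq_integral => g _; rewrite (bigD1 ord_max)//= eqxx.
  rewrite big1 ?addr0// => i /negbTE ->; by rewrite mul0r.
have mN c : measurable_fun setT (fun g : n.-tuple (mR * mR) => (expR (c * N g))%:E).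
  measurable_real; apply: measurable_noise_form; measurable_projection.
have mN2 : measurable_fun setT (fun g : n.-tuple (mR * mR) => ((v + N g) ^+ 2)%:E).
  measurable_real; apply: measurable_noise_form; measurable_projection.
have bound (l : R) : 0 < l -> (\int[gauss_noise R n]_g ((v + N g) ^+ 2)%:E <=
    ((v ^+ 2 + s) * expR (l * `|v| + l ^+ 2 * s / 2))%:E)%E.
  move=> l0.
  have l20 : 0 < l ^+ 2 by rewrite exprn_gt0.
  have E2 : (\int[gauss_noise R n]_g (l ^+ 2 * (v + N g) ^+ 2 + 2)%:E <=
      ((expR (l * v) + expR (- (l * v))) * expR (l ^+ 2 * s / 2))%:E)%E.
    apply: (@le_trans _ _ (\int[gauss_noise R n]_g
        ((expR (l * v))%:E * (expR (l * N g))%:E +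
         (expR (- (l * v)))%:E * (expR (- l * N g))%:E))%E).
      apply: ge0_integral_mono => g.
        by rewrite lee_fin addr_ge0// mulr_ge0// ?sqr_ge0// ltW.
      rewrite -!EFinM -!EFinD -!expRD lee_fin -lerBrDr -exprMn mulNr -opprD -mulrDr.
      exact: expR_sym_ge.
    rewrite ge0_integralD//; last 2 first.
    - exact: measurable_funeM.
    - exact: measurable_funeM.
    rewrite !ge0_integralZl// !EN -!EFinM -EFinD sqrrN -mulrDl//.
  have EI : (\int[gauss_noise R n]_g (l ^+ 2 * (v + N g) ^+ 2 + 2)%:E =
      (l ^+ 2)%:E * \int[gauss_noise R n]_g ((v + N g) ^+ 2)%:E + 2%:E)%E.
    under eq_integral do rewrite EFinD EFinM.
    rewrite ge0_integralD//.
    - rewrite ge0_integralZl ?integral_prob_cst ?lee_fin ?sqr_ge0//.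
      by move=> g _; rewrite lee_fin sqr_ge0.
    - by move=> g _; rewrite lee_fin mulr_ge0 ?sqr_ge0.
    - exact: measurable_funeM.
  move: E2; rewrite EI.
  have : (0 <= \int[gauss_noise R n]_g ((v + N g) ^+ 2)%:E)%E.
    by apply: integral_ge0 => g _; rewrite lee_fin sqr_ge0.
  case: (integral _ _ _) => [I _||//]; last first.
    by rewrite gt0_muley ?lte_fin.
  rewrite -EFinM -EFinD !lee_fin => H.
  rewrite -(ler_pM2l l20).
  move: (expR_sym_le (l * v)); rewrite normrM (gtr0_norm l0) exprMn expRD.
  move: H; set A := _ + expR (- _); set Ex := expR (l * _); set Es := expR _ => H A2.
  have Es1 : 1 <= Es by rewrite /Es -[leLHS]expR0 ler_expR mulr_ge0// mulr_ge0// ltW.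
  have Ex1 : 1 <= Ex by rewrite /Ex -[leLHS]expR0 ler_expR mulr_ge0// ltW.
  have A3 : A * Es <= (l ^+ 2 * v ^+ 2 * Ex + 2) * Es by rewrite ler_wpM2r//; lra.
  have Es2 : Es - 1 <= l ^+ 2 * s / 2 * Es.
    have : Es * (1 - l ^+ 2 * s / 2) <= 1.
      rewrite -[leRHS](expRxMexpNx_1 (l ^+ 2 * s / 2)) ler_wpM2l ?expR_ge0//.
      exact: expR_ge1Dx.
    lra.
  have : l ^+ 2 * s * Es <= l ^+ 2 * s * Es * Ex.
    by rewrite ler_peMr// mulr_ge0 ?expR_ge0// mulr_ge0// ltW.
  lra.
have : (0 <= \int[gauss_noise R n]_g ((v + N g) ^+ 2)%:E)%E.
  by apply: integral_ge0 => g _; rewrite lee_fin sqr_ge0.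
move: bound; case: (integral _ _ _) => [I||//] bound; last first.
  by have := bound 1 ltr01; rewrite leNgt ltry.
rewrite !lee_fin => I0; rewrite leNgt; apply/negP => CI.
set C := v ^+ 2 + s in CI bound; pose m : R := `|v| + s / 2.
have m0 : 0 <= m by rewrite addr_ge0// divr_ge0.
(* If the integral [I] exceeded [C], this [l] would be small enough for a contradiction: for
   [l <= 1] the exponent is at most [l * m], so [I * (1 - l * m) <= C], whereas
   [l * m * I < I - C]. *)
pose l := Num.min 1 ((I - C) / (2 * (m * I + 1))).
have mI : 0 <= m * I by rewrite mulr_ge0.
have l0 : 0 < l.
  by rewrite lt_min ltr01 divr_gt0 ?subr_gt0// mulr_gt0// ltr_wpDl.
have l1 : l <= 1 by rewrite ge_min lexx.
have l2 : l * (2 * (m * I + 1)) <= I - C.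
  by rewrite -ler_pdivlMr ?mulr_gt0 ?ltr_wpDl// ge_min lexx orbT.
have := bound l l0; rewrite lee_fin => H.
have el : l * `|v| + l ^+ 2 * s / 2 <= l * m.
  rewrite /m mulrDr lerD2l -mulrA ler_wpM2r ?divr_ge0// expr2 ler_piMl//.
  exact: ltW.
have C0 : 0 <= C by rewrite addr_ge0 ?sqr_ge0.
have H2 : I <= C * expR (l * m).
  by apply: le_trans H _; rewrite ler_wpM2l// ler_expR.
have H3 : I * (1 - l * m) <= C.
  apply: (@le_trans _ _ (I * expR (- (l * m)))).
    by rewrite ler_wpM2l//; exact: expR_ge1Dx.
  apply: le_trans (ler_wpM2r (expR_ge0 _) H2) _.
  by rewrite -mulrA expRxMexpNx_1 mulr1.
nra.
Qed.

End second_moment.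

(** * Codebooks for the scalar statistics *)

Section information_density.
Variable R : realType.

(* Information density of the scalar channel [b = s x + N(0, s)] with standard
   normal input [x]. *)
Definition info_density (s b x : R) : R :=
  b * x - s * x ^+ 2 / 2 + ln (1 + s) / 2 - b ^+ 2 / (2 * (1 + s)).

Lemma info_density_true (s x w : R) : 0 <= s ->
  info_density s (s * x + w) x =
  ln (1 + s) / 2 + (s * x ^+ 2 + 2 * w * x - w ^+ 2) / (2 * (1 + s)).
Proof.
move=> s0; rewrite /info_density.
have : 1 + s != 0 by rewrite gt_eqF// ltr_wpDr.
by move=> s1; field.
Qed.

(** For [s > 0] the exponential of the density is the likelihood ratio of N(s x, s) against the
    output law N(0, s (1 + s)); averaged over the input law it is one at every output [b]. *)
Lemma integral_info_density L (s tau : R) (b : 'I_L -> R) : 0 <= s ->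
  (\int[gauss_word R L]_x
    (expR (\sum_(k < L) info_density s (b k) (tnth x k) - tau))%:E
   = (expR (- tau))%:E)%E.
Proof.
move=> s0; have s1 : 0 < 1 + s by rewrite ltr_wpDr.
pose c := \sum_(k < L) (ln (1 + s) / 2 - b k ^+ 2 / (2 * (1 + s))) - tau.
transitivity (\int[gauss_word R L]_x ((expR c)%:E *
   (expR (\sum_(k < L) (b k * tnth x k + (- (s / 2)) * tnth x k ^+ 2)))%:E))%E.
  apply: eq_integral => x _; rewrite -EFinM -expRD; congr (expR _)%:E.
  rewrite /c addrAC; congr (_ - _); rewrite -big_split/=; apply: eq_bigr => k _.
  by rewrite /info_density; ring.
rewrite ge0_integralZl//; last by measurable_real.
rewrite integral_gauss_word_quad; last by lra.
rewrite -EFinM -expRD /c addrAC -big_split/=; congr (expR _)%:E.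
rewrite big1 ?add0r// => k _.
rewrite (_ : 1 - 2 * - (s / 2) = 1 + s); last by field.
by ring.
Qed.

End information_density.

Section scalar_code.
Variable R : realType.
Local Notation mR := (measurableTypeR R).
Variables (h n L : nat) (p1 q1 p2 q2 : nat -> R) (eps sg : R).
Hypotheses (h0 : (0 < h)%N) (Ln : (L * h <= n)%N).
Hypotheses (eps0 : 0 < eps) (eps1 : eps <= 1) (sg1 : sg ^+ 2 = 1).

Local Notation word := (L.-tuple mR).
Local Notation noise := (n.-tuple (mR * mR)).
Local Notation mu := (gauss_word R L).
Local Notation nu := (gauss_noise R n).

Definition form_cov : R := \sum_(j < h) (p1 j * p2 j + q1 j * q2 j).
Local Notation s11 := (form_var h p1 q1).
Local Notation s22 := (form_var h p2 q2).
Local Notation s12 := form_cov.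
(** By the Sherman-Morrison formula, [l2 - regression * l1] is the matched filter for [x2] when [x1]
    is added to the noise, and [s22'] is its gain. Since [s12 - r * s11 = r], the coefficient [r] is
    also the residual gain of [x1]. *)
Definition regression : R := s12 / (1 + s11).
Local Notation r := regression.
Definition s22' : R := s22 - r * s12.
Let p' j := p2 j - r * p1 j.
Let q' j := q2 j - r * q1 j.

Lemma s11_ge0 : 0 <= s11. Proof. exact: form_var_ge0. Qed.
Lemma s22_ge0 : 0 <= s22. Proof. exact: form_var_ge0. Qed.

(** The total noise of that filter, residual [x1] included, has variance equal to its gain, so it is
    again a scalar channel of the form [s x + N(0, s)]. *)
Lemma s22'E : r ^+ 2 + form_var h p' q' = s22'.
Proof.
have -> : form_var h p' q' = s22 - 2 * r * s12 + r ^+ 2 * s11.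
  rewrite /form_var /form_cov !big_distrr/= -sumrB -big_split/=.
  by apply: eq_bigr => j _; rewrite /p' /q'; ring.
have s1 : 1 + s11 != 0 by rewrite gt_eqF// ltr_wpDr// s11_ge0.
by rewrite /s22' /regression; field.
Qed.

Lemma s22'_ge0 : 0 <= s22'.
Proof. by rewrite -s22'E addr_ge0 ?sqr_ge0 ?form_var_ge0. Qed.

(** Chain rule for mutual information: the thresholds of the two terms of the joint test add up to
    the sum-rate determinant. *)
Lemma det_factor : (1 + s11) * (1 + s22') = (1 + s11) * (1 + s22) - s12 ^+ 2.
Proof.
have s1 : 1 + s11 != 0 by rewrite gt_eqF// ltr_wpDr// s11_ge0.
by rewrite /s22' /regression; field.
Qed.

Definition stat1 (x1 x2 : word) (g : noise) (k : 'I_L) : R :=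
  s11 * tnth x1 k + s12 * tnth x2 k + noise_form h p1 q1 k g.
Definition stat2 (x1 x2 : word) (g : noise) (k : 'I_L) : R :=
  s12 * tnth x1 k + s22 * tnth x2 k + noise_form h p2 q2 k g.

Definition score1 (l1 : 'I_L -> R) (x1 x2 : word) : R :=
  \sum_(k < L) info_density s11 (l1 k - s12 * tnth x2 k) (tnth x1 k).
Definition score2 (l2 : 'I_L -> R) (x1 x2 : word) : R :=
  \sum_(k < L) info_density s22 (l2 k - s12 * tnth x1 k) (tnth x2 k).
Definition score2' (l1 l2 : 'I_L -> R) (x2 : word) : R :=
  \sum_(k < L) info_density s22' (l2 k - r * l1 k) (tnth x2 k).

Definition threshold (s : R) : R := L%:R * (ln (1 + s) / 2 - eps).
Local Notation tau1 := (threshold s11).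
Local Notation tau2 := (threshold s22).
Local Notation tau2' := (threshold s22').

(* The joint test splits [i(x1, x2; y)] as [i(x1; y | x2) + i(x2; y)], where
   the second term treats [x1] as noise. *)
Definition passes (l1 l2 : 'I_L -> R) (x1 x2 : word) : bool :=
  [&& tau1 < score1 l1 x1 x2, tau2 < score2 l2 x1 x2 &
      tau1 + tau2' < score1 l1 x1 x2 + score2' l1 l2 x2].

(** Common Chernoff parameter: the deviations gain a term of order [lam * eps] and the moment
    generating functions cost one of order [lam ^+ 2]. *)
Let lam := eps / 16.

Lemma score1_true x1 x2 g : score1 (stat1 x1 x2 g) x1 x2 =
  L%:R * (ln (1 + s11) / 2) + \sum_(k < L)
   (s11 * tnth x1 k ^+ 2 + 2 * noise_form h p1 q1 k g * tnth x1 k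
    - noise_form h p1 q1 k g ^+ 2) / (2 * (1 + s11)).
Proof.
rewrite /score1 /stat1; under eq_bigr => k _.
  rewrite (_ : _ - _ = s11 * tnth x1 k + noise_form h p1 q1 k g); last by ring.
  rewrite info_density_true ?s11_ge0//; over.
by rewrite big_split/= sumr_const card_ord [L%:R * _]mulr_natl.
Qed.

Lemma score2_true x1 x2 g : score2 (stat2 x1 x2 g) x1 x2 =
  L%:R * (ln (1 + s22) / 2) + \sum_(k < L)
   (s22 * tnth x2 k ^+ 2 + 2 * noise_form h p2 q2 k g * tnth x2 k
    - noise_form h p2 q2 k g ^+ 2) / (2 * (1 + s22)).
Proof.
rewrite /score2 /stat2; under eq_bigr => k _.
  rewrite (_ : _ - _ = s22 * tnth x2 k + noise_form h p2 q2 k g); last by ring.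
  rewrite info_density_true ?s22_ge0//; over.
by rewrite big_split/= sumr_const card_ord [L%:R * _]mulr_natl.
Qed.

Lemma noise_formB k (g : noise) :
  noise_form h p' q' k g = noise_form h p2 q2 k g - r * noise_form h p1 q1 k g.
Proof.
rewrite /noise_form big_distrr/= -sumrB; apply: eq_bigr => t _.
by rewrite /p' /q'; ring.
Qed.

Lemma score2'_true x1 x2 g (w := fun k : 'I_L => r * tnth x1 k + noise_form h p' q' k g) :
  score2' (stat1 x1 x2 g) (stat2 x1 x2 g) x2 =
  L%:R * (ln (1 + s22') / 2) + \sum_(k < L)
   (s22' * tnth x2 k ^+ 2 + 2 * w k * tnth x2 k - w k ^+ 2) / (2 * (1 + s22')).
Proof.
rewrite /score2' /stat1 /stat2; under eq_bigr => k _.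
  rewrite (_ : _ - _ = s22' * tnth x2 k + w k).
    by rewrite info_density_true ?s22'_ge0//; over.
  have s1 : 1 + s11 != 0 by rewrite gt_eqF// ltr_wpDr// s11_ge0.
  rewrite /w noise_formB /s22'; have rE : s12 - r * s11 = r.
    by rewrite /regression; field.
  by rewrite -[in X in X * tnth x1 k + _]rE; ring.
by rewrite big_split/= sumr_const card_ord [L%:R * _]mulr_natl.
Qed.

Definition outage_term (s : R) (x w : 'I_L -> R) : R :=
  expR (outage_exponent (lam / (1 + s)) s x w - lam * (L%:R * eps)).

(** When [S] is the score of the sent word, the term equals [exp (lam * (threshold s - S))]. *)
Lemma outage_term_ge (s S : R) (x w : 'I_L -> R) : 0 <= s ->
  S = L%:R * (ln (1 + s) / 2) + \sum_(k < L)
   (s * x k ^+ 2 + 2 * w k * x k - w k ^+ 2) / (2 * (1 + s)) ->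
  S <= threshold s -> 1 <= outage_term s x w.
Proof.
move=> s0 SE St; rewrite /outage_term -[leLHS]expR0 ler_expR.
have s1 : 1 + s != 0 by rewrite gt_eqF// ltr_wpDr.
rewrite [leRHS](_ : _ = lam * (threshold s - S)).
  by rewrite mulr_ge0 ?subr_ge0// divr_ge0// ltW.
rewrite SE /threshold /outage_exponent -big_distrl/=; by field.
Qed.

(** The slack [eps / 2] here and the [eps / 2] of [cross_term] together make up the factor [1 + eps]
    in the power of transmitter 2. *)
Definition power_term (x : word) : R :=
  expR (lam * (\sum_(k < L) tnth x k ^+ 2 - L%:R * (1 + eps / 2))).
Definition cross_term (x1 x2 : word) : R :=
  expR (lam * (sg * (\sum_(k < L) tnth x1 k * tnth x2 k) - L%:R * (eps / 2))).

(** The dummy summands with coefficient [0] bring the first two terms to the shape of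
    [integral_outage], where the third has an interfering word with coefficient [r]. *)
Definition outages (w : word * word * noise) : R :=
  outage_term s11 (tnth w.1.1) (fun k => 0 * tnth w.1.2 k + noise_form h p1 q1 k w.2) +
  outage_term s22 (tnth w.1.2) (fun k => 0 * tnth w.1.1 k + noise_form h p2 q2 k w.2) +
  outage_term s22' (tnth w.1.2) (fun k => r * tnth w.1.1 k + noise_form h p' q' k w.2).

Definition bad_terms (w : word * word * noise) : R :=
  outages w + (power_term w.1.1 + power_term w.1.2 + cross_term w.1.1 w.1.2).

(** The first component is the candidate word, the last one the sent pair with the noise. In
    [confusion12] both words are candidates, and averaging over the first leaves [confusion2']. *)
Definition confusion1 (y : word * (word * word * noise)) : R :=
  expR (score1 (stat1 y.2.1.1 y.2.1.2 y.2.2) y.1 y.2.1.2 - tau1).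
Definition confusion2 (y : word * (word * word * noise)) : R :=
  expR (score2 (stat2 y.2.1.1 y.2.1.2 y.2.2) y.2.1.1 y.1 - tau2).
Definition confusion2' (y : word * (word * word * noise)) : R :=
  expR (score2' (stat1 y.2.1.1 y.2.1.2 y.2.2) (stat2 y.2.1.1 y.2.1.2 y.2.2) y.1
        - (tau1 + tau2')).
Definition confusion12 (y : word * (word * (word * word * noise))) : R :=
  expR (score1 (stat1 y.2.2.1.1 y.2.2.1.2 y.2.2.2) y.1 y.2.1 +
        score2' (stat1 y.2.2.1.1 y.2.2.1.2 y.2.2.2)
                (stat2 y.2.2.1.1 y.2.2.1.2 y.2.2.2) y.2.1 - (tau1 + tau2')).

Ltac measurable_terms :=
  rewrite ?/bad_terms ?/outages ?/outage_term ?/outage_exponent ?/power_term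
    ?/cross_term ?/confusion1 ?/confusion2 ?/confusion2' ?/confusion12
    ?/score1 ?/score2 ?/score2' ?/info_density ?/stat1 ?/stat2 ?/noise_form;
  measurable_real.

Lemma measurable_bad_terms : measurable_fun setT (fun w => (bad_terms w)%:E).
Proof. by measurable_terms. Qed.

Lemma measurable_confusion1 : measurable_fun setT (fun w => (confusion1 w)%:E).
Proof. by measurable_terms. Qed.

Lemma measurable_confusion2 : measurable_fun setT (fun w => (confusion2 w)%:E).
Proof. by measurable_terms. Qed.

Lemma measurable_confusion2' : measurable_fun setT (fun w => (confusion2' w)%:E).
Proof. by measurable_terms. Qed.

Lemma measurable_confusion12 : measurable_fun setT (fun w => (confusion12 w)%:E).
Proof. by measurable_terms. Qed.

End scalar_code.

(** * Expectation bounds for the majorants and choice of the codebooks *)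

Section codebook.
Variable R : realType.
Local Notation mR := (measurableTypeR R).
Variables (h n L : nat) (p1 q1 p2 q2 : nat -> R) (eps sg : R).
Hypotheses (h0 : (0 < h)%N) (Ln : (L * h <= n)%N).
Hypotheses (eps0 : 0 < eps) (eps1 : eps <= 1) (sg1 : sg ^+ 2 = 1).

Local Notation word := (L.-tuple mR).
Local Notation noise := (n.-tuple (mR * mR)).
Local Notation mu := (gauss_word R L).
Local Notation nu := (gauss_noise R n).
Local Notation s11 := (form_var h p1 q1).
Local Notation s22 := (form_var h p2 q2).
Local Notation r := (regression h p1 q1 p2 q2).
Local Notation s22' := (s22' h p1 q1 p2 q2).
Local Notation tau1 := (threshold L eps s11).
Local Notation tau2 := (threshold L eps s22).
Local Notation tau2' := (threshold L eps s22').
Local Notation p' := (fun j => p2 j - r * p1 j).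
Local Notation q' := (fun j => q2 j - r * q1 j).
Local Notation stat1 := (@stat1 R h n L p1 q1 p2 q2).
Local Notation stat2 := (@stat2 R h n L p1 q1 p2 q2).
Local Notation score1 := (@score1 R h L p1 q1 p2 q2).
Local Notation score2 := (@score2 R h L p1 q1 p2 q2).
Local Notation score2' := (@score2' R h L p1 q1 p2 q2).
Local Notation passes := (@passes R h L p1 q1 p2 q2 eps).
Local Notation power_term := (@power_term R L eps).
Local Notation cross_term := (@cross_term R L eps sg).
Local Notation outages := (@outages R h n L p1 q1 p2 q2 eps).
Local Notation bad_terms := (@bad_terms R h n L p1 q1 p2 q2 eps sg).
Local Notation confusion1 := (@confusion1 R h n L p1 q1 p2 q2 eps).
Local Notation confusion2 := (@confusion2 R h n L p1 q1 p2 q2 eps).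
Local Notation confusion2' := (@confusion2' R h n L p1 q1 p2 q2 eps).
Local Notation confusion12 := (@confusion12 R h n L p1 q1 p2 q2 eps).
Let lam := eps / 16.

(** The constant is set by the power term, where [lam * (1 + eps / 4) - lam * (1 + eps / 2) = - eps
    ^+ 2 / 64]; the other terms leave at least [7 * eps ^+ 2 / 256]. *)
Definition decay : R := expR (- (L%:R * (eps ^+ 2 / 64))).

Let lam0 : 0 <= lam. Proof. by rewrite divr_ge0// ltW. Qed.
Let eps2 : eps ^+ 2 <= 1. Proof. by rewrite expr_le1// ltW. Qed.
Let lam2E : lam ^+ 2 = eps ^+ 2 / 256. Proof. by rewrite /lam; field. Qed.
Let lam2 : lam ^+ 2 <= 2^-1. Proof. by have := eps2; rewrite lam2E; lra. Qed.
Let lam2eps : lam ^+ 2 - lam * (eps / 2) <= - (eps ^+ 2 / 64).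
Proof.
have -> : lam * (eps / 2) = eps ^+ 2 / 32 by rewrite /lam; field.
by have := sqr_ge0 eps; rewrite lam2E; lra.
Qed.

Local Notation I3 f := (\int[prod_prob (prod_prob mu mu) nu]_w (f w)%:E)%E.

Lemma integral_scale3 (c : R) (f : word * word * noise -> R) :
  measurable_fun setT (fun w => (f w)%:E) -> (forall w, 0 <= f w) -> 0 <= c ->
  I3 (fun w => c * f w) = (c%:E * I3 f)%E.
Proof.
move=> mf f0 c0; under eq_integral do rewrite EFinM.
by rewrite ge0_integralZl//; move=> w _; rewrite lee_fin.
Qed.

Lemma integral_add3 (f g : word * word * noise -> R) (a b : R) :
  measurable_fun setT (fun w => (f w)%:E) -> (forall w, 0 <= f w) ->
  measurable_fun setT (fun w => (g w)%:E) -> (forall w, 0 <= g w) ->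
  (I3 f <= a%:E)%E -> (I3 g <= b%:E)%E ->
  (I3 (fun w => f w + g w) <= (a + b)%:E)%E.
Proof.
move=> mf f0 mg g0 fa gb; under eq_integral do rewrite EFinD.
rewrite ge0_integralD// ?EFinD ?leeD//; by move=> w _; rewrite lee_fin.
Qed.

Let outage_scale (s : R) (x w : 'I_L -> R) : outage_term eps s x w =
  expR (- (lam * (L%:R * eps))) * expR (outage_exponent (lam / (1 + s)) s x w).
Proof. by rewrite /outage_term expRD mulrC. Qed.

Let decay_bound (a : \bar R) : (a <= (expR (L%:R * lam ^+ 2))%:E)%E ->
  ((expR (- (lam * (L%:R * eps))))%:E * a <= decay%:E)%E.
Proof.
move=> ha; apply: (@le_trans _ _ ((expR (- (lam * (L%:R * eps))))%:E *
   (expR (L%:R * lam ^+ 2))%:E)%E).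
  by rewrite lee_pmul2l// ?lte_fin ?expR_gt0// fin_numE.
rewrite -EFinM -expRD lee_fin /decay ler_expR.
rewrite [leLHS](_ : _ = L%:R * (lam ^+ 2 - lam * eps)); last by ring.
rewrite -(mulrN L%:R) ler_wpM2l ?ler0n//; apply: le_trans lam2eps.
rewrite lerD2l lerN2 ler_wpM2l ?lam0// ler_pdivrMr//.
by move: eps0; lra.
Qed.

Lemma integral_outage1 : (I3 (fun w : word * word * noise =>
   outage_term eps s11 (tnth w.1.1)
     (fun k => (0:R) * tnth w.1.2 k + noise_form h p1 q1 k w.2)) <= decay%:E)%E.
Proof.
under eq_integral do rewrite outage_scale.
rewrite integral_scale3 ?expR_ge0//; last first.
  by rewrite /outage_exponent /noise_form; measurable_real.
apply: decay_bound.
rewrite integral_prod3_zyx//; last first.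
  by rewrite /outage_exponent /noise_form; measurable_real.
have := @integral_outage R n h L p1 q1 0 lam h0 Ln lam0 lam2.
by rewrite expr0n/= add0r.
Qed.

Lemma integral_outage2 : (I3 (fun w : word * word * noise =>
   outage_term eps s22 (tnth w.1.2)
     (fun k => (0:R) * tnth w.1.1 k + noise_form h p2 q2 k w.2)) <= decay%:E)%E.
Proof.
under eq_integral do rewrite outage_scale.
rewrite integral_scale3 ?expR_ge0//; last first.
  by rewrite /outage_exponent /noise_form; measurable_real.
apply: decay_bound.
rewrite integral_prod3_zxy//; last first.
  by rewrite /outage_exponent /noise_form; measurable_real.
have := @integral_outage R n h L p2 q2 0 lam h0 Ln lam0 lam2.
by rewrite expr0n/= add0r.
Qed.

Lemma integral_outage2' : (I3 (fun w : word * word * noise =>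
   outage_term eps s22' (tnth w.1.2)
     (fun k => r * tnth w.1.1 k + noise_form h p' q' k w.2)) <= decay%:E)%E.
Proof.
under eq_integral do rewrite outage_scale.
rewrite integral_scale3 ?expR_ge0//; last first.
  by rewrite /outage_exponent /noise_form; measurable_real.
apply: decay_bound.
rewrite integral_prod3_zxy//; last first.
  by rewrite /outage_exponent /noise_form; measurable_real.
have := @integral_outage R n h L p' q' r lam h0 Ln lam0 lam2.
by rewrite s22'E.
Qed.

(** Here [1 + v / (1 - v) = 1 / (1 - v)]. The power term needs this first-order sharp bound:
    [ln1B_ge] would lose a factor two. *)
Let ln1B_ge2 (v : R) : 0 <= v -> v < 1 -> - (ln (1 - v)) <= v / (1 - v).
Proof.
move=> v0 v1; have lt1 : 0 < 1 - v by rewrite subr_gt0.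
rewrite lerNl -ler_expR lnK ?posrE// expRN invf_ple ?posrE ?expR_gt0//.
apply: le_trans (expR_ge1Dx _).
by rewrite [leRHS](_ : _ = (1 - v)^-1)//; field; rewrite gt_eqF.
Qed.

Let integral_power_word : (\int[mu]_x (power_term x)%:E <= decay%:E)%E.
Proof.
pose c := expR (- (lam * (L%:R * (1 + eps / 2)))).
have c0 : (0 <= c%:E)%E by rewrite lee_fin expR_ge0.
rewrite [leLHS](_ : _ = \int[mu]_x (c%:E * (expR (\sum_(k < L)
   (0 * tnth x k + lam * tnth x k ^+ 2)))%:E))%E; last first.
  apply: eq_integral => x _.
  rewrite -EFinM -expRD /power_term -/lam; congr (expR _)%:E.
  rewrite mulrBr addrC big_distrr/=; congr (_ + _).
  by apply: eq_bigr => k _; rewrite mul0r add0r.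
rewrite ge0_integralZl//; last by measurable_real.
have l1 : 2 * lam < 1 by move: eps1; rewrite /lam; lra.
rewrite integral_gauss_word_quad// -EFinM -expRD lee_fin /decay ler_expR.
rewrite (eq_bigr (fun=> - ln (1 - 2 * lam) / 2)); last first.
  by move=> k _; rewrite expr0n/= mul0r sub0r mulNr.
rewrite sumr_const card_ord -[X in _ + X]mulr_natl.
rewrite [leLHS](_ : _ = L%:R * (- ln (1 - 2 * lam) / 2 - lam * (1 + eps / 2)));
  last by ring.
rewrite -(mulrN L%:R) ler_wpM2l ?ler0n//.
have v0 : 0 <= 2 * lam by rewrite mulr_ge0.
have := ln1B_ge2 v0 l1.
(* As [2 * lam = eps / 8], this follows from [(1 - eps / 8) * (1 + eps / 4) >= 1]. *)
have : 2 * lam / (1 - 2 * lam) <= 2 * lam * (1 + eps / 4).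
  rewrite ler_pdivrMr ?subr_gt0// /lam.
  have : 0 <= eps * (eps * (1 / 8 - eps / 32)).
    by rewrite mulr_ge0 ?mulr_ge0//; move: eps0 eps1; lra.
  lra.
by have := sqr_ge0 eps; rewrite /lam; lra.
Qed.

Lemma integral_power1 : (I3 (fun w : word * word * noise => power_term w.1.1)
  <= decay%:E)%E.
Proof.
rewrite integral_prod3_zyx; [|by rewrite /power_term; measurable_real
  |by move=> w; rewrite lee_fin expR_ge0].
apply: integral_le_cst => g; first by do 2 apply: integral_ge0 => ? _; rewrite lee_fin expR_ge0.
apply: integral_le_cst => x2; last exact: integral_power_word.
by apply: integral_ge0 => ? _; rewrite lee_fin expR_ge0.
Qed.

Lemma integral_power2 : (I3 (fun w : word * word * noise => power_term w.1.2)
  <= decay%:E)%E.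
Proof.
rewrite integral_prod3_zxy; [|by rewrite /power_term; measurable_real
  |by move=> w; rewrite lee_fin expR_ge0].
apply: integral_le_cst => g; first by do 2 apply: integral_ge0 => ? _; rewrite lee_fin expR_ge0.
apply: integral_le_cst => x2; last exact: integral_power_word.
by apply: integral_ge0 => ? _; rewrite lee_fin expR_ge0.
Qed.

(** Integrating over [x1] turns the linear exponent into [lam ^+ 2 * x2 ^+ 2 / 2], where the sign
    disappears because [sg ^+ 2 = 1]; the integral over [x2] is then quadratic. *)
Lemma integral_cross :
  (I3 (fun w : word * word * noise => cross_term w.1.1 w.1.2) <= decay%:E)%E.
Proof.
rewrite integral_prod3_zyx; [|by rewrite /cross_term; measurable_real
  |by move=> w; rewrite lee_fin expR_ge0].
apply: integral_le_cst => g /=; first by do 2 apply: integral_ge0 => ? _; rewrite lee_fin expR_ge0.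
pose c := expR (- (lam * (L%:R * (eps / 2)))).
have c0 : (0 <= c%:E)%E by rewrite lee_fin expR_ge0.
rewrite [leLHS](_ : _ = \int[mu]_x2 (c%:E * (expR (\sum_(k < L)
   (0 * tnth x2 k + (lam ^+ 2 / 2) * tnth x2 k ^+ 2)))%:E))%E; last first.
  apply: eq_integral => x2 _.
  transitivity (\int[mu]_x1 (c%:E * (expR (\sum_(k < L)
     ((lam * sg * tnth x2 k) * tnth x1 k + 0 * tnth x1 k ^+ 2)))%:E))%E.
    apply: eq_integral => x1 _.
    rewrite -EFinM -expRD /cross_term -/lam; congr (expR _)%:E.
    rewrite mulrBr addrC (mulrA lam sg) big_distrr/=; congr (_ + _).
    by apply: eq_bigr => k _; ring.
  rewrite ge0_integralZl//; last by measurable_real.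
  rewrite integral_gauss_word_quad ?mulr0//; congr (_ * (expR _)%:E)%E.
  apply: eq_bigr => k _.
  by rewrite subr0 ln1 mul0r subr0 mul0r add0r !exprMn sg1 !mulr1; field.
rewrite ge0_integralZl//; last by measurable_real.
have e2 : 2 * (lam ^+ 2 / 2) = lam ^+ 2 by field.
have l1 : 2 * (lam ^+ 2 / 2) < 1 by rewrite e2; have := lam2; lra.
rewrite integral_gauss_word_quad// -EFinM -expRD lee_fin /decay ler_expR.
rewrite (eq_bigr (fun=> - (ln (1 - lam ^+ 2) / 2))); last first.
  by move=> k _; rewrite expr0n/= mul0r sub0r e2.
rewrite sumr_const card_ord -[X in _ + X]mulr_natl.
rewrite [leLHS](_ : _ = L%:R * (- (ln (1 - lam ^+ 2) / 2) - lam * (eps / 2)));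
  last by ring.
rewrite -(mulrN L%:R) ler_wpM2l ?ler0n//.
apply: le_trans lam2eps; rewrite lerD2r; apply: ln1B_ge; last exact: lam2.
exact: sqr_ge0.
Qed.

Lemma integral_bad_terms :
  (\int[nu]_g \int[mu]_x2 \int[mu]_x1 (bad_terms ((x1, x2), g))%:E
   <= (6 * decay)%:E)%E.
Proof.
have mO : measurable_fun setT (fun w => (bad_terms w)%:E).
  exact: measurable_bad_terms.
rewrite -(integral_prod3_zyx _ _ _ mO); last first.
  by move=> w; rewrite lee_fin !addr_ge0 ?expR_ge0.
rewrite [6 * decay](_ : _ = decay + decay + decay + (decay + decay + decay));
  last by ring.
apply: integral_add3.
- by rewrite /outages /outage_term /outage_exponent /noise_form; measurable_real.
- by move=> w; rewrite !addr_ge0 ?expR_ge0.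
- by rewrite /power_term /cross_term; measurable_real.
- by move=> w; rewrite !addr_ge0 ?expR_ge0.
- apply: integral_add3 integral_outage2'.
  + by rewrite /outage_term /outage_exponent /noise_form; measurable_real.
  + by move=> w; rewrite !addr_ge0 ?expR_ge0.
  + by rewrite /outage_term /outage_exponent /noise_form; measurable_real.
  + by move=> w; rewrite expR_ge0.
  apply: integral_add3 integral_outage1 integral_outage2.
  + by rewrite /outage_term /outage_exponent /noise_form; measurable_real.
  + by move=> w; rewrite expR_ge0.
  + by rewrite /outage_term /outage_exponent /noise_form; measurable_real.
  + by move=> w; rewrite expR_ge0.
- apply: integral_add3 integral_cross.
  + by rewrite /power_term; measurable_real.
  + by move=> w; rewrite !addr_ge0 ?expR_ge0.
  + by rewrite /cross_term; measurable_real.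
  + by move=> w; rewrite expR_ge0.
  apply: integral_add3 integral_power1 integral_power2.
  + by rewrite /power_term; measurable_real.
  + by move=> w; rewrite expR_ge0.
  + by rewrite /power_term; measurable_real.
  + by move=> w; rewrite expR_ge0.
Qed.

Lemma confusion1_le w : (\int[mu]_x (confusion1 (x, w))%:E <= (expR (- tau1))%:E)%E.
Proof.
by rewrite -(integral_info_density tau1 (fun k => stat1 w.1.1 w.1.2 w.2 k
  - form_cov h p1 q1 p2 q2 * tnth w.1.2 k) (s11_ge0 h p1 q1)).
Qed.

Lemma confusion2_le w : (\int[mu]_x (confusion2 (x, w))%:E <= (expR (- tau2))%:E)%E.
Proof.
by rewrite -(integral_info_density tau2 (fun k => stat2 w.1.1 w.1.2 w.2 k
  - form_cov h p1 q1 p2 q2 * tnth w.1.1 k) (s22_ge0 h p2 q2)).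
Qed.

Lemma confusion2'_le w :
  (\int[mu]_x (confusion2' (x, w))%:E <= (expR (- (tau1 + tau2')))%:E)%E.
Proof.
by rewrite -(integral_info_density (tau1 + tau2') (fun k =>
  stat2 w.1.1 w.1.2 w.2 k - r * stat1 w.1.1 w.1.2 w.2 k)
  (s22'_ge0 h p1 q1 p2 q2)).
Qed.

Lemma confusion12_le x' w :
  (\int[mu]_x (confusion12 (x, (x', w)))%:E <= (confusion2' (x', w))%:E)%E.
Proof.
pose l1 := stat1 w.1.1 w.1.2 w.2; pose l2 := stat2 w.1.1 w.1.2 w.2.
(* The second score does not involve the word being averaged, so it is absorbed, with opposite sign,
   into the free constant [tau]. *)
have := @integral_info_density R L s11 (- (score2' l1 l2 x' - (tau1 + tau2')))
  (fun k => l1 k - form_cov h p1 q1 p2 q2 * tnth x' k) (s11_ge0 _ _ _).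
rewrite opprK => <-.
apply: ge0_integral_mono => x; first by rewrite lee_fin expR_ge0.
by rewrite /confusion12 /= addrA.
Qed.

Lemma lee_sum_term (I : finType) (P : pred I) (f : I -> \bar R) i :
  P i -> (forall j, 0 <= f j)%E -> (f i <= \sum_(j | P j) f j)%E.
Proof. by move=> Pi f0; rewrite (bigD1 i)//= leeDl// sume_ge0. Qed.

Let U K1 K2 := @union_bound _ _ _ _ R K1 K2 (fun w => (bad_terms w)%:E)
  (fun w => (confusion1 w)%:E) (fun w => (confusion2 w)%:E)
  (fun w => (confusion12 w)%:E).

Let bad_ge0 w : (0 <= (bad_terms w)%:E)%E.
Proof. by rewrite lee_fin !addr_ge0 ?expR_ge0. Qed.

Lemma union_bound_bad K1 K2 (c1 : 'I_K1 -> word) (c2 : 'I_K2 -> word) m1 m2 g :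
  ((bad_terms ((c1 m1, c2 m2), g))%:E <= U c1 c2 m1 m2 g)%E.
Proof.
rewrite /U /union_bound -!addeA leeDl// !adde_ge0// !sume_ge0// => m _.
- by rewrite lee_fin expR_ge0.
- by rewrite lee_fin expR_ge0.
- by rewrite sume_ge0// => m' _; rewrite lee_fin expR_ge0.
Qed.

(** Contains every error of a decoder that returns an arbitrary passing pair: either the sent pair
    fails or some other pair passes. *)
Definition decoding_error K1 K2 (c1 : 'I_K1 -> word) (c2 : 'I_K2 -> word) m1 m2
    (l1 l2 : 'I_L -> R) : bool :=
  ~~ passes l1 l2 (c1 m1) (c2 m2) ||
  [exists p : 'I_K1 * 'I_K2, (p != (m1, m2)) && passes l1 l2 (c1 p.1) (c2 p.2)].

Lemma union_bound_error K1 K2 (c1 : 'I_K1 -> word) (c2 : 'I_K2 -> word) m1 m2 g :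
  decoding_error c1 c2 m1 m2 (stat1 (c1 m1) (c2 m2) g) (stat2 (c1 m1) (c2 m2) g) ->
  (1 <= U c1 c2 m1 m2 g)%E.
Proof.
set x1 := c1 m1; set x2 := c2 m2.
set l1 := stat1 x1 x2 g; set l2 := stat2 x1 x2 g.
have o0 (s : R) (x w : 'I_L -> R) : 0 <= outage_term eps s x w by exact: expR_ge0.
have bad1 : 1 <= outages ((x1, x2), g) -> (1 <= U c1 c2 m1 m2 g)%E.
  move=> b; apply: le_trans (union_bound_bad c1 c2 m1 m2 g).
  by rewrite lee_fin /bad_terms ler_wpDr// !addr_ge0 ?expR_ge0.
have out1 : score1 l1 x1 x2 <= tau1 -> (1 <= U c1 c2 m1 m2 g)%E.
  move=> le1; apply: bad1; rewrite /outages -addrA ler_wpDr ?addr_ge0//=.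
  apply: (outage_term_ge eps0 (s11_ge0 _ _ _) _ le1).
  by rewrite score1_true; congr (_ + _); apply: eq_bigr => k _; rewrite mul0r add0r.
have out2 : score2 l2 x1 x2 <= tau2 -> (1 <= U c1 c2 m1 m2 g)%E.
  move=> le2; apply: bad1; rewrite /outages addrAC ler_wpDl ?addr_ge0//=.
  apply: (outage_term_ge eps0 (s22_ge0 _ _ _) _ le2).
  by rewrite score2_true; congr (_ + _); apply: eq_bigr => k _; rewrite mul0r add0r.
have out2' : score2' l1 l2 x2 <= tau2' -> (1 <= U c1 c2 m1 m2 g)%E.
  move=> le2; apply: bad1; rewrite /outages ler_wpDl ?addr_ge0//=.
  apply: (outage_term_ge eps0 (s22'_ge0 _ _ _ _ _) _ le2).
  exact: score2'_true.
have F0 (x : R) : (0 <= (expR x)%:E)%E by rewrite lee_fin expR_ge0.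
have S1 m : (0 <= (confusion1 (c1 m, (x1, x2, g)))%:E)%E by exact: F0.
have S2 m : (0 <= (confusion2 (c2 m, (x1, x2, g)))%:E)%E by exact: F0.
have S12 m m' : (0 <= (confusion12 (c1 m, (c2 m', (x1, x2, g))))%:E)%E by exact: F0.
case/orP => [|/existsP[[m m'] /=]].
  rewrite /passes !negb_and -!leNgt => /orP[/out1//|/orP[/out2//|le12]].
  (* A failed joint test is charged to one of its summands: if the first score exceeds its
     threshold, the second one must lie below its own. *)
  have [/out1//|lt1] := leP (score1 l1 x1 x2) tau1.
  by apply: out2'; move: le12 lt1; lra.
rewrite xpair_eqE => /andP[+ /and3P[t1 t2 t12]].
have one (z : R) : 0 < z -> (1 <= (expR z)%:E)%E.
  by move=> z0; rewrite lee_fin -[leLHS]expR0 ler_expR ltW.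
have [em|nm] := eqVneq m m1; have [em'|nm'] := eqVneq m' m2 => // _.
- apply: (@le_trans _ _ (confusion2 (c2 m', (x1, x2, g)))%:E).
    by apply: one; rewrite subr_gt0/=; move: t2; rewrite em.
  apply: le_trans (@lee_sum_term _ (fun m => m2 != m) (fun m =>
    (confusion2 (c2 m, (x1, x2, g)))%:E) m' _ _) _ => //; first by rewrite eq_sym.
  rewrite /U /union_bound addeAC leeDr// !adde_ge0// ?sume_ge0// => i _.
  by rewrite sume_ge0.
- apply: (@le_trans _ _ (confusion1 (c1 m, (x1, x2, g)))%:E).
    by apply: one; rewrite subr_gt0/=; move: t1; rewrite em'.
  apply: le_trans (@lee_sum_term _ (fun m => m1 != m) (fun m =>
    (confusion1 (c1 m, (x1, x2, g)))%:E) m _ _) _ => //; first by rewrite eq_sym.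
  rewrite /U /union_bound -2!addeA addeCA leeDl// !adde_ge0// ?sume_ge0// => i _.
  by rewrite sume_ge0.
- apply: (@le_trans _ _ (confusion12 (c1 m, (c2 m', (x1, x2, g))))%:E).
    by apply: one; rewrite subr_gt0.
  apply: le_trans (@lee_sum_term _ (fun i => m2 != i) (fun i =>
    (confusion12 (c1 m, (c2 i, (x1, x2, g))))%:E) m' _ _) _ => //.
    by rewrite eq_sym.
  apply: le_trans (@lee_sum_term _ (fun i => m1 != i) (fun i =>
    \sum_(i' | m2 != i') (confusion12 (c1 i, (c2 i', (x1, x2, g))))%:E)%E m _ _) _ => //.
  + by rewrite eq_sym.
  + by move=> i; rewrite sume_ge0.
  by rewrite /U /union_bound leeDr// !adde_ge0// ?sume_ge0.
Qed.

Definition mean2 K1 K2 (f : 'I_K1 -> 'I_K2 -> R) : R :=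
  (K1 * K2)%:R^-1 * \sum_(m1 < K1) \sum_(m2 < K2) f m1 m2.

(** By [1 + x <= exp x], an exponential average below one forces a nonpositive linear average. This
    suffices because the power constraints are averages over the messages. *)
Lemma mean2_exp_lt1 K1 K2 (f : 'I_K1 -> 'I_K2 -> R) (a : R) :
  (0 < K1)%N -> (0 < K2)%N -> 0 < a ->
  mean2 (fun m1 m2 => expR (a * f m1 m2)) < 1 -> mean2 f <= 0.
Proof.
move=> K10 K20 a0 lt1.
have c0 : 0 <= (K1 * K2)%:R^-1 :> R by rewrite invr_ge0.
have : mean2 (fun m1 m2 => 1 + a * f m1 m2) < 1.
  apply: le_lt_trans lt1; rewrite /mean2 ler_wpM2l//.
  by apply: ler_sum => m1 _; apply: ler_sum => m2 _; exact: expR_ge1Dx.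
have -> : mean2 (fun m1 m2 => 1 + a * f m1 m2) = 1 + a * mean2 f.
  rewrite /mean2; under eq_bigr do rewrite big_split/= sumr_const card_ord -big_distrr/=.
  rewrite big_split/= sumr_const card_ord -big_distrr/= mulrDr; congr (_ + _); last by ring.
  rewrite -mulrnA -[X in _ * X]/((K2 * K1)%:R) mulnC mulVf//.
  by rewrite pnatr_eq0 -lt0n muln_gt0 K10 K20.
by rewrite gtrDl pmulr_rlt0// => /ltW.
Qed.

(** All conclusions come from one averaged union bound below [B]. It dominates the error; and since
    the power and cross terms are among its nonnegative summands and free of noise, [B <= 1] puts
    each of their averages below one. *)
Lemma good_codebook K1 K2 (B : R) (c := (K1 * K2)%:R^-1 : R) :
  (0 < K1)%N -> (0 < K2)%N -> B <= 1 ->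
  6 * decay + K1.-1%:R * expR (- tau1) + K2.-1%:R * expR (- tau2)
    + K1.-1%:R * (K2.-1%:R * expR (- (tau1 + tau2'))) < B ->
  exists (c1 : 'I_K1 -> word) (c2 : 'I_K2 -> word),
    [/\ (forall E : 'I_K1 -> 'I_K2 -> n.-tuple (R * R) -> bool,
          (forall m1 m2 g, E m1 m2 g -> decoding_error c1 c2 m1 m2
             (stat1 (c1 m1) (c2 m2) g) (stat2 (c1 m1) (c2 m2) g)) ->
          (c%:E * \sum_(m1 < K1) \sum_(m2 < K2)
             gauss_int (fun g => (if E m1 m2 g then 1 else 0)%:E) <= B%:E)%E),
        mean2 (fun (m1 : 'I_K1) (_ : 'I_K2) => \sum_(k < L) tnth (c1 m1) k ^+ 2 - L%:R * (1 + eps / 2)) <= 0,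
        mean2 (fun (_ : 'I_K1) (m2 : 'I_K2) => \sum_(k < L) tnth (c2 m2) k ^+ 2 - L%:R * (1 + eps / 2)) <= 0 &
        mean2 (fun m1 m2 => sg * (\sum_(k < L) tnth (c1 m1) k * tnth (c2 m2) k)
            - L%:R * (eps / 2)) <= 0].
Proof.
move=> K10 K20 B1 HB.
have d0 : 0 <= decay by exact: expR_ge0.
have B0 : 0 <= B.
  by apply: le_trans (ltW HB); rewrite !addr_ge0 ?mulr_ge0 ?expR_ge0.
have pos (f : R) : (0 <= (expR f)%:E)%E by rewrite lee_fin expR_ge0.
have [c1 [c2 Hc]] := @random_coding _ _ _ _ R mu nu K1 K2
  (fun w => (bad_terms w)%:E)
  (fun w => (confusion1 w)%:E) (fun w => (confusion2 w)%:E)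
  (fun w => (confusion2' w)%:E) (fun w => (confusion12 w)%:E)
  (6 * decay) (expR (- tau1)) (expR (- tau2)) (expR (- (tau1 + tau2'))) B
  K10 K20 B0 (measurable_bad_terms _ _ _ _ _ _ _)
  (measurable_confusion1 _ _ _ _ _ _) (measurable_confusion2 _ _ _ _ _ _)
  (measurable_confusion2' _ _ _ _ _ _) (measurable_confusion12 _ _ _ _ _ _)
  bad_ge0 (fun w => pos _) (fun w => pos _) (fun w => pos _) (fun w => pos _)
  integral_bad_terms
  confusion1_le confusion2_le confusion12_le confusion2'_le HB.
have c0 : 0 <= c by rewrite invr_ge0.
have avg (f : 'I_K1 -> 'I_K2 -> n.-tuple (mR * mR) -> \bar R) :
    (forall m1 m2 g, 0 <= f m1 m2 g)%E ->
    (forall m1 m2 g, f m1 m2 g <= U c1 c2 m1 m2 g)%E ->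
    (c%:E * \sum_(m1 < K1) \sum_(m2 < K2) \int[nu]_g f m1 m2 g < B%:E)%E.
  move=> f0 fU; apply: le_lt_trans Hc; rewrite lee_wpmul2l ?lee_fin//.
  apply: lee_sum => m1 _; apply: lee_sum => m2 _.
  exact: ge0_integral_mono.
have avgc (f : 'I_K1 -> 'I_K2 -> R) :
    (forall m1 m2 g, expR (eps / 16 * f m1 m2) <= bad_terms ((c1 m1, c2 m2), g)) ->
    mean2 f <= 0.
  move=> fb; apply: (@mean2_exp_lt1 _ _ _ (eps / 16)) => //; first by rewrite divr_gt0.
  have := avg (fun m1 m2 _ => (expR (eps / 16 * f m1 m2))%:E) (fun _ _ _ => pos _).
  under eq_bigr do under eq_bigr do rewrite integral_prob_cst.
  under eq_bigr do rewrite sumEFin.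
  rewrite sumEFin -EFinM lte_fin => H; apply: lt_le_trans B1; apply: H.
  move=> m1 m2 g; apply: le_trans (union_bound_bad c1 c2 m1 m2 g).
  by rewrite lee_fin.
have o0 (s : R) (x w : 'I_L -> R) : 0 <= outage_term eps s x w by exact: expR_ge0.
exists c1, c2; split.
- move=> E HE; apply: le_trans (ltW Hc); rewrite lee_wpmul2l ?lee_fin//.
  apply: lee_sum => m1 _; apply: lee_sum => m2 _.
  have U0 g : (0 <= U c1 c2 m1 m2 g)%E.
    exact: le_trans (union_bound_bad c1 c2 m1 m2 g).
  have mU : measurable_fun setT (U c1 c2 m1 m2).
    rewrite /U /union_bound; apply: emeasurable_funD; first apply: emeasurable_funD;
      first apply: emeasurable_funD.
    - apply: (measurable_comp_fun (measurable_bad_terms _ _ _ _ _ _ _)).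
      by measurable_projection.
    - apply: emeasurable_sum_cond => m.
      apply: (measurable_comp_fun (measurable_confusion1 _ _ _ _ _ _)).
      by measurable_projection.
    - apply: emeasurable_sum_cond => m.
      apply: (measurable_comp_fun (measurable_confusion2 _ _ _ _ _ _)).
      by measurable_projection.
    - apply: emeasurable_sum_cond => m; apply: emeasurable_sum_cond => m'.
      apply: (measurable_comp_fun (measurable_confusion12 _ _ _ _ _ _)).
      by measurable_projection.
  apply: (@le_trans _ _ (gauss_int (U c1 c2 m1 m2))).
    apply: gauss_int_mono => g; first by case: ifP.
    by case: ifPn => [/HE|_]; [exact: union_bound_error|exact: U0].
  by rewrite (gauss_intE mU U0).
- apply: avgc => m1 m2 g; rewrite /bad_terms ler_wpDl ?addr_ge0//.
  by rewrite -addrA ler_wpDr// addr_ge0// expR_ge0.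
- apply: avgc => m1 m2 g; rewrite /bad_terms ler_wpDl ?addr_ge0//.
  by rewrite addrAC ler_wpDl// addr_ge0// expR_ge0.
- apply: avgc => m1 m2 g; rewrite /bad_terms ler_wpDl ?addr_ge0//.
  by rewrite ler_wpDl// addr_ge0// expR_ge0.
Qed.

End codebook.

(** * The block code and its trajectories *)

Section block_code.
Variables (R : realType) (N s2 : R) (e n : nat).
Local Notation mR := (measurableTypeR R).
Local Notation h := e.+1.
Local Notation L := (n %/ h)%N.
Variables (a1 a2 : 'cV[R]_h) (B2 : 'M[R]_h) (u1 u2 : 'cV[R]_h) (eps : R).
Variables (M1 M2 : nat).
Variables (c1 : 'I_M1.+1 -> L.-tuple mR) (c2 : 'I_M2.+1 -> L.-tuple mR).
Hypotheses (N0 : 0 <= N) (s20 : 0 <= s2) (B2low : strictly_lower B2).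

(** Together with [noise_coef2], the coefficients of the standard normals behind [Z] and [W] in
    [u^T (Z + B2 W)]. *)
Definition noise_coef1 (u : 'cV[R]_h) (j : nat) : R := Num.sqrt N * u (inord j) 0.
Definition noise_coef2 (u : 'cV[R]_h) (j : nat) : R :=
  Num.sqrt s2 * (B2^T *m u) (inord j) 0.

Definition word_at (x : L.-tuple mR) (k : nat) : R := nth (0 : R) (x : seq R) k.

Definition block_enc1 (m : 'I_M1.+1) (t : nat) : R :=
  if (t < L * h)%N then a1 (inord (t %% h)) 0 * word_at (c1 m) (t %/ h) else 0.

(** The sum runs over the whole block; causality is due to the zeros of [B2] on and above the
    diagonal. Nothing is sent after the last complete block. *)
Definition block_enc2 (m : 'I_M2.+1) (t : nat) (v : n.-tuple R) : R :=
  if (t < L * h)%N then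
    a2 (inord (t %% h)) 0 * word_at (c2 m) (t %/ h) +
    \sum_(i < h) B2 (inord (t %% h)) i * nth 0 v (t %/ h * h + i)
  else 0.

(* [(1 - B2)^T] undoes the feedback loop, see [block_whitened]. *)
Definition block_stat (u : 'cV[R]_h) (y : seq R) (k : 'I_L) : R :=
  \sum_(j < h) ((1%:M - B2)^T *m u) j 0 * nth 0 y (k * h + j).

Definition block_test (y : n.-tuple R) (p : 'I_M1.+1 * 'I_M2.+1) : bool :=
  passes h (noise_coef1 u1) (noise_coef2 u1) (noise_coef1 u2) (noise_coef2 u2) eps
    (block_stat u1 y) (block_stat u2 y) (c1 p.1) (c2 p.2).

Definition block_dec (y : n.-tuple R) : 'I_M1.+1 * 'I_M2.+1 :=
  odflt (ord0, ord0) [pick p | block_test y p].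

Definition block_code : Defs.code R n := Code block_enc1 block_enc2 block_dec.

Lemma block_index_lt k j : (k < L)%N -> (j < h)%N -> (k * h + j < L * h)%N.
Proof.
move=> kL jh; apply: (@leq_trans (k.+1 * h)); last by rewrite leq_mul2r kL orbT.
by rewrite mulSnr ltn_add2l.
Qed.

Lemma blocks_le : (L * h <= n)%N. Proof. exact: leq_divM. Qed.

Lemma block_code_causal m t (v v' : n.-tuple R) :
  (forall i : 'I_n, (i < t)%N -> tnth v i = tnth v' i) ->
  block_enc2 m t v = block_enc2 m t v'.
Proof.
move=> vv'; rewrite /block_enc2; case: ifP => // tL; congr (_ + _).
apply: eq_bigr => i _.
have [it|ti] := ltnP i (t %% h)%N; last first.
  by rewrite B2low ?mul0r//= inordK ?ltn_pmod.
have lt : (t %/ h * h + i < t)%N by rewrite [X in (_ < X)%N](divn_eq t h) ltn_add2l.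
have ltn : (t %/ h * h + i < n)%N by rewrite (ltn_trans lt)// (leq_trans tL)// blocks_le.
by congr (_ * _); have := vv' (Ordinal ltn) lt; rewrite !(tnth_nth 0).
Qed.

(** * Input-output relations over one block *)

Section trajectory.
Variables (m1 : 'I_M1.+1) (m2 : 'I_M2.+1) (g : n.-tuple (R * R)).
Local Notation V := (@Vpast R N s2 n block_code m1 m2 g).
Local Notation Y := (fun t => @Yof R N n block_code m1 m2 g t (V t)).
Local Notation X := (@X2 R N s2 n block_code m1 m2 g).
Local Notation x1 := (word_at (c1 m1)).
Local Notation x2 := (word_at (c2 m2)).

Lemma size_Vpast t : size (V t) = t.
Proof. by elim: t => //= t IH; rewrite size_rcons IH. Qed.

Lemma nth_Vpast t i : (i < t)%N -> nth 0 (V t) i = Y i + Wnoise s2 g i.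
Proof.
elim: t => // t IH; rewrite ltnS leq_eqVlt => /orP[/eqP->|it] /=.
  by rewrite nth_rcons size_Vpast ltnn eqxx.
by rewrite nth_rcons size_Vpast it IH.
Qed.

Definition block_vec (F : nat -> R) (k : nat) : 'cV[R]_h :=
  \col_(j < h) F (k * h + j)%N.

Lemma block_X2 k : (k < L)%N ->
  block_vec X k = x2 k *: a2 + B2 *m block_vec (fun t => Y t + Wnoise s2 g t) k.
Proof.
move=> kL; apply/matrixP => j j0; rewrite (ord1 j0) {j0} !mxE.
have lt := block_index_lt kL (ltn_ord j).
rewrite /X2 /X2of /= /block_enc2 lt divnMDl// divn_small// addn0 modnMDl modn_small//.
rewrite inord_val mulrC; congr (_ + _); apply: eq_bigr => i _; rewrite mxE.
(* The encoder sees the past padded with zeros, which agrees with [Y + W] only at earlier times; at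
   the other indices the entry of [B2] vanishes. *)
have [ij|ji] := ltnP i j; last by rewrite (B2low ji) !mul0r.
congr (_ * _).
have it : (k * h + i < k * h + j)%N by rewrite ltn_add2l.
have ltn : (k * h + i < n)%N.
  by rewrite (ltn_trans it)// (leq_trans lt)// blocks_le.
by rewrite -(nth_Vpast it) /pad (@nth_mktuple _ _ _ _ (Ordinal ltn)).
Qed.

Lemma block_Y k : (k < L)%N ->
  block_vec Y k = x1 k *: a1 + block_vec X k + block_vec (Znoise N g) k.
Proof.
move=> kL; apply/matrixP => j j0; rewrite (ord1 j0) {j0} !mxE.
rewrite {1}/Yof /= /block_enc1 block_index_lt// divnMDl// divn_small// addn0.
by rewrite modnMDl modn_small// inord_val [_ * a1 _ _]mulrC.
Qed.

Lemma block_vecD F G k : block_vec (fun t => F t + G t) k = block_vec F k + block_vec G k.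
Proof. by apply/matrixP => j j0; rewrite !mxE. Qed.

Lemma block_whitened k : (k < L)%N ->
  (1%:M - B2) *m block_vec Y k =
  x1 k *: a1 + x2 k *: a2 + block_vec (Znoise N g) k + B2 *m block_vec (Wnoise s2 g) k.
Proof.
move=> kL; rewrite mulmxBl mul1mx {1}(block_Y kL) (block_X2 kL) block_vecD mulmxDr.
set Yk := B2 *m block_vec Y k.
set P := x1 k *: a1; set Q := x2 k *: a2; set Z := block_vec _ _; set W := B2 *m _.
rewrite -!addrA; congr (_ + _); congr (_ + _).
by rewrite [W + _]addrC addrA [Yk + _]addrC subrK.
Qed.

Lemma noise_formE (u : 'cV[R]_h) k : (k < L)%N ->
  (u^T *m (block_vec (Znoise N g) k + B2 *m block_vec (Wnoise s2 g) k)) 0 0 =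
  noise_form h (noise_coef1 u) (noise_coef2 u) k g.
Proof.
move=> kL; rewrite /noise_form.
rewrite (eq_bigr (fun t : 'I_n => noise_coef1 u (t %% h) * (nth (0, 0) g t).1 +
    noise_coef2 u (t %% h) * (nth (0, 0) g t).2)); last first.
  by move=> t _; rewrite -tnth_nth.
rewrite (@sum_block _ n h k (fun t => noise_coef1 u (t %% h) * (nth (0, 0) g t).1 +
    noise_coef2 u (t %% h) * (nth (0, 0) g t).2))//; last first.
  by rewrite -mulSnr (leq_trans _ blocks_le)// leq_mul2r kL orbT.
rewrite mulmxDr mxE mulmxA big_split/=; congr (_ + _).
  rewrite mxE; apply: eq_bigr => j _; rewrite !mxE /noise_coef1 /Znoise modnMDl.
  by rewrite modn_small// inord_val; ring.
rewrite mxE; apply: eq_bigr => j _; rewrite [block_vec _ _ _ _]mxE /noise_coef2 /Wnoise.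
rewrite modnMDl modn_small// inord_val.
have -> : (u^T *m B2) 0 j = (B2^T *m u) j 0.
  by rewrite -[in RHS](trmxK u) -trmx_mul [RHS]mxE.
by ring.
Qed.

Lemma block_statE (u : 'cV[R]_h) (k : 'I_L) :
  block_stat u (Yout N s2 (c := block_code) m1 m2 g) k =
  (u^T *m a1) 0 0 * x1 k + (u^T *m a2) 0 0 * x2 k +
  noise_form h (noise_coef1 u) (noise_coef2 u) k g.
Proof.
have -> : block_stat u (Yout N s2 (c := block_code) m1 m2 g) k =
    (u^T *m ((1%:M - B2) *m block_vec Y k)) 0 0.
  rewrite mulmxA mxE; apply: eq_bigr => j _; rewrite [block_vec _ _ _ _]mxE.
  rewrite -[in LHS](trmxK u) -trmx_mul [X in X * _]mxE; congr (_ * _).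
  have ltn : (k * h + j < n)%N.
    by rewrite (leq_trans (block_index_lt (ltn_ord k) (ltn_ord j)))// blocks_le.
  by rewrite /Yout (@nth_mktuple _ _ _ _ (Ordinal ltn)).
rewrite block_whitened// -noise_formE// -addrA mulmxDr mxE; congr (_ + _).
by rewrite mulmxDr mxE -!scalemxAr !mxE; congr (_ + _); rewrite mulrC.
Qed.

End trajectory.

Lemma measurable_nth_coord (i : nat) :
  measurable_fun setT (fun v : n.-tuple R => nth 0 v i : R).
Proof.
have [lt|ge] := ltnP i n.
  rewrite (_ : (fun _ => _) = (fun v : n.-tuple R => tnth v (Ordinal lt))).
    exact: measurable_tnth.
  by apply/funext => v; rewrite (tnth_nth 0).
rewrite (_ : (fun _ => _) = (fun=> 0)); first exact: measurable_cst.
by apply/funext => v; rewrite nth_default// size_tuple.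
Qed.

Lemma measurable_block_enc2 m t : measurable_fun setT (block_enc2 m t).
Proof.
rewrite /block_enc2; case: (t < L * h)%N; last exact: measurable_cst.
apply: measurable_add_fun; first exact: measurable_cst.
apply: measurable_sum_fun => i; apply: measurable_mul_fun.
  exact: measurable_cst.
exact: measurable_nth_coord.
Qed.

Lemma measurable_block_stat u k :
  measurable_fun setT (fun y : n.-tuple R => block_stat u y k).
Proof.
apply: measurable_sum_fun => i; apply: measurable_mul_fun.
  exact: measurable_cst.
exact: measurable_nth_coord.
Qed.

Lemma measurable_info_density (s x : R) (b : n.-tuple R -> R) :
  measurable_fun setT b -> measurable_fun setT (fun y => info_density s (b y) x).
Proof.
move=> mb; rewrite /info_density; apply: measurable_add_fun; last first.
  apply: measurable_opp_fun; apply: measurable_mul_fun; last exact: measurable_cst.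
  exact: measurable_pow_fun.
apply: measurable_add_fun; last exact: measurable_cst.
apply: measurable_add_fun; last exact: measurable_cst.
by apply: measurable_mul_fun => //; exact: measurable_cst.
Qed.

Lemma measurable_block_test p :
  measurable_fun setT (fun y : n.-tuple R => block_test y p).
Proof.
have ms u k := measurable_block_stat u k.
have mc (c : R) : measurable_fun setT (fun _ : n.-tuple R => c) := measurable_cst c.
have m1 : measurable_fun setT (fun y : n.-tuple R => score1 h (noise_coef1 u1)
    (noise_coef2 u1) (noise_coef1 u2) (noise_coef2 u2) (block_stat u1 y) (c1 p.1) (c2 p.2)).
  apply: measurable_sum_fun => k; apply: measurable_info_density.
  exact: measurable_add_fun.
have m2 : measurable_fun setT (fun y : n.-tuple R => score2 h (noise_coef1 u1)
    (noise_coef2 u1) (noise_coef1 u2) (noise_coef2 u2) (block_stat u2 y) (c1 p.1) (c2 p.2)).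
  apply: measurable_sum_fun => k; apply: measurable_info_density.
  exact: measurable_add_fun.
have m3 : measurable_fun setT (fun y : n.-tuple R => score2' h (noise_coef1 u1)
    (noise_coef2 u1) (noise_coef1 u2) (noise_coef2 u2) (block_stat u1 y)
    (block_stat u2 y) (c2 p.2)).
  apply: measurable_sum_fun => k; apply: measurable_info_density.
  apply: measurable_add_fun => //; apply: measurable_opp_fun.
  exact: measurable_mul_fun.
apply: measurable_and; first exact: measurable_fun_ltr.
apply: measurable_and; first exact: measurable_fun_ltr.
by apply: measurable_fun_ltr => //; exact: measurable_add_fun.
Qed.

(** The decoder depends on [y] only through the finite table of test outcomes, so a preimage is a
    finite union of finite intersections of measurable sets. *)
Lemma measurable_block_dec p : measurable (block_dec @^-1` [set p]).
Proof.
pose F (f : {ffun 'I_M1.+1 * 'I_M2.+1 -> bool}) := odflt (ord0, ord0) [pick q | f q].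
have decE y : block_dec y = F [ffun q => block_test y q].
  rewrite /block_dec /F; congr odflt; apply: eq_pick => q; by rewrite ffunE.
rewrite (_ : _ @^-1` _ = \big[setU/set0]_(f | F f == p)
    \big[setI/setT]_q ((fun y => block_test y q) @^-1` [set f q])).
  apply: bigsetU_measurable => f _; apply: bigsetI_measurable => q _.
  by rewrite -[X in measurable X]setTI; apply: measurable_block_test.
apply/seteqP; split => y /=.
  rewrite decE => Fp; rewrite (bigD1 [ffun q => block_test y q])/=; last exact/eqP.
  left; elim/big_ind : _ => //= q _; by rewrite ffunE.
rewrite -bigcup_seq_cond /= => -[f /= /andP[_ /eqP <-] H].
rewrite decE; congr F; apply/ffunP => q; rewrite ffunE.
by move: H; rewrite (bigD1 q)//= => -[].
Qed.

Lemma block_code_valid : valid_code block_code.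
Proof.
split => //=.
- by move=> m t v v'; exact: block_code_causal.
- by move=> m t _; exact: measurable_block_enc2.
- exact: measurable_block_dec.
Qed.

Lemma form_cov_noise (v1 v2 : 'cV[R]_h) :
  form_cov h (noise_coef1 v1) (noise_coef2 v1) (noise_coef1 v2) (noise_coef2 v2) =
  (v1^T *m QP N s2 B2 *m v2) 0 0.
Proof.
rewrite /form_cov /QP mulmxDr mulmxDl mxE big_split/=; congr (_ + _).
  rewrite mul_mx_scalar -scalemxAl !mxE big_distrr/=; apply: eq_bigr => j _.
  by rewrite /noise_coef1 inord_val !mxE mulrACA -expr2 sqr_sqrtr.
rewrite -scalemxAr -scalemxAl mxE.
have -> : v1^T *m (B2 *m B2^T) *m v2 = (B2^T *m v1)^T *m (B2^T *m v2).
  by rewrite trmx_mul trmxK !mulmxA.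
rewrite [in RHS]mxE big_distrr/=; apply: eq_bigr => j _.
by rewrite /noise_coef2 inord_val mulrACA -expr2 sqr_sqrtr// [in RHS]mxE.
Qed.

Lemma form_var_noise (v : 'cV[R]_h) :
  form_var h (noise_coef1 v) (noise_coef2 v) = (v^T *m QP N s2 B2 *m v) 0 0.
Proof.
rewrite -form_cov_noise /form_var /form_cov.
by apply: eq_bigr => j _; rewrite !expr2.
Qed.

(** The matched-filter property: signal gains equal noise covariances. It puts the block statistics
    into the form [stat1], [stat2] of the scalar code. *)
Hypothesis u11 : u1^T *m a1 = u1^T *m QP N s2 B2 *m u1.
Hypothesis u12 : u1^T *m a2 = u1^T *m QP N s2 B2 *m u2.
Hypothesis u21 : u2^T *m a1 = u1^T *m QP N s2 B2 *m u2.
Hypothesis u22 : u2^T *m a2 = u2^T *m QP N s2 B2 *m u2.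

Lemma word_at_tnth (x : L.-tuple mR) (k : 'I_L) : word_at x k = tnth x k.
Proof. by rewrite /word_at (tnth_nth (0 : R)). Qed.

Lemma block_dec_error m1 m2 (g : n.-tuple (R * R)) :
  block_dec (Yout N s2 (c := block_code) m1 m2 g) != (m1, m2) ->
  decoding_error h (noise_coef1 u1) (noise_coef2 u1) (noise_coef1 u2) (noise_coef2 u2)
    eps c1 c2 m1 m2
    (stat1 h (noise_coef1 u1) (noise_coef2 u1) (noise_coef1 u2) (noise_coef2 u2)
       (c1 m1) (c2 m2) g)
    (stat2 h (noise_coef1 u1) (noise_coef2 u1) (noise_coef1 u2) (noise_coef2 u2)
       (c1 m1) (c2 m2) g).
Proof.
set y := Yout _ _ _ _ _.
set l1 := stat1 _ _ _ _ _ _ _ _; set l2 := stat2 _ _ _ _ _ _ _ _.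
have e1 : block_stat u1 y = l1.
  apply/funext => k; rewrite /y block_statE /l1 /stat1 form_var_noise form_cov_noise.
  by rewrite u11 u12 !word_at_tnth.
have e2 : block_stat u2 y = l2.
  apply/funext => k; rewrite /y block_statE /l2 /stat2 form_var_noise form_cov_noise.
  by rewrite u21 u22 !word_at_tnth.
have tE p : block_test y p = passes h (noise_coef1 u1) (noise_coef2 u1)
    (noise_coef1 u2) (noise_coef2 u2) eps l1 l2 (c1 p.1) (c2 p.2).
  by rewrite /block_test e1 e2.
rewrite /block_dec; case: pickP => [p /= tp|nop] /= ne.
  by apply/orP; right; apply/existsP; exists p; rewrite -tE ne.
by apply/orP; left; rewrite -(tE (m1, m2)) nop.
Qed.

Lemma sum_blocks (F : nat -> R) : (forall t, (L * h <= t)%N -> F t = 0) ->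
  \sum_(t < n) F t = \sum_(k < L) \sum_(j < h) F (k * h + j)%N.
Proof.
move=> F0; under [RHS]eq_bigr => k _.
  rewrite -(@sum_block _ n h k F)//; last first.
    by rewrite -mulSnr (leq_trans _ blocks_le)// leq_mul2r ltn_ord orbT.
  over.
rewrite (exchange_blocks n h (fun (_ : 'I_L) t => F t)); apply: eq_bigr => t _.
by case: insubP => // nL; rewrite F0// -leq_divRL// leqNgt.
Qed.

(** * Empirical powers of the block code *)

Local Notation mean := (@mean2 R M1.+1 M2.+1).

Lemma mean2_cst (c : R) : mean (fun _ _ => c) = c.
Proof.
rewrite /mean2 !sumr_const !card_ord -mulrnA -[X in _ * X]mulr_natl mulrA mulnC.
by rewrite mulVf ?mul1r// pnatr_eq0.
Qed.

Lemma mean2D f f' : mean (fun m1 m2 => f m1 m2 + f' m1 m2) = mean f + mean f'.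
Proof.
rewrite /mean2 -mulrDr -big_split/=; congr (_ * _); apply: eq_bigr => m1 _.
by rewrite big_split.
Qed.

Lemma mean2Z (c : R) f : mean (fun m1 m2 => c * f m1 m2) = c * mean f.
Proof.
rewrite /mean2 mulrCA; congr (_ * _); rewrite big_distrr/=; apply: eq_bigr => m1 _.
by rewrite big_distrr.
Qed.

Lemma mean2_sum (I : finType) (f : I -> 'I_M1.+1 -> 'I_M2.+1 -> R) :
  \sum_i mean (f i) = mean (fun m1 m2 => \sum_i f i m1 m2).
Proof.
rewrite /mean2 -big_distrr/=; congr (_ * _); rewrite exchange_big; apply: eq_bigr => m1 _.
by rewrite exchange_big.
Qed.

Lemma mean2_l (f : 'I_M1.+1 -> R) :
  M1.+1%:R^-1 * \sum_m f m = mean (fun m _ => f m).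
Proof.
rewrite /mean2; under [in RHS]eq_bigr do rewrite sumr_const card_ord -[_ *+ _]mulr_natl.
rewrite -big_distrr/= mulrA natrM invfM -[_ * _ * M2.+1%:R]mulrA mulVf ?mulr1//.
Qed.

Hypothesis pw1 : mean (fun m1 _ =>
  \sum_(k < L) tnth (c1 m1) k ^+ 2 - L%:R * (1 + eps / 2)) <= 0.
Hypothesis pw2 : mean (fun _ m2 =>
  \sum_(k < L) tnth (c2 m2) k ^+ 2 - L%:R * (1 + eps / 2)) <= 0.

Definition sqnorm m (v : 'cV[R]_m) : R := \sum_(j < m) v j 0 ^+ 2.

Lemma sqnorm_ge0 m (v : 'cV[R]_m) : 0 <= sqnorm v.
Proof. by apply: sumr_ge0 => j _; exact: sqr_ge0. Qed.

Let pw1' : mean (fun m1 _ => \sum_(k < L) tnth (c1 m1) k ^+ 2) <= L%:R * (1 + eps / 2).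
Proof. by move: pw1; rewrite mean2D mean2_cst subr_le0. Qed.

Let pw2' : mean (fun _ m2 => \sum_(k < L) tnth (c2 m2) k ^+ 2) <= L%:R * (1 + eps / 2).
Proof. by move: pw2; rewrite mean2D mean2_cst subr_le0. Qed.

Lemma block_power1 : \sum_(t < n) (M1.+1)%:R^-1 * \sum_(m < M1.+1) block_enc1 m t ^+ 2
  <= sqnorm a1 * (L%:R * (1 + eps / 2)).
Proof.
under eq_bigr do rewrite mean2_l.
rewrite mean2_sum.
rewrite [leLHS](_ : _ = sqnorm a1 * mean (fun m1 _ => \sum_(k < L) tnth (c1 m1) k ^+ 2)).
  by rewrite ler_wpM2l ?sqnorm_ge0.
rewrite -mean2Z; congr (mean2 _); apply/funext => m1; apply/funext => m2.
rewrite (@sum_blocks (fun t => block_enc1 m1 t ^+ 2)); last first.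
  by move=> t lt; rewrite /block_enc1 ltnNge lt expr0n.
rewrite big_distrr/=; apply: eq_bigr => k _; rewrite big_distrl/=; apply: eq_bigr => j _.
rewrite /block_enc1 block_index_lt// divnMDl// (divn_small (ltn_ord j)) addn0 modnMDl
  (modn_small (ltn_ord j)).
by rewrite inord_val exprMn word_at_tnth.
Qed.

Local Notation G := (invmx (1%:M - B2)).
Local Notation alpha := (G *m (B2 *m a1)).
Local Notation beta := (G *m a2).

Lemma unit_1B : (1%:M - B2) \in unitmx.
Proof.
rewrite unitmxE det_trig; last first.
  apply/is_trig_mxP => i j ij; rewrite !mxE B2low ?(ltnW ij)// subr0.
  by rewrite -val_eqE (ltn_eqF ij).
rewrite big1 ?unitr1// => i _.
by rewrite !mxE eqxx B2low// subr0.
Qed.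

Lemma noise_form_block p q k (g : n.-tuple (R * R)) : (k < L)%N ->
  noise_form h p q k g = \sum_(j < h)
    (p j * (nth (0, 0) g (k * h + j)).1 + q j * (nth (0, 0) g (k * h + j)).2).
Proof.
move=> kL; rewrite /noise_form.
rewrite (eq_bigr (fun t : 'I_n => p (t %% h)%N * (nth (0, 0) g t).1 +
    q (t %% h)%N * (nth (0, 0) g t).2)); last first.
  by move=> t _; rewrite -tnth_nth.
rewrite (@sum_block _ n h k (fun t => p (t %% h)%N * (nth (0, 0) g t).1 +
    q (t %% h)%N * (nth (0, 0) g t).2))//; last first.
  by rewrite -mulSnr (leq_trans _ blocks_le)// leq_mul2r kL orbT.
by apply: eq_bigr => j _; rewrite modnMDl (modn_small (ltn_ord j)).
Qed.

Definition input_mean (m1 : 'I_M1.+1) (m2 : 'I_M2.+1) (k : nat) (j : 'I_h) : R :=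
  word_at (c2 m2) k * beta j 0 + word_at (c1 m1) k * alpha j 0.

Definition input_coef (sd : R) (j : 'I_h) (i : nat) : R := sd * (G *m B2) j (inord i).

(** Solving the loop for the input gives [(1 - B2) X = x2 a2 + B2 (x1 a1 + Z + W)]; channel and
    observation noise pass through the same matrix [G *m B2], whence the factor [N + s2] in
    [input_var]. *)
Lemma block_X2E m1 m2 (g : n.-tuple (R * R)) k (j : 'I_h) : (k < L)%N ->
  X2 (c := block_code) N s2 m1 m2 g (k * h + j) = input_mean m1 m2 k j +
   noise_form h (input_coef (Num.sqrt N) j) (input_coef (Num.sqrt s2) j) k g.
Proof.
move=> kL.
have XE : block_vec (X2 (c := block_code) N s2 m1 m2 g) k =
    G *m (word_at (c2 m2) k *: a2 + word_at (c1 m1) k *: (B2 *m a1) +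
      B2 *m (block_vec (Znoise N g) k + block_vec (Wnoise s2 g) k)).
  rewrite -[LHS](mulKmx unit_1B) mulmxBl mul1mx; congr (_ *m _).
  have := block_X2 m1 m2 g kL; rewrite block_vecD (block_Y m1 m2 g kL).
  set X := block_vec _ _; set Z := block_vec (Znoise _ _) _; set W := block_vec (Wnoise _ _) _.
  move=> {1}->; rewrite !mulmxDr scalemxAr.
  set P := _ *: a2; set Q := B2 *m (_ *: a1); set XX := B2 *m X.
  rewrite -!addrA; congr (P + _); congr (Q + _).
  by rewrite addrC -!addrA addNr addr0.
transitivity (block_vec (X2 (c := block_code) N s2 m1 m2 g) k j 0); first by rewrite mxE.
rewrite XE mulmxDr mxE; congr (_ + _).
  by rewrite mulmxDr -!scalemxAr mxE; congr (_ + _); rewrite mxE.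
rewrite mulmxA mxE noise_form_block//; apply: eq_bigr => i _.
rewrite /input_coef inord_val !mxE /Znoise /Wnoise; ring.
Qed.

Definition input_var (j : 'I_h) : R := (N + s2) * \sum_(i < h) (G *m B2) j i ^+ 2.

Lemma form_var_input j :
  form_var h (input_coef (Num.sqrt N) j) (input_coef (Num.sqrt s2) j) = input_var j.
Proof.
rewrite /form_var /input_var big_distrr/=; apply: eq_bigr => i _.
by rewrite /input_coef inord_val !exprMn !sqr_sqrtr// mulrDl.
Qed.

Lemma gauss_int_X2 m1 m2 k (j : 'I_h) : (k < L)%N ->
  (gauss_int (fun g => ((X2 (c := block_code) N s2 m1 m2 g (k * h + j)) ^+ 2)%:E)
   <= (input_mean m1 m2 k j ^+ 2 + input_var j)%:E)%E.
Proof.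
move=> kL; rewrite -form_var_input.
rewrite (_ : (fun _ => _) = (fun g : n.-tuple (R * R) => ((input_mean m1 m2 k j +
   noise_form h (input_coef (Num.sqrt N) j) (input_coef (Num.sqrt s2) j) k g) ^+ 2)%:E)).
  apply: gauss_int_affine_sq => //.
  by rewrite -mulSnr (leq_trans _ blocks_le)// leq_mul2r kL orbT.
by apply/funext => g; rewrite block_X2E.
Qed.

(** Half the coefficient of the codeword correlation in the power of transmitter 2. The codebooks
    bound the correlation on one side only, so [sg] is taken to be the sign of this number. *)
Definition input_dot : R := \sum_(j < h) alpha j 0 * beta j 0.
Variable sg : R.
Hypothesis sg_dot : input_dot = sg * `|input_dot|.
Hypothesis pw3 : mean (fun m1 m2 =>
  sg * (\sum_(k < L) tnth (c1 m1) k * tnth (c2 m2) k) - L%:R * (eps / 2)) <= 0.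
Hypothesis eps0 : 0 <= eps.

Let pw3' : sg * mean (fun m1 m2 => \sum_(k < L) tnth (c1 m1) k * tnth (c2 m2) k) <=
  L%:R * (eps / 2).
Proof. by move: pw3; rewrite mean2D mean2_cst mean2Z subr_le0. Qed.

Lemma input_dot_le : `|input_dot| <= (sqnorm alpha + sqnorm beta) / 2.
Proof.
rewrite /input_dot; apply: le_trans (ler_norm_sum _ _ _) _.
rewrite /sqnorm -big_split/= big_distrl/=; apply: ler_sum => j _.
rewrite ler_norml; apply/andP; split.
  by have := sqr_ge0 (alpha j 0 + beta j 0); rewrite sqrrD; lra.
by have := sqr_ge0 (alpha j 0 - beta j 0); rewrite sqrrB; lra.
Qed.

(** The codeword powers contribute [1 + eps / 2]; the cross term contributes at most
    [eps * |input_dot|], which is at most [eps / 2] times the sum of the squared norms. The noise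
    part has no excess factor. *)
Lemma block_power2 :
  (\sum_(t < n) (((M1.+1 * M2.+1)%:R^-1)%:E *
     \sum_(m1 < M1.+1) \sum_(m2 < M2.+1)
        gauss_int (fun g => ((X2 (c := block_code) N s2 m1 m2 g t) ^+ 2)%:E))
   <= (L%:R * ((1 + eps) * (sqnorm alpha + sqnorm beta) + \sum_j input_var j))%:E)%E.
Proof.
pose D (t : nat) m1 m2 := if (t < L * h)%N then
  input_mean m1 m2 (t %/ h) (inord (t %% h)) ^+ 2 + input_var (inord (t %% h)) else 0.
have DE m1 m2 t : (gauss_int (fun g =>
    ((X2 (c := block_code) N s2 m1 m2 g t) ^+ 2)%:E) <= (D t m1 m2)%:E)%E.
  rewrite /D; case: ltnP => tL.
    have kL : (t %/ h < L)%N by rewrite ltn_divLR.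
    have := gauss_int_X2 m1 m2 (inord (t %% h)) kL.
    by rewrite inordK ?ltn_pmod// -divn_eq.
  rewrite (_ : (fun _ => _) = (fun _ => 0%:E)).
    by rewrite gauss_intE// integral_prob_cst.
  apply/funext => g; rewrite /X2 /X2of /= /block_enc2 ltnNge tL /= expr0n//.
apply: (@le_trans _ _ (\sum_(t < n) (mean (D t))%:E)%E).
  apply: lee_sum => t _; rewrite /mean2 EFinM lee_wpmul2l ?lee_fin ?invr_ge0//.
  rewrite -sumEFin; apply: lee_sum => m1 _; rewrite -sumEFin.
  by apply: lee_sum => m2 _; exact: DE.
rewrite sumEFin lee_fin (mean2_sum (fun t : 'I_n => D t)).
rewrite [leLHS](_ : _ = sqnorm beta * mean (fun _ m2 => \sum_(k < L) tnth (c2 m2) k ^+ 2) +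
   (sqnorm alpha * mean (fun m1 _ => \sum_(k < L) tnth (c1 m1) k ^+ 2) +
   (2 * input_dot * mean (fun m1 m2 => \sum_(k < L) tnth (c1 m1) k * tnth (c2 m2) k) +
    L%:R * \sum_j input_var j))).
  have e1 := ler_wpM2l (sqnorm_ge0 beta) pw2'.
  have e2 := ler_wpM2l (sqnorm_ge0 alpha) pw1'.
  have e3 := ler_wpM2l (normr_ge0 input_dot) pw3'.
  have Le : 0 <= L%:R * eps by rewrite mulr_ge0.
  have e4 := ler_wpM2r Le input_dot_le.
  rewrite {1}sg_dot.
  move: e1 e2 e3 e4; set m := mean (fun m1 m2 => \sum_(k < L) tnth (c1 m1) k * tnth (c2 m2) k).
  set mA := mean _; set mB := mean _; set sA := sqnorm alpha; set sB := sqnorm beta.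
  set d := `|input_dot|; set l := L%:R; set I := \sum_j _ => e1 e2 e3 e4.
  lra.
rewrite -!mean2Z -(mean2_cst (L%:R * _)) -!mean2D; congr (mean2 _).
apply/funext => m1; apply/funext => m2.
rewrite (@sum_blocks (fun t => D t m1 m2)); last first.
  by move=> t lt; rewrite /D ltnNge lt.
rewrite (_ : L%:R * (\sum_j input_var j) = \sum_(k < L) \sum_j input_var j); last first.
  by rewrite sumr_const card_ord mulr_natl.
rewrite !big_distrr/= -!big_split/=; apply: eq_bigr => k _.
rewrite /sqnorm !mulr_suml.
rewrite -!big_split/=; apply: eq_bigr => j _.
rewrite /D block_index_lt// divnMDl// (divn_small (ltn_ord j)) addn0 modnMDl.
rewrite (modn_small (ltn_ord j)) inord_val /input_mean !word_at_tnth.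
ring.
Qed.

End block_code.

(** * Linear receivers *)

Section determinants.
Variable R : realType.

(** Both sides are the determinant of the block matrix [K], read off from its two triangular
    factorisations. *)
Lemma det_sylvester k m (V : 'M[R]_(k, m)) (W : 'M[R]_(m, k)) :
  \det (1%:M + V *m W) = \det (1%:M + W *m V).
Proof.
pose K := block_mx (1%:M : 'M[R]_m) (- W) V (1%:M : 'M[R]_k).
have b1 : K = block_mx 1%:M 0 V 1%:M *m block_mx 1%:M (- W) 0 (1%:M + V *m W).
  rewrite mulmx_block !mulmx1 !mul1mx ?mul0mx ?mulmx0 ?addr0 mulmxN.
  by rewrite addrCA addNr addr0.
have b2 : K = block_mx 1%:M (- W) 0 1%:M *m block_mx (1%:M + W *m V) 0 V 1%:M.
  by rewrite mulmx_block !mulmx1 !mul1mx ?mul0mx ?mulmx0 ?add0r mulNmx addrK.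
have := congr1 determinant (etrans (esym b1) b2).
by rewrite !det_mulmx !det_lblock !det_ublock !det1 !mul1r !mulr1.
Qed.

Lemma det_mx2 (M : 'M[R]_(1 + 1)) :
  \det M = M 0 0 * M ord_max ord_max - M 0 ord_max * M ord_max 0.
Proof.
rewrite (expand_det_row _ 0) big_ord_recl big_ord1 /cofactor !det_mx11 !mxE /=.
rewrite expr0 mul1r expr1 mulN1r mulrN.
have -> : lift 0 0 = ord_max :> 'I_(1 + 1) by apply/val_inj.
by congr (_ * M _ _ - _ * M _ _); apply/val_inj.
Qed.

End determinants.

Section noise_covariance.
Variables (R : realType) (N s2 : R) (k h : nat) (B2 : 'M[R]_h) (C : 'M[R]_(k, h)).
Hypotheses (N0 : 0 < N) (s20 : 0 <= s2) (CC : C *m C^T \in unitmx).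
Local Notation QP := (QP N s2 B2).
Local Notation Q := (C *m QP *m C^T).

Lemma mulmx_tr_ge0 m (v : 'rV[R]_m) : 0 <= (v *m v^T) 0 0.
Proof. by rewrite mxE sumr_ge0// => j _; rewrite mxE -expr2 sqr_ge0. Qed.

Lemma mulmx_tr_eq0 m (v : 'rV[R]_m) : (v *m v^T) 0 0 = 0 -> v = 0.
Proof.
rewrite mxE => /eqP; rewrite psumr_eq0; last first.
  by move=> j _; rewrite mxE -expr2 sqr_ge0.
move=> /allP v0; apply/matrixP => i j; rewrite (ord1 i) [RHS]mxE.
by apply/eqP; have := v0 j (mem_index_enum j); rewrite mxE mulf_eq0 orbb.
Qed.

Lemma QP_sym : QP^T = QP.
Proof. by rewrite /QP linearD/= tr_scalar_mx linearZ/= trmx_mul trmxK. Qed.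

Lemma Q_sym : Q^T = Q.
Proof. by rewrite !trmx_mul trmxK QP_sym mulmxA. Qed.

(** If [v Q = 0], then [N |v C|^2 + s2 |v C B2|^2 = 0], so [v C = 0] because [N > 0], and
    invertibility of [C C^T] gives [v = 0]. *)
Lemma Q_unit : Q \in unitmx.
Proof.
rewrite -row_free_unit -kermx_eq0; apply/eqP/row_matrixP => i; rewrite row0.
set v := row i _.
have vQ : v *m Q = 0 by apply/sub_kermxP; exact: row_sub.
have : (v *m Q *m v^T) 0 0 = 0 by rewrite vQ mul0mx mxE.
have -> : v *m Q *m v^T = N *: ((v *m C) *m (v *m C)^T) +
   s2 *: ((v *m C *m B2) *m (v *m C *m B2)^T).
  rewrite /QP !(mulmxDr, mulmxDl) mul_mx_scalar -!(scalemxAr, scalemxAl).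
  by rewrite !trmx_mul !mulmxA.
rewrite mxE [X in X + _]mxE [X in _ + X]mxE => /eqP.
rewrite paddr_eq0 ?mulr_ge0 ?mulmx_tr_ge0// ?(ltW N0)// mulf_eq0 (gt_eqF N0) /=.
move=> /andP[/eqP /mulmx_tr_eq0 vC _].
by rewrite -[v](mulmxK CC) mulmxA vC !mul0mx.
Qed.

Local Notation Qi := (invmx Q).

Definition snr m m' (A : 'M[R]_(h, m)) (A' : 'M[R]_(h, m')) : 'M[R]_(m, m') :=
  (C *m A)^T *m Qi *m (C *m A').

Lemma det_snr m (A : 'M[R]_(h, m)) :
  \det (C *m (A *m A^T + QP) *m C^T) / \det Q = \det (1%:M + snr A A).
Proof.
have -> : C *m (A *m A^T + QP) *m C^T = Q *m (1%:M + Qi *m (C *m A) *m (C *m A)^T).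
  rewrite [RHS]mulmxDr mulmx1 -(mulmxA Qi (C *m A)) mulKVmx ?Q_unit//.
  by rewrite mulmxDr mulmxDl trmx_mul !mulmxA addrC.
rewrite det_mulmx mulrC mulrA mulVf ?mul1r; last first.
  by have := Q_unit; rewrite unitmxE unitfE.
by rewrite det_sylvester /snr (mulmxA (C *m A)^T Qi).
Qed.

(* [(receiver c a)^T y = (c C a)^T Q^-1 (C y)], the matched filter for the
   input direction [c a]. *)
Definition receiver (c : R) (a : 'cV[R]_h) : 'cV[R]_h := C^T *m Qi *m (C *m (c *: a)).

Lemma receiver_gain c (a a' : 'cV[R]_h) :
  (receiver c a)^T *m (c *: a') = c ^+ 2 *: snr a a'.
Proof.
rewrite /receiver /snr !trmx_mul trmxK trmx_inv Q_sym -!scalemxAr linearZ/= -!scalemxAl.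
by rewrite scalerA -expr2 !mulmxA.
Qed.

(** The right-hand side is that of [receiver_gain]: this equality is the matched-filter property
    required by the block code. *)
Lemma receiver_noise c (a a' : 'cV[R]_h) :
  (receiver c a)^T *m QP *m receiver c a' = c ^+ 2 *: snr a a'.
Proof.
have rE b : receiver c b = C^T *m (Qi *m (C *m (c *: b))) by rewrite mulmxA.
transitivity ((Qi *m (C *m (c *: a)))^T *m Q *m (Qi *m (C *m (c *: a')))).
  by rewrite !rE trmx_mul trmxK !mulmxA.
rewrite -(mulmxA _ Q) mulKVmx ?Q_unit// trmx_mul trmx_inv Q_sym.
by rewrite /snr -!scalemxAr linearZ/= -!scalemxAl scalerA -expr2.
Qed.

Lemma snr_tr (a a' : 'cV[R]_h) : (snr a a')^T = snr a' a.
Proof. by rewrite /snr !trmx_mul !trmxK trmx_inv Q_sym !mulmxA. Qed.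

Lemma snrC (a a' : 'cV[R]_h) : snr a a' = snr a' a.
Proof. by rewrite -(snr_tr a' a); apply/matrixP => i j; rewrite mxE (ord1 i) (ord1 j). Qed.

Lemma det_snr1 (a : 'cV[R]_h) : \det (1%:M + snr a a) = 1 + snr a a 0 0.
Proof. by rewrite det_mx11 !mxE. Qed.

Lemma det_snr2 (a1 a2 : 'cV[R]_h) :
  \det (1%:M + snr (row_mx a1 a2) (row_mx a1 a2)) =
  (1 + snr a1 a1 0 0) * (1 + snr a2 a2 0 0) - snr a1 a2 0 0 ^+ 2.
Proof.
have -> : snr (row_mx a1 a2) (row_mx a1 a2) =
    block_mx (snr a1 a1) (snr a1 a2) (snr a2 a1) (snr a2 a2).
  by rewrite /snr mul_mx_row tr_row_mx mul_col_mx mul_col_row.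
rewrite scalar_mx_block add_block_mx !add0r det_mx2 (snrC a2 a1).
have -> : 0 = lshift 1 0 :> 'I_(1 + 1) by apply/val_inj.
have -> : ord_max = rshift 1 0 :> 'I_(1 + 1) by apply/val_inj.
by rewrite block_mxEul block_mxEdr block_mxEur block_mxEdl !mxE eqxx -expr2.
Qed.

End noise_covariance.

(** * Achievability *)

Section arithmetic.
Variable R : realType.
Implicit Types x y z E d : R.

Lemma exponent_slack1 x y : x - 3 * y * 1 + y <= x - 2 * y. Proof. lra. Qed.

Lemma exponent_slack2 x y : 0 < y -> x - 3 * y * 2 + y <= x - 3 * y. Proof. lra. Qed.

Lemma sq_div_le y : 0 < y -> y <= 1 -> y ^+ 2 / 64 <= y.
Proof. by move=> y0 y1; have : y ^+ 2 <= y by [rewrite expr2 ler_piMl// ltW]; lra. Qed.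

Lemma sum_bound E d b t1 t2 t3 : 0 < d -> 0 < E -> b <= d ->
  t1 <= E * b -> t2 <= E * b -> t3 <= E * b ->
  6 * d + t1 + t2 + t3 < 2 * ((6 + 3 * E) * d).
Proof.
move=> d0 E0 bd h1 h2 h3; have := ler_wpM2l (ltW E0) bd.
have : 0 < E * d by rewrite mulr_gt0.
lra.
Qed.

End arithmetic.

Section achievability.
Variables (R : realType) (N s2 P1 P2 r1 r2 : R) (e k : nat).
Local Notation h := e.+1.
Variables (a1 a2 : 'cV[R]_h) (B2 : 'M[R]_h) (C : 'M[R]_(k, h)) (delta : R).
Hypotheses (P10 : 0 < P1) (P20 : 0 < P2) (N0 : 0 < N) (s20 : 0 <= s2).
Hypotheses (delta0 : 0 < delta) (CC : C *m C^T \in unitmx).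
Hypotheses (B2low : strictly_lower B2).
Hypotheses (pow1 : power_P1 P1 a1) (pow2 : power_P2 P2 N s2 a1 a2 B2).
Hypothesis rates : rate_bounds N s2 a1 a2 B2 C r1 r2.

(** The message counts give up [h * delta >= 3 * eps] per block and message; the single thresholds
    lose at most [2 * eps] and the joint one at most [3 * eps], so at least [eps] per block
    remains. *)
Let eps := Num.min 1 (h%:R * delta / 3).
(* The codebooks exceed unit power by a factor at most [1 + eps], which
   scaling the inputs by [c] compensates. *)
Let c := Num.sqrt (1 + eps)^-1.

Let eps_gt0 : 0 < eps.
Proof. by rewrite lt_min ltr01 /= divr_gt0// mulr_gt0. Qed.
Let eps_le1 : eps <= 1. Proof. by rewrite ge_min lexx. Qed.
Let eps_delta : 3 * eps <= h%:R * delta.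
Proof. by rewrite mulrC -ler_pdivlMr// ge_min lexx orbT. Qed.
Let eps1_gt0 : 0 < 1 + eps. Proof. by rewrite addr_gt0. Qed.
Let c2E : c ^+ 2 = (1 + eps)^-1.
Proof. by rewrite sqr_sqrtr// invr_ge0 ltW. Qed.
Let c2_gt0 : 0 < c ^+ 2. Proof. by rewrite c2E invr_gt0. Qed.
Let c2_le1 : c ^+ 2 <= 1.
Proof. by rewrite c2E invf_le1// lerDl ltW. Qed.
Let ln_c2 : - eps <= ln (c ^+ 2).
Proof.
by rewrite c2E lnV ?posrE// lerN2 -ler_expR lnK ?posrE// expR_ge1Dx.
Qed.

Let u1 := receiver N s2 B2 C c a1.
Let u2 := receiver N s2 B2 C c a2.
Let S11 := snr N s2 B2 C a1 a1 0 0.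
Let S12 := snr N s2 B2 C a1 a2 0 0.
Let S22 := snr N s2 B2 C a2 a2 0 0.
Local Notation p1 := (noise_coef1 N u1).
Local Notation q1 := (noise_coef2 s2 B2 u1).
Local Notation p2 := (noise_coef1 N u2).
Local Notation q2 := (noise_coef2 s2 B2 u2).

Let s11E : form_var h p1 q1 = c ^+ 2 * S11.
Proof. by rewrite form_var_noise ?(ltW N0)// receiver_noise// mxE. Qed.
Let s22E : form_var h p2 q2 = c ^+ 2 * S22.
Proof. by rewrite form_var_noise ?(ltW N0)// receiver_noise// mxE. Qed.
Let s12E : form_cov h p1 q1 p2 q2 = c ^+ 2 * S12.
Proof. by rewrite form_cov_noise ?(ltW N0)// receiver_noise// mxE. Qed.

Let S11_ge0 : 0 <= S11.
Proof. by rewrite -(pmulr_rge0 _ c2_gt0) -s11E form_var_ge0. Qed.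
Let S22_ge0 : 0 <= S22.
Proof. by rewrite -(pmulr_rge0 _ c2_gt0) -s22E form_var_ge0. Qed.

Lemma ln_scale_ge (X D kap : R) :
  1 <= X -> 0 < kap -> kap <= 1 -> kap * D <= X -> ln D + ln kap <= ln X.
Proof.
move=> X1 k0 k1 kD; have X0 : 0 < X by exact: lt_le_trans X1.
have [D0|D0] := ltP 0 D.
  by rewrite addrC -lnM ?posrE// ler_ln ?posrE// mulr_gt0.
(* For [D <= 0] the logarithm takes its default value zero, and the claim becomes
   [ln kap <= 0 <= ln X]. *)
by rewrite (ln0 D0) add0r (le_trans (ln_le0 k1))// ln_ge0.
Qed.

Let rate_scale (x y : R) : x <= (2 * h%:R)^-1 * y -> h%:R * x <= y / 2.
Proof.
move=> le; rewrite (_ : y / 2 = h%:R * ((2 * h%:R)^-1 * y)) ?ler_wpM2l//.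
have : h%:R != 0 :> R by rewrite pnatr_eq0.
by move: (h%:R : R) => H H0; field.
Qed.

Let rate1 : h%:R * r1 <= ln (1 + S11) / 2.
Proof.
have [_ _ + _ _] := rates; rewrite /logdetratio det_snr// det_snr1 -/S11 => le.
exact: rate_scale.
Qed.
Let rate2 : h%:R * r2 <= ln (1 + S22) / 2.
Proof.
have [_ _ _ + _] := rates; rewrite /logdetratio det_snr// det_snr1 -/S22 => le.
exact: rate_scale.
Qed.
Let rate12 : h%:R * (r1 + r2) <= ln ((1 + S11) * (1 + S22) - S12 ^+ 2) / 2.
Proof.
have [_ _ _ _ +] := rates; rewrite /logdetratio det_snr// det_snr2//.
rewrite -/S11 -/S22 -/S12 => le.
exact: rate_scale.
Qed.

Variable n : nat.
Local Notation L := (n %/ h)%N.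
Hypothesis n0 : (0 < n)%N.
Let tau1 := threshold L eps (form_var h p1 q1).
Let tau2 := threshold L eps (form_var h p2 q2).
Let tau2' := threshold L eps (s22' h p1 q1 p2 q2).

(** Scaling costs little because [1 + c^2 S11 >= c^2 (1 + S11)] and [ln (c^2) >= - eps]; with the
    margin [eps] of the threshold the loss is at most [3/2 * eps]. *)
Let tau1_ge : L%:R * (h%:R * r1 - 2 * eps) <= tau1.
Proof.
rewrite /tau1 /threshold s11E ler_wpM2l//.
have := @ln_scale_ge (1 + c ^+ 2 * S11) (1 + S11) (c ^+ 2).
rewrite lerDl mulr_ge0// => [/(_ isT c2_gt0 c2_le1)|]; last exact: ltW.
have -> : c ^+ 2 * (1 + S11) <= 1 + c ^+ 2 * S11 by rewrite mulrDr mulr1 lerD2r.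
move=> /(_ isT); have := rate1; have := ln_c2; have := eps_gt0; lra.
Qed.

Let tau2_ge : L%:R * (h%:R * r2 - 2 * eps) <= tau2.
Proof.
rewrite /tau2 /threshold s22E ler_wpM2l//.
have := @ln_scale_ge (1 + c ^+ 2 * S22) (1 + S22) (c ^+ 2).
rewrite lerDl mulr_ge0// => [/(_ isT c2_gt0 c2_le1)|]; last exact: ltW.
have -> : c ^+ 2 * (1 + S22) <= 1 + c ^+ 2 * S22 by rewrite mulrDr mulr1 lerD2r.
move=> /(_ isT); have := rate2; have := ln_c2; have := eps_gt0; lra.
Qed.

Let tau12_ge : L%:R * (h%:R * (r1 + r2) - 3 * eps) <= tau1 + tau2'.
Proof.
rewrite /tau1 /tau2' /threshold -mulrDr ler_wpM2l//.
set X1 := 1 + form_var _ _ _; set X2 := 1 + s22' _ _ _ _ _.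
have X1_ge1 : 1 <= X1 by rewrite lerDl form_var_ge0.
have X2_ge1 : 1 <= X2 by rewrite lerDl s22'_ge0.
have X10 : 0 < X1 by exact: lt_le_trans X1_ge1.
have X20 : 0 < X2 by exact: lt_le_trans X2_ge1.
have X12 : ln X1 + ln X2 = ln (X1 * X2) by rewrite lnM.
have := @ln_scale_ge (X1 * X2) ((1 + S11) * (1 + S22) - S12 ^+ 2) (c ^+ 2 * c ^+ 2).
rewrite lnM ?posrE// (lnM (x := c ^+ 2)) ?posrE// mulr_gt0// mulr_ile1// ?(ltW c2_gt0)//.
rewrite -[leLHS]mulr1 ler_pM//.
(* With [x = c ^+ 2], the terms in [S12] cancel and the difference of the sides is [(1 - x) * (1 +
   x) + x * (1 - x) * (S11 + S22)]. *)
have -> : c ^+ 2 * c ^+ 2 * ((1 + S11) * (1 + S22) - S12 ^+ 2) <= X1 * X2.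
  rewrite /X1 /X2 det_factor s11E s22E s12E exprMn.
  move: c2_gt0 c2_le1; set x := c ^+ 2 => x0 x1.
  have : 0 <= (1 - x) * (1 + x) by rewrite mulr_ge0 ?subr_ge0// addr_ge0// ltW.
  have : 0 <= x * (1 - x) * (S11 + S22).
    by rewrite mulr_ge0 ?addr_ge0// mulr_ge0 ?subr_ge0// ltW.
  lra.
move=> /(_ isT isT isT isT); have := rate12; have := ln_c2; have := eps_gt0; lra.
Qed.

(** Pays for the incomplete last block: the number of messages grows with [n], which may exceed
    [L * h] by up to [h], while the thresholds grow only with [L]. *)
Let Ebound := expR (h%:R * (r1 + r2)).
(** Six outage, power and correlation terms and three confusion terms; the factor 2 makes the bound
    of [total_bound] strict. *)
Definition error_bound : R := 2 * ((6 + 3 * Ebound) * decay L eps).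

Let n_le : n%:R <= L%:R * h%:R + h%:R :> R.
Proof. by rewrite -natrM -natrD ler_nat -mulSnr ltnW// ltn_ceil. Qed.
Let n_ge : L%:R * h%:R <= n%:R :> R.
Proof. by rewrite -natrM ler_nat leq_divM. Qed.
Let r1_ge0 : 0 <= r1. Proof. by have [] := rates. Qed.
Let r2_ge0 : 0 <= r2. Proof. by have [] := rates. Qed.

(** Here [m] is the number of messages decoded wrongly, 1 or 2, each of which contributes a rate
    reduction [delta]. *)
Let exponent_le (r tau m : R) : 0 <= r -> r <= r1 + r2 -> 0 < m ->
  L%:R * (h%:R * r - 3 * eps * m + eps) <= tau ->
  n%:R * (r - m * delta) - tau <= h%:R * (r1 + r2) - L%:R * eps.
Proof.
move=> r0 rr m0 ht.
have h1 := ler_wpM2r r0 n_le.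
have h2 := ler_wpM2r (mulr_ge0 (ltW m0) (ltW delta0)) n_ge.
have h3 : L%:R * m * (3 * eps) <= L%:R * m * (h%:R * delta).
  by rewrite ler_wpM2l// mulr_ge0// ltW.
have h4 := ler_wpM2l (ler0n R h) rr.
lra.
Qed.

Lemma total_bound (M1 M2 : nat) :
  M1%:R <= expR (n%:R * (r1 - delta)) -> M2%:R <= expR (n%:R * (r2 - delta)) ->
  6 * decay L eps + M1%:R * expR (- tau1) + M2%:R * expR (- tau2)
    + M1%:R * (M2%:R * expR (- (tau1 + tau2'))) < error_bound.
Proof.
move=> le1 le2; have Le : 0 <= L%:R * eps by rewrite mulr_ge0// ltW.
have b1 : M1%:R * expR (- tau1) <= Ebound * expR (- (L%:R * eps)).
  apply: le_trans (ler_wpM2r (expR_ge0 _) le1) _.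
  rewrite -!expRD ler_expR -[delta]mul1r; apply: exponent_le => //.
    by rewrite lerDl.
  by apply: le_trans tau1_ge; rewrite ler_wpM2l// exponent_slack1.
have b2 : M2%:R * expR (- tau2) <= Ebound * expR (- (L%:R * eps)).
  apply: le_trans (ler_wpM2r (expR_ge0 _) le2) _.
  rewrite -!expRD ler_expR -[delta]mul1r; apply: exponent_le => //.
    by rewrite lerDr.
  by apply: le_trans tau2_ge; rewrite ler_wpM2l// exponent_slack1.
have b3 : M1%:R * (M2%:R * expR (- (tau1 + tau2'))) <= Ebound * expR (- (L%:R * eps)).
  rewrite mulrA.
  apply: le_trans (ler_wpM2r (expR_ge0 _)
    (ler_pM (ler0n _ _) (ler0n _ _) le1 le2)) _.
  rewrite -!expRD ler_expR.
  rewrite [X in X + _](_ : _ = n%:R * ((r1 + r2) - 2 * delta)); last by ring.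
  apply: exponent_le => //; first by rewrite addr_ge0.
  by apply: le_trans tau12_ge; rewrite ler_wpM2l// exponent_slack2 ?eps_gt0.
have d0 : 0 < decay L eps by exact: expR_gt0.
have E0 : 0 < Ebound by exact: expR_gt0.
have e1 : expR (- (L%:R * eps)) <= decay L eps.
  by rewrite /decay ler_expR lerN2 ler_wpM2l// sq_div_le ?eps_gt0.
exact: sum_bound d0 E0 e1 b1 b2 b3.
Qed.

Let sqnormZ (v : 'cV[R]_h) : sqnorm (c *: v) = c ^+ 2 * sqnorm v.
Proof. by rewrite /sqnorm big_distrr/=; apply: eq_bigr => j _; rewrite mxE exprMn. Qed.

Let mxtrace_mul_tr m m' (A : 'M[R]_(m, m')) : \tr (A *m A^T) = \sum_i \sum_j A i j ^+ 2.
Proof. by apply: eq_bigr => i _; rewrite mxE; apply: eq_bigr => j _; rewrite mxE expr2. Qed.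

Let Lh_le (P : R) : 0 < P -> L%:R * (h%:R * P) <= n%:R * P.
Proof. by move=> P0; rewrite mulrA ler_wpM2r// ltW. Qed.

Lemma exists_code : error_bound <= 1 -> exists C0 : Defs.code R n,
  [/\ valid_code C0, ln (K1 C0)%:R / n%:R > r1 - delta,
      ln (K2 C0)%:R / n%:R > r2 - delta,
      power1_ok C0 P1 /\ power2_ok N s2 C0 P2 &
      (err_prob N s2 C0 <= error_bound%:E)%E].
Proof.
move=> B1.
pose G := invmx (1%:M - B2).
pose al := G *m (B2 *m a1); pose be := G *m a2.
have alE : G *m (B2 *m (c *: a1)) = c *: al by rewrite -!scalemxAr.
have beE : G *m (c *: a2) = c *: be by rewrite -!scalemxAr.
pose dot := input_dot (c *: a1) (c *: a2) B2.
pose sg : R := if 0 <= dot then 1 else -1.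
have sg2 : sg ^+ 2 = 1 by rewrite /sg; case: ifP; rewrite ?sqrrN expr1n.
have sgdot : dot = sg * `|dot|.
  rewrite /sg; case: leP => d; first by rewrite mul1r ger0_norm.
  by rewrite mulN1r ltr0_norm// opprK.
(* The codebook has [M1.+1] words: the rate bound is strict since [M1.+1] exceeds the exponential,
   while the number of wrong messages is [M1], which does not. *)
have [M1 [M1_le M1_gt]] : exists M, M%:R <= expR (n%:R * (r1 - delta)) /\
    expR (n%:R * (r1 - delta)) < M.+1%:R.
  exists (Num.truncn (expR (n%:R * (r1 - delta)))).
  by rewrite Num.Theory.truncn_le expR_ge0 Num.Theory.truncnS_gt.
have [M2 [M2_le M2_gt]] : exists M, M%:R <= expR (n%:R * (r2 - delta)) /\
    expR (n%:R * (r2 - delta)) < M.+1%:R.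
  exists (Num.truncn (expR (n%:R * (r2 - delta)))).
  by rewrite Num.Theory.truncn_le expR_ge0 Num.Theory.truncnS_gt.
have [c1 [c2 [err w1 w2 w3]]] := @good_codebook R h n L p1 q1 p2 q2 eps sg
  (ltn0Sn _) (leq_divM _ _) eps_gt0 eps_le1 sg2 M1.+1 M2.+1 error_bound
  (ltn0Sn _) (ltn0Sn _) B1 (total_bound M1_le M2_le).
have gain (b b' : 'cV[R]_h) : (receiver N s2 B2 C c b)^T *m (c *: b') =
    (receiver N s2 B2 C c b)^T *m QP N s2 B2 *m receiver N s2 B2 C c b'.
  by rewrite receiver_gain// receiver_noise.
have gain21 : u2^T *m (c *: a1) = u1^T *m QP N s2 B2 *m u2.
  by rewrite /u1 /u2 receiver_gain// receiver_noise// snrC.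
have Lc (S : R) : 0 <= S -> c ^+ 2 * S * (L%:R * (1 + eps / 2)) <= L%:R * S.
  move=> S0; rewrite [leLHS](_ : _ = c ^+ 2 * (1 + eps / 2) * (L%:R * S)); last by ring.
  rewrite ler_piMl ?mulr_ge0// c2E mulrC ler_pdivrMr// mul1r lerD2l.
  by rewrite ler_pdivrMr// ler_peMr ?ler1n// ltW.
exists (block_code N s2 (c *: a1) (c *: a2) B2 u1 u2 eps c1 c2); split.
- exact: block_code_valid.
- by rewrite /= ltr_pdivlMr ?ltr0n// -ltr_expR lnK ?posrE ?ltr0n// mulrC.
- by rewrite /= ltr_pdivlMr ?ltr0n// -ltr_expR lnK ?posrE ?ltr0n// mulrC.
- split.
  + apply: le_trans (block_power1 (c *: a1) w1) _; rewrite sqnormZ.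
    apply: le_trans (Lh_le P10); apply: le_trans (Lc _ (sqnorm_ge0 _)) _.
    rewrite ler_wpM2l//; move: pow1; rewrite /power_P1 mxE; congr (_ <= _).
    by apply: eq_bigr => j _; rewrite mxE expr2.
  + apply: le_trans (block_power2 u1 u2 (ltW N0) s20 B2low w1 w2 sgdot w3 (ltW eps_gt0)) _.
    rewrite lee_fin; apply: le_trans (Lh_le P20); rewrite ler_wpM2l//.
    rewrite -/G alE beE !sqnormZ -mulrDr mulrA c2E mulfV ?gt_eqF// mul1r.
    move: pow2; rewrite /power_P2; congr (_ <= _); rewrite -/G.
    rewrite (_ : G *m _ *m G^T = be *m be^T + al *m al^T +
      (N + s2) *: ((G *m B2) *m (G *m B2)^T)); last first.
      rewrite !(mulmxDr, mulmxDl) -!(scalemxAr, scalemxAl).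
      by rewrite /al /be !trmx_mul !mulmxA.
    rewrite !mxtraceD mxtraceZ !mxtrace_mul_tr.
    have col1 (v : 'cV[R]_h) : \sum_i \sum_j v i j ^+ 2 = sqnorm v.
      by apply: eq_bigr => j _; rewrite big_ord1.
    by rewrite !col1 [sqnorm be + _]addrC big_distrr.
- pose E m1 m2 (g : n.-tuple (R * R)) := block_dec N s2 B2 u1 u2 eps c1 c2
    (Yout N s2 (c := block_code N s2 (c *: a1) (c *: a2) B2 u1 u2 eps c1 c2) m1 m2 g)
    != (m1, m2).
  apply: le_trans (err E _); last first.
    move=> m1 m2 g; exact: (block_dec_error (ltW N0) s20 B2low
      (gain _ _) (gain _ _) gain21 (gain _ _)).
  rewrite /err_prob lee_wpmul2l ?lee_fin ?invr_ge0//.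
  apply: lee_sum => m1 _; apply: lee_sum => m2 _.
  rewrite le_eqVlt; apply/orP; left; apply/eqP; congr gauss_int.
  by apply/funext => g; rewrite /E /=; case: eqP.
Qed.

End achievability.

Lemma decay_eventually (R : realType) (h : nat) (eps D m : R) :
  (0 < h)%N -> 0 < eps -> 0 < D -> 0 < m ->
  exists n1, forall n, (n1 <= n)%N -> D * decay (n %/ h) eps <= m.
Proof.
move=> h0 e0 D0 m0; pose kap := eps ^+ 2 / 64.
have k0 : 0 < kap by rewrite divr_gt0// exprn_gt0.
pose l := (Num.truncn (D / (m * kap))).+1.
exists (l * h)%N => n ln.
have Ll : (l <= n %/ h)%N by rewrite leq_divRL.
have lD : D <= m * ((n %/ h)%:R * kap).
  rewrite mulrCA -ler_pdivrMr ?mulr_gt0//.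
  apply: le_trans (ltW (Num.Theory.truncnS_gt _)) _.
  by rewrite ler_nat.
rewrite /decay -/kap expRN ler_pdivrMr ?expR_gt0//; apply: le_trans lD _.
rewrite ler_wpM2l ?(ltW m0)//; apply: le_trans (expR_ge1Dx _).
by rewrite lerDr.
Qed.

Lemma rate_bounds_achievable (R : realType) (P1 P2 N s2 r1 r2 : R) (e k : nat)
    (a1 a2 : 'cV[R]_e.+1) (B2 : 'M[R]_e.+1) (C : 'M[R]_(k, e.+1)) :
  0 < P1 -> 0 < P2 -> 0 < N -> 0 <= s2 -> C *m C^T \in unitmx ->
  strictly_lower B2 -> power_P1 P1 a1 -> power_P2 P2 N s2 a1 a2 B2 ->
  rate_bounds N s2 a1 a2 B2 C r1 r2 -> achievable P1 P2 N s2 r1 r2.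
Proof.
move=> P10 P20 N0 s20 CC low pow1 pow2 rates delta d0.
pose eps := Num.min 1 (e.+1%:R * delta / 3).
have e0 : 0 < eps by rewrite lt_min ltr01 /= divr_gt0// mulr_gt0.
pose D := 2 * (6 + 3 * expR (e.+1%:R * (r1 + r2))).
have D0 : 0 < D by rewrite mulr_gt0// addr_gt0// mulr_gt0// expR_gt0.
have boundE n : error_bound r1 r2 e delta n = D * decay (n %/ e.+1) eps.
  by rewrite /error_bound mulrA.
have [n1 n1P] := decay_eventually (ltn0Sn e) e0 D0 ltr01.
have ex n : exists c : Defs.code R n, (maxn 1 n1 <= n)%N ->
  [/\ valid_code c, ln (K1 c)%:R / n%:R > r1 - delta,
      ln (K2 c)%:R / n%:R > r2 - delta,
      power1_ok c P1 /\ power2_ok N s2 c P2 &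
      (err_prob N s2 c <= (D * decay (n %/ e.+1) eps)%:E)%E].
  (* From [maxn 1 n1] on, [n] is positive and the error bound is at most one, as the power
     constraints require; below it any code will do. *)
  have [le|lt] := leqP (maxn 1 n1) n; last first.
    by exists (Code (fun (_ : 'I_1) _ => 0) (fun (_ : 'I_1) _ _ => 0)
      (fun=> (ord0, ord0))).
  move: le; rewrite geq_max => /andP[n0 nn1].
  have := @exists_code R N s2 P1 P2 r1 r2 e k a1 a2 B2 C delta P10 P20 N0 s20 d0 CC
    low pow1 pow2 rates n n0; rewrite boundE => /(_ (n1P _ nn1)) [c Hc].
  by exists c.
pose c n := projT1 (cid (ex n)); have cP n := projT2 (cid (ex n)).
exists (maxn 1 n1), c; split.
  by move=> n nn; have [? ? ? [? ?] _] := cP n nn.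
move=> m m0; have [n2 n2P] := decay_eventually (ltn0Sn e) e0 D0 m0.
exists (maxn (maxn 1 n1) n2) => n; rewrite geq_max => /andP[nn nn2].
have [_ _ _ _ err] := cP n nn.
by apply: le_trans err _; rewrite lee_fin n2P.
Qed.

Lemma zero_rates_achievable (R : realType) (P1 P2 N s2 : R) :
  0 < P1 -> 0 < P2 -> achievable P1 P2 N s2 0 0.
Proof.
move=> P10 P20 delta d0.
have int0 n : gauss_int (fun _ : n.-tuple (R * R) => 0%E : \bar R) = 0%E.
  by rewrite gauss_intE// integral_prob_cst.
pose c n : Defs.code R n := Code (fun (_ : 'I_1) _ => 0) (fun (_ : 'I_1) _ _ => 0)
  (fun=> (ord0, ord0)).
exists 0%N, c; split.
- move=> n _; split.
  + split=> //; first by move=> m t _; exact: measurable_cst.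
    move=> p; have [->|ne] := eqVneq p (ord0, ord0).
      by rewrite (_ : _ @^-1` _ = setT)//; apply/seteqP; split.
    rewrite (_ : _ @^-1` _ = set0)//; apply/seteqP; split => // x /= e.
    by rewrite e eqxx in ne.
  + by rewrite /= ln1 mul0r sub0r oppr_lt0.
  + by rewrite /= ln1 mul0r sub0r oppr_lt0.
  + rewrite /power1_ok /= big1 ?mulr_ge0// ?ltW// => t _.
    by rewrite big1 ?mulr0// => m _; rewrite expr0n.
  + rewrite /power2_ok /= big1 ?lee_fin ?mulr_ge0// ?ltW// => t _.
    rewrite big1 ?mule0// => m1 _; rewrite big1// => m2 _.
    by rewrite /X2 /X2of /= expr0n int0.
- move=> m m0; exists 0%N => n _; rewrite /err_prob big1 ?mule0 ?lee_fin ?ltW// => m1 _.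
  rewrite big1// => m2 _; rewrite -[RHS](int0 n); congr gauss_int.
  by apply/funext => g; rewrite /= (ord1 m1) (ord1 m2) eqxx.
Qed.

Theorem mainTheorem7 (R : realType) (P1 P2 N s2 : R) :
  0 < P1 -> 0 < P2 -> 0 < N -> 0 <= s2 ->
  R_P P1 P2 N s2 `<=` C_NoisyPartialFB P1 P2 N s2.
Proof.
move=> P10 P20 N0 s20 [r1 r2] cl delta d0.
have d20 : 0 < delta / 2 by rewrite divr_gt0.
have [[q1 q2] [[eta eta0 [a1 [a2 [B2 [C [low pow1 pow2 reg]]]]]] near_q]] :=
  cl _ (nbhsx_ballx (r1, r2) _ d20).
have [b1 b2] : `|r1 - q1| < delta / 2 /\ `|r2 - q2| < delta / 2 by [].
have lt1 : r1 - delta < q1 - delta / 2.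
  by move: b1; rewrite ltr_norml => /andP[_]; lra.
have lt2 : r2 - delta < q2 - delta / 2.
  by move: b2; rewrite ltr_norml => /andP[_]; lra.
(* Half of [delta] covers the distance to a point of the union, the other half the rate loss of the
   code for that point. *)
suff : achievable P1 P2 N s2 q1 q2.
  move=> /(_ _ d20) [n0 [c [cP err]]]; exists n0, c; split=> // n nn.
  have [v k1 k2 w1 w2] := cP n nn; split => //; exact: lt_trans k1 || exact: lt_trans k2.
case: eta eta0 a1 a2 B2 C low pow1 pow2 reg => [//|e] _ a1 a2 B2 C low pow1 pow2.
rewrite /R_P_eta /=; case: ifPn => [CC|_].
  exact: rate_bounds_achievable.
case: ifPn => [_ [i [Ci]]|_ [-> ->]]; last exact: zero_rates_achievable.
apply: rate_bounds_achievable => //.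
(* The Gram matrix of one nonzero row is a nonzero scalar, so the singular case is the same result
   with a one-row receiver. *)
rewrite unitmxE det_mx11 unitfE; apply: contra Ci => /eqP /mulmx_tr_eq0 ->.
exact: eqxx.
Qed.
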